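(* Let $\omega$ be a weight function. The space $\mathcal{U}_{(\omega)}(\mathbb{C})$ is non-trivial if and only if $\omega$ satisfies $$(\epsilon)_0\qquad \int_0^\infty \omega(t)e^{-\mu t}\,dt<\infty\ \text{ for all } \mu>0.$$ If, in addition, $\omega$ satisfies $$(\delta)\qquad 2\omega(t)\le\omega(Ht)+\log A,\quad t\ge 0,\ \text{ for some } A,H\ge 1,$$ then $\mathcal{U}_{(\omega)}(\mathbb{C})$ is dense in $\mathcal{A}^h_{(\omega)}$ for all $h>0$.
   Context: A weight function is a non-decreasing function $\omega:[0,\infty)\to[0,\infty)$, always assumed to satisfy $\lim_{t\to\infty}\omega(t)/\log t=\infty$; it is extended to $\mathbb{R}$ by $\omega(t)=\omega(|t|)$. Write $z=x+iy$ and $T^h=\mathbb{R}+i(-h,h)$. For $h,\lambda>0$, $\mathcal{A}_\omega^{h,\lambda}$ is the Banach space of all analytic functions $\varphi$ on $T^h$ with $$\|\varphi\|^{h,\lambda}:=\sup_{z\in T^h}|\varphi(z)|e^{\omega(\lambda x)}<\infty.$$ $\mathcal{U}_{(\omega)}(\mathbb{C})=\varprojlim_{h\to\infty}\varprojlim_{\lambda\to\infty}\mathcal{A}_\omega^{h,\lambda}$ is the space of entire functions $\varphi$ with $\|\varphi\|^{h,\lambda}<\infty$ for all $h,\lambda>0$. $\mathcal{A}^h_{(\omega)}=\varprojlim_{k\to h^-}\varprojlim_{\lambda\to\infty}\mathcal{A}_\omega^{k,\lambda}$ is the space of analytic functions $\varphi$ on $T^h$ with $\|\varphi\|^{k,\lambda}<\infty$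 for all $0<k<h$ and $\lambda>0$, topologized by these norms. A space is non-trivial if it contains a function that is not identically zero. *)

(* Defs.v *)
From Stdlib Require Import Reals List.
From Coquelicot Require Import Coquelicot.
Open Scope R_scope.

(* A weight function lives on [0, +oo): only the values of [w] at nonnegative
   arguments are constrained or ever used.  The even extension to the real line
   is [fun t => w (Rabs t)]. *)
Definition weight_function (w : R -> R) : Prop :=
  (forall t, 0 <= t -> 0 <= w t) /\
  (forall s t, 0 <= s -> s <= t -> w s <= w t) /\
  is_lim (fun t => w t / ln t) p_infty p_infty.

Definition even_ext (w : R -> R) (t : R) : R := w (Rabs t).

Definition strip (h : R) (z : C) : Prop := - h < Im z < h.

(* [ex_derive] over the absolute ring C is complex differentiability; the
   domains used below are open. *)
Definition analytic_on (D : C -> Prop) (f : C -> C) : Prop :=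
  forall z : C, D z -> ex_derive (K := C_AbsRing) (V := C_NormedModule) f z.

Definition entire (f : C -> C) : Prop := analytic_on (fun _ => True) f.

(* The supremum is taken in the extended reals, so it may be [p_infty]. *)
Definition wnorm (w : R -> R) (h lam : R) (f : C -> C) : Rbar :=
  Lub_Rbar (fun r => exists z : C,
    strip h z /\ r = Cmod (f z) * exp (even_ext w (lam * Re z))).

Definition U_space (w : R -> R) (f : C -> C) : Prop :=
  entire f /\
  forall h lam, 0 < h -> 0 < lam -> Rbar_lt (wnorm w h lam f) p_infty.

(* Functions on the strip are represented by total functions on C whose values
   off the strip are irrelevant; restriction to the strip is thus implicit. *)
Definition A_space (w : R -> R) (h : R) (f : C -> C) : Prop :=
  analytic_on (strip h) f /\
  forall k lam, 0 < k < h -> 0 < lam -> Rbar_lt (wnorm w k lam f) p_infty.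

Definition nontrivial (S : (C -> C) -> Prop) : Prop :=
  exists f, S f /\ exists z : C, f z <> RtoC 0.

(* Neighbourhoods of [f] in the locally convex topology generated on
   [A_space w h] by the norms [wnorm w k lam], 0 < k < h, 0 < lam: the sets
   containing a finite intersection of balls centred at [f]. *)
Definition A_nbhs (w : R -> R) (h : R) (f : C -> C)
    (P : (C -> C) -> Prop) : Prop :=
  exists (l : list (R * R)) (eps : R),
    0 < eps /\
    (forall k lam, In (k, lam) l -> 0 < k < h /\ 0 < lam) /\
    forall g, A_space w h g ->
      (forall k lam, In (k, lam) l ->
         Rbar_lt (wnorm w k lam (fun z => Cminus (g z) (f z))) (Finite eps)) ->
      P g.

Definition dense_in_A (w : R -> R) (h : R) (S : (C -> C) -> Prop) : Prop :=
  (forall g, S g -> A_space w h g) /\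
  forall f, A_space w h f ->
    forall P, A_nbhs w h f P -> exists g, A_space w h g /\ S g /\ P g.

(* The integrand is nonnegative and Riemann integrable on bounded intervals
   when [w] is a weight function, so finiteness of the integral is convergence
   of the improper Riemann integral. *)
Definition epsilon0 (w : R -> R) : Prop :=
  forall mu, 0 < mu ->
    ex_RInt_gen (V := R_NormedModule) (fun t => w t * exp (- (mu * t)))
      (at_point 0) (Rbar_locally p_infty).

Definition delta (w : R -> R) : Prop :=
  exists A H, 1 <= A /\ 1 <= H /\
    forall t, 0 <= t -> 2 * w t <= w (H * t) + ln A.

(* Main.v *)
Require Import Defs.
From Stdlib Require Import Reals Lra Lia Psatz ZArith List Classical FunctionalExtensionality.
From Coquelicot Require Import Coquelicot.
Open Scope R_scope.

(** Everything rests on one reformulation: since w is monotone, the integral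
    condition holds exactly when w(t) = O(exp(mu t)) for every mu > 0
    (subexponential; epsilon0_subexponential, subexponential_epsilon0).  Because
    every dilation lam is allowed in the norms, the same condition also governs
    the strips of finite width.

    Necessity (A_space_trivial).  If w fails to be subexponential, then for any
    prescribed b a suitable lam makes w(lam x) exceed A exp(b x) at some x, for
    arbitrarily large A.  For a function f of the space on a strip, take
    b = PI / (2k) and multiply f by exp(2 A cosh(b z)).  The extra factor has
    modulus one on the lines Im z = k and Im z = -k, and on the vertical lines
    Re z = x and Re z = -x it is compensated by the decay of f, so the maximum
    principle on the rectangle gives |f(z)| exp(2 A cosh(b Re z) cos(b Im z)) <= M
    inside.  Letting A grow forces f = 0 (strip_uniqueness).  So a space on a
    strip can only be nontrivial when the integral condition holds, and the same
    is true of the space of entire functions, which it contains.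

    The maximum principle is obtained from Goursat's theorem on rectangles
    (goursat), Cauchy's formula with an uncomputed but nonzero constant
    (cauchy_formula, cauchy_kernel_nonzero), and the powers f^n: they give
    |f(z0)|^n <= K B^n with K independent of n.

    Sufficiency (rapidly_decreasing_entire).  The function is exp(-F) with
    F(z) = sum_n (z / 2^n)^(2 k_n), where k_n = o(2^n).  On a fixed strip
    |Im z| <= H each term with |Re z| large compared with k_n H has an argument
    close to a multiple of 2 PI, hence a positive real part comparable to its
    modulus; where |Re z| is not that large, the term is tiny because k_n H is
    small compared with 2^n.  So Re F is bounded below and dominates every
    single term.  A subexponential w leaves room to choose the k_n so large that
    these terms beat w(lam x) for all lam at once (slow_majorant,
    lacunary_exponents).

    Density.  If w is not subexponential, the space on the strip contains only
    the zero function and there is nothing to approximate.  Otherwise exp(-F) is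
    positive on the real line, so its dilations, normalised, form an approximate
    identity kappa (mollifier_exists).  The approximants are Riemann sums of
    the integral of f(t) kappa(z - t) over a real segment, that is, finite
    combinations of translates of kappa (riemann_approximation).  For z = x + i y
    the path of integration is moved to height y (contour_shift), which turns the
    integral into an average of the values f(x - s + i y) against kappa(s); it is
    close to f(z) in the weighted norm (mollification_error).  Condition delta is
    used through rapid_vanish: the weighted modulus of a function of the space
    tends to zero at infinity, so that every uniform estimate reduces to uniform
    continuity on a compact rectangle. *)

(** * Complex differentiability *)

Lemma Im_le_Cmod (z : C) : Rabs (Im z) <= Cmod z.
Proof.
  replace (Im z) with (- Re (z * Ci)%C) by (rewrite re_mult_Ci; ring).
  rewrite Rabs_Ropp.
  apply Rle_trans with (1 := re_le_Cmod _).
  rewrite Cmod_mult. rewrite <- (Rmult_1_r (Cmod z)) at 2.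
  apply Rmult_le_compat_l. apply Cmod_ge_0.
  unfold Cmod, Ci; simpl. replace (0*(0*1)+1*(1*1)) with 1 by ring. rewrite sqrt_1; lra.
Qed.

Lemma Cmod_le_abs (z : C) : Cmod z <= Rabs (Re z) + Rabs (Im z).
Proof.
  rewrite <- (Rabs_pos_eq (Rabs (Re z) + Rabs (Im z))).
  2: generalize (Rabs_pos (Re z)) (Rabs_pos (Im z)); lra.
  unfold Cmod. rewrite <- sqrt_Rsqr_abs. apply sqrt_le_1_alt.
  unfold Rsqr. fold (Re z) (Im z).
  generalize (Rabs_pos (Re z)) (Rabs_pos (Im z)) (Rsqr_abs (Re z)) (Rsqr_abs (Im z)).
  unfold Rsqr. intros. nra.
Qed.

Lemma Cmod_minus_sym (z w : C) : Cmod (z - w) = Cmod (w - z).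
Proof. rewrite <- Cmod_opp. f_equal. ring. Qed.

Lemma Cmod_minus_le (z w : C) : Cmod (z - w) <= Cmod z + Cmod w.
Proof. unfold Cminus. rewrite <- (Cmod_opp w). apply Cmod_triangle. Qed.

Lemma Cmod_tri (x y z : C) : Cmod (x - z) <= Cmod (x - y) + Cmod (y - z).
Proof. replace (x - z)%C with ((x-y)+(y-z))%C by ring. apply Cmod_triangle. Qed.

Definition ccont (f : C -> C) (z : C) :=
  forall eps, 0 < eps -> exists d, 0 < d /\
    forall w, Cmod (w - z) < d -> Cmod (f w - f z) < eps.

Lemma ccont_const c z : ccont (fun _ => c) z.
Proof.
  intros e He; exists 1; split; [lra|]. intros w _.
  replace (c - c)%C with (RtoC 0) by ring. rewrite Cmod_0; lra.
Qed.

Lemma ccont_id z : ccont (fun w => w) z.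
Proof. intros e He; exists e; split; auto. Qed.

Lemma ccont_ext f g z : (forall w, f w = g w) -> ccont f z -> ccont g z.
Proof.
  intros E H e He. destruct (H e He) as [d [Hd K]]. exists d; split; auto.
  intros w Hw. rewrite <- !E. auto.
Qed.

Lemma ccont_local f g z r : 0 < r -> (forall w, Cmod (w - z) < r -> f w = g w) ->
  ccont f z -> ccont g z.
Proof.
  intros Hr E H e He. destruct (H e He) as [d [Hd K]]. exists (Rmin r d); split.
  apply Rmin_glb_lt; auto.
  intros w Hw. rewrite <- !E. apply K. eapply Rlt_le_trans; [exact Hw| apply Rmin_r].
  replace (z - z)%C with (RtoC 0) by ring. rewrite Cmod_0; lra.
  eapply Rlt_le_trans; [exact Hw| apply Rmin_l].
Qed.

Lemma ccont_plus f g z : ccont f z -> ccont g z -> ccont (fun w => f w + g w)%C z.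
Proof.
  intros Hf Hg e He.
  destruct (Hf (e/2)) as [d1 [D1 H1]]; [lra|].
  destruct (Hg (e/2)) as [d2 [D2 H2]]; [lra|].
  exists (Rmin d1 d2); split. apply Rmin_glb_lt; auto.
  intros w Hw.
  replace (f w + g w - (f z + g z))%C with ((f w - f z) + (g w - g z))%C by ring.
  generalize (Rmin_l d1 d2) (Rmin_r d1 d2); intros.
  generalize (H1 w) (H2 w) (Cmod_triangle (f w - f z) (g w - g z)). lra.
Qed.

Lemma ccont_mult f g z : ccont f z -> ccont g z -> ccont (fun w => f w * g w)%C z.
Proof.
  intros Hf Hg e He.
  set (A := Cmod (f z) + Cmod (g z) + 1).
  assert (HA : 0 < A).
  { unfold A; generalize (Cmod_ge_0 (f z)) (Cmod_ge_0 (g z)); lra. }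
  set (e' := Rmin 1 (e / (2 * A))).
  assert (He' : 0 < e').
  { unfold e'. apply Rmin_glb_lt. lra. apply Rdiv_lt_0_compat; lra. }
  assert (Hb : 2 * A * e' <= e).
  { apply Rle_trans with (2 * A * (e / (2 * A))).
    apply Rmult_le_compat_l. lra. apply Rmin_r. right. field. lra. }
  assert (Hc : e' <= 1) by apply Rmin_l.
  destruct (Hf e' He') as [d1 [D1 H1]].
  destruct (Hg e' He') as [d2 [D2 H2]].
  exists (Rmin d1 d2); split. apply Rmin_glb_lt; auto.
  intros w Hw.
  generalize (Rmin_l d1 d2) (Rmin_r d1 d2); intros.
  replace (f w * g w - f z * g z)%C with
    ((f w - f z) * (g w - g z) + f z * (g w - g z) + g z * (f w - f z))%C by ring.
  assert (K1 := H1 w ltac:(lra)). assert (K2 := H2 w ltac:(lra)).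
  eapply Rle_lt_trans. apply Cmod_triangle.
  eapply Rle_lt_trans. apply Rplus_le_compat_r. apply Cmod_triangle.
  rewrite !Cmod_mult.
  generalize (Cmod_ge_0 (f w - f z)) (Cmod_ge_0 (g w - g z)) (Cmod_ge_0 (f z)) (Cmod_ge_0 (g z)).
  intros. unfold A in *.
  assert (Cmod (f w - f z) * Cmod (g w - g z) <= e' * 1).
  { apply Rmult_le_compat; lra. }
  assert (Cmod (f z) * Cmod (g w - g z) <= Cmod (f z) * e').
  { apply Rmult_le_compat_l; lra. }
  assert (Cmod (g z) * Cmod (f w - f z) <= Cmod (g z) * e').
  { apply Rmult_le_compat_l; lra. }
  nra.
Qed.

Lemma ccont_comp f g z : ccont g z -> ccont f (g z) -> ccont (fun w => f (g w)) z.
Proof.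
  intros Hg Hf e He. destruct (Hf e He) as [d [D H]].
  destruct (Hg d D) as [d' [D' H']]. exists d'; split; auto.
Qed.

Lemma ccont_inv (z : C) : z <> 0 -> ccont Cinv z.
Proof.
  intros Hz e He. apply Cmod_gt_0 in Hz. set (r := Cmod z) in *.
  exists (Rmin (r / 2) (e * (r * r) / 2)); split.
  { assert (0 < e * (r * r)) by (repeat apply Rmult_lt_0_compat; lra). apply Rmin_glb_lt; lra. }
  intros w Hw.
  assert (A1 : Cmod (w - z) < r / 2) by (eapply Rlt_le_trans; [exact Hw|apply Rmin_l]).
  assert (A2 : Cmod (w - z) < e * (r * r) / 2) by (eapply Rlt_le_trans; [exact Hw|apply Rmin_r]).
  assert (B : r <= Cmod (w - z) + Cmod w).
  { unfold r. replace z with ((z - w) + w)%C at 1 by ring. rewrite (Cmod_minus_sym w z).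
    apply Cmod_triangle. }
  assert (Hw0 : w <> 0). { apply Cmod_gt_0. lra. }
  assert (Hz0 : z <> 0). { apply Cmod_gt_0. fold r. lra. }
  replace (/ w - / z)%C with ((z - w) * (/ w * / z))%C by (field; split; auto).
  rewrite !Cmod_mult, !Cmod_inv by auto. fold r. rewrite (Cmod_minus_sym z w).
  assert (Hi : / Cmod w <= 2 / r).
  { replace (2 / r) with (/ (r / 2)) by (field; lra). apply Rinv_le_contravar; lra. }
  assert (0 < / r) by (apply Rinv_0_lt_compat; lra).
  assert (0 < / Cmod w) by (apply Rinv_0_lt_compat; lra).
  apply Rle_lt_trans with (Cmod (w - z) * (2 / r * / r)).
  { apply Rmult_le_compat_l. apply Cmod_ge_0. apply Rmult_le_compat_r; lra. }
  replace e with (e * (r * r) / 2 * (2 / r * / r)) by (field; lra).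
  apply Rmult_lt_compat_r; auto.
  unfold Rdiv. assert (0 < 2 * / r) by lra. nra.
Qed.

(** Caratheodory's form of differentiability: the difference quotient extends
    continuously.  The product and chain rules reduce to continuity, and the
    slope function itself is the integrand needed for Cauchy's formula. *)
Definition cdiff (f : C -> C) (z : C) :=
  exists phi, ccont phi z /\ forall w, (f w - f z = phi w * (w - z))%C.

Lemma cdiff_ccont f z : cdiff f z -> ccont f z.
Proof.
  intros [phi [Hp H]].
  apply ccont_ext with (fun w => f z + phi w * (w + - z))%C.
  { intros w. change (w + - z)%C with (w - z)%C. rewrite <- H. ring. }
  apply ccont_plus. apply ccont_const.
  apply ccont_mult; auto. apply ccont_plus. apply ccont_id. apply ccont_const.
Qed.

Lemma cdiff_ext f g z : (forall w, f w = g w) -> cdiff f z -> cdiff g z.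
Proof.
  intros E [phi [Hp H]]. exists phi; split; auto. intros w. rewrite <- !E; auto.
Qed.

Lemma cdiff_const c z : cdiff (fun _ => c) z.
Proof. exists (fun _ => RtoC 0); split. apply ccont_const. intros; ring. Qed.

Lemma cdiff_id z : cdiff (fun w => w) z.
Proof. exists (fun _ => RtoC 1); split. apply ccont_const. intros; ring. Qed.

Lemma cdiff_plus f g z : cdiff f z -> cdiff g z -> cdiff (fun w => f w + g w)%C z.
Proof.
  intros [p [P Hf]] [q [Q Hg]]. exists (fun w => p w + q w)%C; split.
  apply ccont_plus; auto. intros w.
  rewrite Cmult_plus_distr_r, <- Hf, <- Hg. ring.
Qed.

Lemma cdiff_mult f g z : cdiff f z -> cdiff g z -> cdiff (fun w => f w * g w)%C z.
Proof.
  intros Hf Hg. assert (Cf := cdiff_ccont _ _ Hf).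
  destruct Hf as [p [P Hf]], Hg as [q [Q Hg]].
  exists (fun w => f w * q w + g z * p w)%C; split.
  apply ccont_plus; apply ccont_mult; auto; apply ccont_const.
  intros w. rewrite Cmult_plus_distr_r, <- !Cmult_assoc, <- Hf, <- Hg. ring.
Qed.

Lemma cdiff_minus f g z : cdiff f z -> cdiff g z -> cdiff (fun w => f w - g w)%C z.
Proof.
  intros Hf Hg. apply cdiff_ext with (fun w => f w + (- RtoC 1) * g w)%C.
  intros w. ring.
  apply cdiff_plus; auto. apply cdiff_mult; auto. apply cdiff_const.
Qed.

Lemma cdiff_pow f n z : cdiff f z -> cdiff (fun w => f w ^ n)%C z.
Proof.
  intros H; induction n as [|n IH]; simpl. apply cdiff_const. now apply cdiff_mult.
Qed.

Lemma cdiff_comp f g z : cdiff g z -> cdiff f (g z) -> cdiff (fun w => f (g w)) z.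
Proof.
  intros Hg Hf. assert (Cg := cdiff_ccont _ _ Hg).
  destruct Hf as [p [P Hf]], Hg as [q [Q Hg]].
  exists (fun w => p (g w) * q w)%C; split.
  apply ccont_mult; auto. apply ccont_comp with (f := p); auto.
  intros w. rewrite Hf, Hg. ring.
Qed.

Lemma cdiff_inv (z : C) : z <> 0 -> cdiff Cinv z.
Proof.
  intros Hz.
  (* away from 0 the slope is -1/(wz); at w = 0, where the total inverse takes a
     conventional value, it has to be the actual quotient *)
  exists (fun w => if Ceq_dec w 0 then (/ w - / z) / (w - z) else - (/ w * / z))%C; split.
  - assert (Hm := Hz). apply Cmod_gt_0 in Hm.
    apply ccont_local with (fun w => (- RtoC 1) * (/ w * / z))%C (Cmod z); auto.
    + intros w Hw. destruct (Ceq_dec w 0) as [->|Hw0].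
      * exfalso. replace (0 - z)%C with (- z)%C in Hw by ring. rewrite Cmod_opp in Hw. lra.
      * ring.
    + apply ccont_mult. apply ccont_const. apply ccont_mult. now apply ccont_inv. apply ccont_const.
  - intros w. destruct (Ceq_dec w 0) as [->|Hw0].
    + assert (0 - z <> 0)%C.
      { intro E. apply Hz. replace z with (- (0 - z))%C by ring. rewrite E. ring. }
      unfold Cdiv. rewrite <- Cmult_assoc, Cinv_l, Cmult_1_r; auto.
    + field; split; auto.
Qed.

(** The slope function is the difference quotient, completed at z by the
    derivative. *)
Lemma ex_derive_cdiff (f : C -> C) (z : C) :
  ex_derive (K := C_AbsRing) (V := C_NormedModule) f z <-> cdiff f z.
Proof.
  split.
  - intros [l [_ H]].
    specialize (H z (fun P HP => HP)).
    exists (fun w => if Ceq_dec w z then l else (f w - f z) / (w - z))%C.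
    assert (Hne : forall w, w <> z -> (w - z)%C <> 0).
    { intros w Hw E. apply Hw. apply Ceq_minus. exact E. }
    split.
    + intros e He. 
      destruct (H (mkposreal (e/2) ltac:(lra))) as [d Hd].
      exists d; split. apply cond_pos.
      intros w Hw. destruct (Ceq_dec z z) as [_|]; [|now contradiction].
      destruct (Ceq_dec w z) as [->|Hwz].
      replace (l - l)%C with (RtoC 0) by ring. rewrite Cmod_0; lra.
      assert (K := Hd w Hw). simpl in K.
      change (Cmod ((f w - f z) - (w - z) * l) <= e / 2 * Cmod (w - z)) in K.
      replace ((f w - f z) / (w - z) - l)%C with (((f w - f z) - (w - z) * l) / (w - z))%C.
      2: field; apply Hne; auto.
      assert (N := Hne w Hwz). rewrite Cmod_div by auto.
      apply Cmod_gt_0 in N. apply Rle_lt_trans with (e/2); [|lra].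
      apply Rle_div_l; auto.
    + intros w. destruct (Ceq_dec w z) as [->|Hwz]. ring. field. apply Hne; auto.
  - intros [phi [Hp H]]. exists (phi z). split.
    + apply is_linear_scal_l.
    + intros x Hx. assert (E : z = x).
      { apply (is_filter_lim_locally_unique (V := AbsRing_NormedModule C_AbsRing)). exact Hx. }
      subst x. clear Hx. intros eps.
      destruct (Hp eps (cond_pos eps)) as [d [D K]].
      exists (mkposreal d D). intros w Hw.
      change (Cmod ((f w - f z) - (w - z) * phi z) <= eps * Cmod (w - z)).
      rewrite H. replace (phi w * (w - z) - (w - z) * phi z)%C with ((phi w - phi z) * (w - z))%C by ring.
      rewrite Cmod_mult. apply Rmult_le_compat_r. apply Cmod_ge_0.
      left. apply K. exact Hw.
Qed.

(** * Integrals of complex functions along segments *)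

Definition cint (g : R -> C) (a b : R) : C := RInt (V := C_R_CompleteNormedModule) g a b.
Definition cintable (g : R -> C) (a b : R) : Prop := ex_RInt (V := C_R_CompleteNormedModule) g a b.

Lemma cint_ext f g a b : a <= b -> (forall x, a <= x <= b -> f x = g x) -> cint f a b = cint g a b.
Proof.
  intros H E. apply (RInt_ext (V := C_R_CompleteNormedModule)). intros x Hx.
  rewrite Rmin_left, Rmax_right in Hx by auto. apply E; lra.
Qed.

Lemma cint_plus f g a b : cintable f a b -> cintable g a b ->
  cint (fun x => f x + g x)%C a b = (cint f a b + cint g a b)%C.
Proof. intros; apply (RInt_plus (V := C_R_CompleteNormedModule)); auto. Qed.

Lemma cint_minus f g a b : cintable f a b -> cintable g a b ->
  cint (fun x => f x - g x)%C a b = (cint f a b - cint g a b)%C.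
Proof. intros; apply (RInt_minus (V := C_R_CompleteNormedModule)); auto. Qed.

Lemma cintable_minus f g a b : cintable f a b -> cintable g a b ->
  cintable (fun x => f x - g x)%C a b.
Proof. intros; apply (ex_RInt_minus (V := C_R_CompleteNormedModule)); auto. Qed.

Lemma cint_const c a b : cint (fun _ => c) a b = (RtoC (b - a) * c)%C.
Proof. unfold cint. rewrite (RInt_const (V := C_R_CompleteNormedModule)). apply scal_R_Cmult. Qed.

Lemma cint_Chasles f a b c : cintable f a b -> cintable f b c ->
  cint f a c = (cint f a b + cint f b c)%C.
Proof. intros; symmetry; apply (RInt_Chasles (V := C_R_CompleteNormedModule)); auto. Qed.

Lemma cint_Re f a b : cintable f a b -> ex_RInt (fun x => Re (f x)) a b /\
  Re (cint f a b) = RInt (fun x => Re (f x)) a b.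
Proof.
  intros H. apply (RInt_correct (V := C_R_CompleteNormedModule)) in H.
  apply (is_RInt_fct_extend_fst (U := R_NormedModule) (V := R_NormedModule)) in H.
  split. eexists; exact H. symmetry. now apply is_RInt_unique.
Qed.

Lemma cint_Im f a b : cintable f a b -> ex_RInt (fun x => Im (f x)) a b /\
  Im (cint f a b) = RInt (fun x => Im (f x)) a b.
Proof.
  intros H. apply (RInt_correct (V := C_R_CompleteNormedModule)) in H.
  apply (is_RInt_fct_extend_snd (U := R_NormedModule) (V := R_NormedModule)) in H.
  split. eexists; exact H. symmetry. now apply is_RInt_unique.
Qed.

Lemma is_cint_pair f a b u v :
  is_RInt (fun x => Re (f x)) a b u -> is_RInt (fun x => Im (f x)) a b v ->
  cintable f a b /\ cint f a b = (u, v).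
Proof.
  intros Hu Hv.
  assert (H := is_RInt_fct_extend_pair (U := R_NormedModule) (V := R_NormedModule) f a b u v Hu Hv).
  split. eexists; exact H.
  apply (is_RInt_unique (V := C_R_CompleteNormedModule)). exact H.
Qed.

(** The integral is linear over the reals by construction; a complex factor mixes
    the real and imaginary parts, so they are treated separately. *)
Lemma cint_mult c f a b : cintable f a b ->
  cintable (fun x => c * f x)%C a b /\ cint (fun x => c * f x)%C a b = (c * cint f a b)%C.
Proof.
  intros H. destruct (cint_Re _ _ _ H) as [R1 R2], (cint_Im _ _ _ H) as [I1 I2].
  apply (RInt_correct (V := R_CompleteNormedModule)) in R1. apply (RInt_correct (V := R_CompleteNormedModule)) in I1. rewrite <- R2 in R1. rewrite <- I2 in I1.
  destruct c as [p q].
  assert (K := is_cint_pair (fun x => (p, q) * f x)%C a b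
    (p * Re (cint f a b) - q * Im (cint f a b)) (p * Im (cint f a b) + q * Re (cint f a b))).
  destruct K as [K1 K2].
  - apply (is_RInt_minus (V := R_NormedModule)); apply (is_RInt_scal (V := R_NormedModule)); auto.
  - apply (is_RInt_plus (V := R_NormedModule)); apply (is_RInt_scal (V := R_NormedModule)); auto.
  - split; auto.
Qed.

Lemma cint_bound f a b g I : a <= b -> cintable f a b ->
  (forall x, a <= x <= b -> Cmod (f x) <= g x) -> is_RInt g a b I -> Cmod (cint f a b) <= I.
Proof.
  intros H F K G. rewrite Cmod_norm.
  refine (norm_RInt_le (V := C_R_NormedModule) f g a b _ I H _ _ G).
  - intros x Hx. rewrite <- Cmod_norm. auto.
  - exact (RInt_correct (V := C_R_CompleteNormedModule) f a b F).
Qed.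

Lemma cint_bound_const f a b M : a <= b -> cintable f a b ->
  (forall x, a <= x <= b -> Cmod (f x) <= M) -> Cmod (cint f a b) <= (b - a) * M.
Proof.
  intros H F K. apply cint_bound with (fun _ => M); auto.
  apply (is_RInt_const (V := R_NormedModule)).
Qed.

Definition pcont (g : R -> C) (t : R) := forall e, 0 < e -> exists d, 0 < d /\
  forall s, Rabs (s - t) < d -> Cmod (g s - g t) < e.

Lemma pcont_continuous g t : pcont g t -> continuous (T := R_UniformSpace) (U := C_R_CompleteNormedModule) g t.
Proof.
  intros H. apply filterlim_locally. intros [e He].
  destruct (H e He) as [d [D K]]. exists (mkposreal d D). intros s Hs.
  assert (B := K s Hs). split; simpl.
  - change (Rabs (Re (g s) - Re (g t)) < e).
    eapply Rle_lt_trans; [|exact B]. apply (re_le_Cmod (g s - g t)).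
  - change (Rabs (Im (g s) - Im (g t)) < e).
    eapply Rle_lt_trans; [|exact B]. apply (Im_le_Cmod (g s - g t)).
Qed.

Lemma pcont_cintable g a b : a <= b -> (forall t, a <= t <= b -> pcont g t) -> cintable g a b.
Proof.
  intros H K. apply (ex_RInt_continuous (V := C_R_CompleteNormedModule)).
  intros z Hz. rewrite Rmin_left, Rmax_right in Hz by auto.
  apply pcont_continuous; auto.
Qed.

Lemma Cmod_hor (s : R) : Cmod (s, 0) = Rabs s.
Proof. apply (Cmod_R s). Qed.

Lemma Cmod_ver (s : R) : Cmod (0, s) = Rabs s.
Proof.
  unfold Cmod; simpl. rewrite <- sqrt_Rsqr_abs. f_equal. unfold Rsqr; ring.
Qed.

Lemma Cdist_hor x x' y : Cmod ((x', y) - (x, y))%C = Rabs (x' - x).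
Proof. rewrite <- Cmod_hor. f_equal. apply injective_projections; simpl; ring. Qed.

Lemma Cdist_ver x y y' : Cmod ((x, y') - (x, y))%C = Rabs (y' - y).
Proof. rewrite <- Cmod_ver. f_equal. apply injective_projections; simpl; ring. Qed.

Lemma ccont_hor f x y : ccont f (x, y) -> pcont (fun s => f (s, y)) x.
Proof.
  intros H e He. destruct (H e He) as [d [D K]]. exists d; split; auto.
  intros s Hs. apply K. rewrite Cdist_hor; auto.
Qed.

Lemma ccont_ver f x y : ccont f (x, y) -> pcont (fun s => f (x, s)) y.
Proof.
  intros H e He. destruct (H e He) as [d [D K]]. exists d; split; auto.
  intros s Hs. apply K. rewrite Cdist_ver; auto.
Qed.

(** * Goursat's theorem on rectangles *)

Definition on_rect (P : C -> Prop) (a b c d : R) :=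
  forall x y, a <= x <= b -> c <= y <= d -> P (x, y).

Definition on_boundary (P : C -> Prop) (a b c d : R) :=
  (forall x, a <= x <= b -> P (x, c) /\ P (x, d)) /\
  (forall y, c <= y <= d -> P (a, y) /\ P (b, y)).

Lemma on_rect_boundary P a b c d : a <= b -> c <= d -> on_rect P a b c d -> on_boundary P a b c d.
Proof. intros H1 H2 H; split; intros; split; apply H; lra. Qed.

Lemma cintable_hor f y a b : a <= b -> (forall x, a <= x <= b -> ccont f (x, y)) ->
  cintable (fun x => f (x, y)) a b.
Proof. intros. apply pcont_cintable; auto. intros; apply ccont_hor; auto. Qed.

Lemma cintable_ver f x c d : c <= d -> (forall y, c <= y <= d -> ccont f (x, y)) ->
  cintable (fun y => f (x, y)) c d.
Proof. intros. apply pcont_cintable; auto. intros; apply ccont_ver; auto. Qed.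

(** The integral over the positively oriented boundary.  Opposite sides are
    paired under one integral sign, so that for an affine f the integrands are
    constant. *)
Definition rect_int (f : C -> C) (a b c d : R) : C :=
  (cint (fun x => f (x, c) - f (x, d)) a b + Ci * cint (fun y => f (b, y) - f (a, y)) c d)%C.

Lemma rect_int_sides f a b c d : a <= b -> c <= d -> on_boundary (ccont f) a b c d ->
  rect_int f a b c d = (cint (fun x => f (x, c)) a b - cint (fun x => f (x, d)) a b
    + Ci * (cint (fun y => f (b, y)) c d - cint (fun y => f (a, y)) c d))%C.
Proof.
  intros H1 H2 [F G]. unfold rect_int.
  rewrite (cint_minus (fun x => f (x, c)) (fun x => f (x, d))),
    (cint_minus (fun y => f (b, y)) (fun y => f (a, y))); auto.
  1,2: apply (cintable_ver f); auto; apply G.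
  all: apply (cintable_hor f); auto; apply F.
Qed.

Lemma on_boundary_map (P Q S : C -> Prop) a b c d : (forall z, P z -> Q z -> S z) ->
  on_boundary P a b c d -> on_boundary Q a b c d -> on_boundary S a b c d.
Proof.
  intros H [P1 P2] [Q1 Q2]; split; intros x Hx;
  [destruct (P1 x Hx), (Q1 x Hx)|destruct (P2 x Hx), (Q2 x Hx)]; split; auto.
Qed.

(** Only continuity at boundary points is assumed here and in the next lemmas,
    because the Cauchy kernel is singular inside the rectangle. *)
Lemma rect_int_plus f g a b c d : a <= b -> c <= d ->
  on_boundary (ccont f) a b c d -> on_boundary (ccont g) a b c d ->
  rect_int (fun z => f z + g z)%C a b c d = (rect_int f a b c d + rect_int g a b c d)%C.
Proof.
  intros H1 H2 F G.
  rewrite !rect_int_sides; auto.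
  2: { eapply on_boundary_map; [|exact F|exact G]. intros z; simpl. apply ccont_plus. }
  destruct F as [F F'], G as [G G'].
  rewrite (cint_plus (fun x => f (x, c)) (fun x => g (x, c))),
    (cint_plus (fun x => f (x, d)) (fun x => g (x, d))),
    (cint_plus (fun y => f (a, y)) (fun y => g (a, y))),
    (cint_plus (fun y => f (b, y)) (fun y => g (b, y))).
  ring.
  1,3: apply (cintable_ver f); auto; apply F'.
  1,2: apply (cintable_ver g); auto; apply G'.
  1,3: apply (cintable_hor f); auto; apply F.
  all: apply (cintable_hor g); auto; apply G.
Qed.

Lemma rect_int_mult k f a b c d : a <= b -> c <= d -> on_boundary (ccont f) a b c d ->
  rect_int (fun z => k * f z)%C a b c d = (k * rect_int f a b c d)%C.
Proof.
  intros H1 H2 F.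
  rewrite !rect_int_sides; auto.
  2: { eapply on_boundary_map; [|exact F|exact F]. intros z Hz _; simpl.
       apply ccont_mult; auto. apply ccont_const. }
  destruct F as [F F'].
  rewrite (fun H => proj2 (cint_mult k (fun x => f (x, c)) a b H)),
    (fun H => proj2 (cint_mult k (fun x => f (x, d)) a b H)),
    (fun H => proj2 (cint_mult k (fun y => f (a, y)) c d H)),
    (fun H => proj2 (cint_mult k (fun y => f (b, y)) c d H)).
  ring.
  1,2: apply (cintable_ver f); auto; apply F'.
  all: apply (cintable_hor f); auto; apply F.
Qed.

Lemma rect_int_bound f a b c d M : a <= b -> c <= d -> on_boundary (ccont f) a b c d ->
  on_boundary (fun z => Cmod (f z) <= M) a b c d ->
  Cmod (rect_int f a b c d) <= 2 * M * ((b - a) + (d - c)).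
Proof.
  intros H1 H2 [F F'] [K1 K2]. unfold rect_int.
  eapply Rle_trans. apply Cmod_triangle. rewrite Cmod_mult.
  replace (Cmod Ci) with 1. 2: { unfold Ci. rewrite Cmod_ver, Rabs_R1; auto. }
  assert (Cmod (cint (fun x => f (x, c) - f (x, d))%C a b) <= (b - a) * (2 * M)).
  { apply cint_bound_const; auto. apply cintable_minus; apply (cintable_hor f); auto; apply F.
    intros x Hx. generalize (Cmod_minus_le (f (x, c)) (f (x, d))) (K1 x Hx). lra. }
  assert (Cmod (cint (fun y => f (b, y) - f (a, y))%C c d) <= (d - c) * (2 * M)).
  { apply cint_bound_const; auto. apply cintable_minus; apply (cintable_ver f); auto; apply F'.
    intros x Hx. generalize (Cmod_minus_le (f (b, x)) (f (a, x))) (K2 x Hx). lra. }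
  lra.
Qed.

Lemma rect_int_affine p q a b c d : rect_int (fun z => p + q * z)%C a b c d = 0.
Proof.
  unfold rect_int.
  replace (cint (fun x => p + q * (x, c) - (p + q * (x, d)))%C a b) with
    (cint (fun _ => q * (0, c - d)%R)%C a b).
  replace (cint (fun y => p + q * (b, y) - (p + q * (a, y)))%C c d) with
    (cint (fun _ => q * (b - a, 0)%R)%C c d).
  - rewrite !cint_const. destruct q as [u v]. apply injective_projections; simpl; ring.
  - unfold cint. f_equal. apply functional_extensionality.
    intros y. destruct q, p; apply injective_projections; simpl; ring.
  - unfold cint. f_equal. apply functional_extensionality.
    intros y. destruct q, p; apply injective_projections; simpl; ring.
Qed.

Lemma on_rect_sub P a b c d a' b' c' d' : on_rect P a b c d ->
  a <= a' -> b' <= b -> c <= c' -> d' <= d -> on_rect P a' b' c' d'.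
Proof. intros H ? ? ? ? x y ? ?. apply H; lra. Qed.

Lemma rect_int_split_x f a m b c d : a <= m -> m <= b -> c <= d -> on_rect (ccont f) a b c d ->
  rect_int f a b c d = (rect_int f a m c d + rect_int f m b c d)%C.
Proof.
  intros H1 H2 H3 F.
  rewrite !rect_int_sides; auto; try lra; try (apply on_rect_boundary; try lra; eapply on_rect_sub; eauto; lra).
  assert (E : forall y, c <= y <= d -> cint (fun x => f (x, y)) a b =
    (cint (fun x => f (x, y)) a m + cint (fun x => f (x, y)) m b)%C).
  { intros y Hy. apply cint_Chasles; apply (cintable_hor f); try lra; intros; apply F; lra. }
  rewrite !E by lra. ring.
Qed.

Lemma rect_int_split_y f a b c m d : a <= b -> c <= m -> m <= d -> on_rect (ccont f) a b c d ->
  rect_int f a b c d = (rect_int f a b c m + rect_int f a b m d)%C.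
Proof.
  intros H1 H2 H3 F.
  rewrite !rect_int_sides; auto; try lra; try (apply on_rect_boundary; try lra; eapply on_rect_sub; eauto; lra).
  assert (E : forall x, a <= x <= b -> cint (fun y => f (x, y)) c d =
    (cint (fun y => f (x, y)) c m + cint (fun y => f (x, y)) m d)%C).
  { intros y Hy. apply cint_Chasles; apply (cintable_ver f); try lra; intros; apply F; lra. }
  rewrite !E by lra. ring.
Qed.

Lemma nested_point (a b : nat -> R) :
  (forall n, a n <= a (S n)) -> (forall n, b (S n) <= b n) -> (forall n, a n <= b n) ->
  exists x, forall n, a n <= x <= b n.
Proof.
  intros Ha Hb Hab.
  assert (Ma : forall n k, a n <= a (k + n)%nat).
  { intros n k; induction k; simpl. lra. generalize (Ha (k + n)%nat); lra. }
  assert (Mb : forall n k, b (k + n)%nat <= b n).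
  { intros n k; induction k; simpl. lra. generalize (Hb (k + n)%nat); lra. }
  assert (U : forall n m, a n <= b m).
  { intros n m. generalize (Ma n m) (Mb m n) (Hab (m + n)%nat). rewrite (Nat.add_comm n m). lra. }
  destruct (completeness (fun r => exists n, r = a n)) as [x [X1 X2]].
  - exists (b 0%nat). intros r [n ->]. apply U.
  - exists (a 0%nat), 0%nat; auto.
  - exists x. intros n; split. apply X1. exists n; auto.
    apply X2. intros r [m ->]. apply U.
Qed.

Record quad := Quad { qa : R; qb : R; qc : R; qd : R }.

(** Cousin's lemma by quartering: a property that passes from the four quarters to
    the whole and holds for all small rectangles around each point holds
    globally.  Otherwise some quarter fails at each stage, and the nested failing
    rectangles shrink to a point where local validity is contradicted.
    Decidability lets the failing quarter be selected by computation. *)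
Lemma rect_bisection (P : quad -> Prop) (Pdec : forall q, {P q} + {~ P q}) a b c d :
  a <= b -> c <= d ->
  (forall a' b' c' d', a <= a' -> a' <= b' -> b' <= b -> c <= c' -> c' <= d' -> d' <= d ->
     let m := (a' + b') / 2 in let n := (c' + d') / 2 in
     P (Quad a' m c' n) -> P (Quad m b' c' n) -> P (Quad a' m n d') -> P (Quad m b' n d') ->
     P (Quad a' b' c' d')) ->
  (forall x y, a <= x <= b -> c <= y <= d -> exists e, 0 < e /\
     forall a' b' c' d', a <= a' -> a' <= x <= b' -> b' <= b -> c <= c' -> c' <= y <= d' -> d' <= d ->
       b' - a' < e -> d' - c' < e -> P (Quad a' b' c' d')) ->
  P (Quad a b c d).
Proof.
  intros Hab Hcd Hadd Hloc. apply NNPP; intros HN.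
  pose (next q := let '(Quad a b c d) := q in
    let m := (a + b) / 2 in let n := (c + d) / 2 in
    if Pdec (Quad a m c n) then
      if Pdec (Quad m b c n) then
        if Pdec (Quad a m n d) then Quad m b n d else Quad a m n d
      else Quad m b c n
    else Quad a m c n).
  pose (Q := fix Q n := match n with O => Quad a b c d | S n => next (Q n) end).
  assert (HQ : forall n, ~ P (Q n) /\ a <= qa (Q n) /\ qa (Q n) <= qb (Q n) /\ qb (Q n) <= b /\
     c <= qc (Q n) /\ qc (Q n) <= qd (Q n) /\ qd (Q n) <= d /\
     qb (Q n) - qa (Q n) = (b - a) / 2 ^ n /\ qd (Q n) - qc (Q n) = (d - c) / 2 ^ n /\
     qa (Q n) <= qa (Q (S n)) /\ qb (Q (S n)) <= qb (Q n) /\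
     qc (Q n) <= qc (Q (S n)) /\ qd (Q (S n)) <= qd (Q n)).
  { assert (Step : forall q r, ~ P q -> a <= qa q -> qa q <= qb q -> qb q <= b ->
      c <= qc q -> qc q <= qd q -> qd q <= d ->
      qb q - qa q = (b - a) / r -> qd q - qc q = (d - c) / r -> r <> 0 ->
      ~ P (next q) /\ qa q <= qa (next q) /\ qa (next q) <= qb (next q) /\ qb (next q) <= qb q /\
      qc q <= qc (next q) /\ qc (next q) <= qd (next q) /\ qd (next q) <= qd q /\
      qb (next q) - qa (next q) = (b - a) / (2 * r) /\
      qd (next q) - qc (next q) = (d - c) / (2 * r)).
    { intros [a' b' c' d'] r; simpl; intros Hn ? ? ? ? ? ? E1 E2 Hr.
      assert (G := Hadd a' b' c' d'). cbv zeta in G.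
      replace ((b - a) / (2 * r)) with ((b' - a') / 2) by (rewrite E1; field; auto).
      replace ((d - c) / (2 * r)) with ((d' - c') / 2) by (rewrite E2; field; auto).
      destruct (Pdec _) as [P1|P1]; [|simpl; repeat split; try lra; auto].
      destruct (Pdec _) as [P2|P2]; [|simpl; repeat split; try lra; auto].
      destruct (Pdec _) as [P3|P3]; [|simpl; repeat split; try lra; auto].
      simpl; repeat split; try lra. intros P4. apply Hn, G; auto. }
    intros n. assert (H0 : ~ P (Q n) /\ a <= qa (Q n) /\ qa (Q n) <= qb (Q n) /\ qb (Q n) <= b /\
     c <= qc (Q n) /\ qc (Q n) <= qd (Q n) /\ qd (Q n) <= d /\
     qb (Q n) - qa (Q n) = (b - a) / 2 ^ n /\ qd (Q n) - qc (Q n) = (d - c) / 2 ^ n).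
    { induction n as [|n IH].
      - simpl. repeat split; try lra. auto.
      - destruct IH as (N & ? & ? & ? & ? & ? & ? & E1 & E2).
        destruct (Step (Q n) (2 ^ n)) as (N' & ? & ? & ? & ? & ? & ? & E1' & E2'); auto.
        apply pow_nonzero; lra.
        change (Q (S n)) with (next (Q n)). simpl (2 ^ S n).
        repeat split; try lra; auto. }
    destruct H0 as (N & ? & ? & ? & ? & ? & ? & E1 & E2).
    destruct (Step (Q n) (2 ^ n)) as (N' & ? & ? & ? & ? & ? & ? & E1' & E2'); auto.
    apply pow_nonzero; lra.
    change (Q (S n)) with (next (Q n)). repeat split; try lra; auto. }
  destruct (nested_point (fun n => qa (Q n)) (fun n => qb (Q n))) as [x Hx]; try (intros n; apply HQ).
  destruct (nested_point (fun n => qc (Q n)) (fun n => qd (Q n))) as [y Hy]; try (intros n; apply HQ).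
  destruct (Hloc x y (Hx 0%nat) (Hy 0%nat)) as [e [He Hp]].
  destruct (pow_lt_1_zero (/2) ltac:(rewrite Rabs_pos_eq; lra) (e / (1 + (b - a) + (d - c)))) as [N HN'].
  { apply Rdiv_lt_0_compat; lra. }
  specialize (HN' N (le_n _)).
  rewrite Rabs_pos_eq in HN' by (apply pow_le; lra). rewrite pow_inv in HN'.
  destruct (HQ N) as (K & ? & ? & ? & ? & ? & ? & E1 & E2 & _).
  apply K. destruct (Q N) as [a' b' c' d'] eqn:EQ; simpl in *.
  specialize (Hx N). specialize (Hy N). cbv beta in Hx, Hy. rewrite EQ in Hx, Hy. simpl in Hx, Hy.
  assert (PW : 0 < / 2 ^ N) by (apply Rinv_0_lt_compat, pow_lt; lra).
  assert (KK : / 2 ^ N * (1 + (b - a) + (d - c)) < e).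
  { apply Rlt_le_trans with (e / (1 + (b - a) + (d - c)) * (1 + (b - a) + (d - c))).
    apply Rmult_lt_compat_r; lra. right; field; lra. }
  apply Hp; try lra; unfold Rdiv in *; nra.
Qed.

(** The quantity compared with the integral is the sum S of the squares of the
    side lengths: it is divided by four by quartering, so a bound |integral| <=
    eps S passes from the quarters to the whole, and it is comparable to diameter
    times perimeter, so differentiability at a point gives the bound for all small
    rectangles around it. *)
Lemma goursat f a b c d : a <= b -> c <= d -> on_rect (cdiff f) a b c d -> rect_int f a b c d = 0.
Proof.
  intros Hab Hcd HD.
  assert (HC : on_rect (ccont f) a b c d).
  { intros x y Hx Hy. apply cdiff_ccont, HD; auto. }
  pose (S q := (qb q - qa q) ^ 2 + (qd q - qc q) ^ 2).
  assert (Main : forall eps, 0 < eps -> Cmod (rect_int f a b c d) <= eps * S (Quad a b c d)).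
  { intros eps Heps.
    pose (P q := Cmod (rect_int f (qa q) (qb q) (qc q) (qd q)) <= eps * S q).
    change (P (Quad a b c d)). apply rect_bisection; auto.
    { intros q. apply Rle_dec. }
    { intros a' b' c' d' ? ? ? ? ? ? m n. unfold P, S; simpl. intros P1 P2 P3 P4.
      assert (HC' : on_rect (ccont f) a' b' c' d') by (eapply on_rect_sub; eauto).
      assert (a' <= m <= b') by (unfold m; lra). assert (c' <= n <= d') by (unfold n; lra).
      rewrite (rect_int_split_x f a' m b'); try lra; auto.
      rewrite (rect_int_split_y f a' m c' n d'); try lra.
      2: { eapply on_rect_sub; eauto; lra. }
      rewrite (rect_int_split_y f m b' c' n d'); try lra.
      2: { eapply on_rect_sub; eauto; lra. }
      eapply Rle_trans. apply Cmod_triangle.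
      eapply Rle_trans. apply Rplus_le_compat; apply Cmod_triangle.
      assert (Em : m - a' = (b' - a') / 2) by (unfold m; lra).
      assert (Em' : b' - m = (b' - a') / 2) by (unfold m; lra).
      assert (En : n - c' = (d' - c') / 2) by (unfold n; lra).
      assert (En' : d' - n = (d' - c') / 2) by (unfold n; lra).
      rewrite Em, En in P1. rewrite Em', En in P2. rewrite Em, En' in P3. rewrite Em', En' in P4.
      nra. }
    intros x y Hx Hy. destruct (HD x y Hx Hy) as [phi [Hphi Hf]].
    set (z := (x, y) : C) in *.
    destruct (Hphi (eps / 4)) as [r [Hr K]]; [lra|].
    exists (r / 2); split; [lra|]. intros a' b' c' d' ? ? ? ? ? ? D1 D2. unfold P, S; simpl.
    (* subtract the affine part, whose boundary integral vanishes; the remainder is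
       at most eps/4 times the distance to z *)
    pose (g w := ((f z - phi z * z) + phi z * w)%C).
    pose (h w := (f w + (- RtoC 1) * g w)%C).
    assert (Cg : forall w, ccont g w).
    { intros w. unfold g. apply ccont_plus. apply ccont_const. apply ccont_mult.
      apply ccont_const. apply ccont_id. }
    assert (HC' : on_rect (ccont f) a' b' c' d') by (eapply on_rect_sub; eauto).
    assert (Hh : on_rect (ccont h) a' b' c' d').
    { intros u v Hu Hv. unfold h. apply ccont_plus. apply HC'; auto.
      apply ccont_mult. apply ccont_const. apply Cg. }
    replace (rect_int f a' b' c' d') with (rect_int (fun w => h w + g w)%C a' b' c' d').
    2: { f_equal. apply functional_extensionality. intros w. unfold h. ring. }
    rewrite rect_int_plus; try lra; try (apply on_rect_boundary; try lra; auto; intros u v _ _; apply Cg).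
    unfold g at 1. rewrite rect_int_affine, Cplus_0_r.
    assert (B : on_rect (fun w => Cmod (h w) <= eps / 4 * ((b' - a') + (d' - c'))) a' b' c' d').
    { intros u v Hu Hv. unfold h, g.
      set (w := (u, v) : C).
      replace (f w + - RtoC 1 * (f z - phi z * z + phi z * w))%C with
        ((f w - f z) - phi z * (w - z))%C by ring.
      rewrite Hf. replace (phi w * (w - z) - phi z * (w - z))%C with ((phi w - phi z) * (w - z))%C by ring.
      rewrite Cmod_mult.
      assert (M : Cmod (w - z) <= (b' - a') + (d' - c')).
      { eapply Rle_trans. apply Cmod_le_abs. unfold w, z; simpl.
        apply Rplus_le_compat; apply Rabs_le; lra. }
      apply Rmult_le_compat; try apply Cmod_ge_0; auto.
      left. apply K. lra. }
    eapply Rle_trans. apply rect_int_bound with (M := eps / 4 * ((b' - a') + (d' - c'))); try lra; apply on_rect_boundary; auto; lra.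
    - generalize (pow2_ge_0 ((b' - a') - (d' - c'))). intros.
      replace (2 * (eps / 4 * (b' - a' + (d' - c'))) * (b' - a' + (d' - c'))) with
        (eps * ((b' - a' + (d' - c')) ^ 2 / 2)) by field.
      apply Rmult_le_compat_l; [lra|]. nra. }
  apply Cmod_eq_0. apply Rle_antisym; [|apply Cmod_ge_0].
  apply le_epsilon. intros e He. rewrite Rplus_0_l.
  assert (HS : 0 <= S (Quad a b c d)).
  { unfold S. generalize (pow2_ge_0 (qb (Quad a b c d) - qa (Quad a b c d)))
      (pow2_ge_0 (qd (Quad a b c d) - qc (Quad a b c d))). lra. }
  set (s := S (Quad a b c d)) in *.
  eapply Rle_trans. apply (Main (e / (1 + s))). apply Rdiv_lt_0_compat; lra.
  fold s. apply Rle_trans with (e / (1 + s) * (1 + s)).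
  - apply Rmult_le_compat_l. left; apply Rdiv_lt_0_compat; lra. lra.
  - right; field; lra.
Qed.

(** * Cauchy's formula and the maximum principle *)

Lemma ccont_uniform f a b c d : on_rect (ccont f) a b c d ->
  forall e, 0 < e -> exists del, 0 < del /\ forall x y u v,
    a <= x <= b -> c <= y <= d -> a <= u <= b -> c <= v <= d ->
    Rabs (u - x) < del -> Rabs (v - y) < del -> Cmod (f (u, v) - f (x, y)) < e.
Proof.
  intros H e He.
  assert (K : forall p : C -> R, (forall z, Rabs (p z) <= Cmod z) ->
    (forall z w, p (z - w)%C = p z - p w) ->
    forall x y, a <= x <= b -> c <= y <= d -> continuity_2d_pt (fun u v => p (f (u, v))) x y).
  { intros p P1 P2 x y Hx Hy [t Ht]. destruct (H x y Hx Hy t Ht) as [r [Hr G]].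
    assert (Hr2 : 0 < r / 2) by lra.
    exists (mkposreal _ Hr2). simpl. intros u v Hu Hv.
    rewrite <- P2. eapply Rle_lt_trans. apply P1. apply G.
    eapply Rle_lt_trans. apply Cmod_le_abs. simpl.
    unfold Rminus in Hu, Hv. lra. }
  assert (He2 : 0 < e / 2) by lra.
  destruct (uniform_continuity_2d _ a b c d (K Re re_le_Cmod ltac:(intros; reflexivity)) (mkposreal _ He2)) as [[d1 D1] U1].
  destruct (uniform_continuity_2d _ a b c d (K Im Im_le_Cmod ltac:(intros; reflexivity)) (mkposreal _ He2)) as [[d2 D2] U2].
  exists (Rmin d1 d2). split. apply Rmin_glb_lt; auto.
  generalize (Rmin_l d1 d2) (Rmin_r d1 d2); intros.
  eapply Rle_lt_trans. apply Cmod_le_abs. simpl in *.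
  assert (A1 := U1 x y u v ltac:(lra) ltac:(lra) ltac:(lra) ltac:(lra) ltac:(lra) ltac:(lra)).
  assert (A2 := U2 x y u v ltac:(lra) ltac:(lra) ltac:(lra) ltac:(lra) ltac:(lra) ltac:(lra)).
  unfold Re, Im in *. unfold Rminus in *. lra.
Qed.

Lemma Cminus_zero_r (z : C) : (z - 0)%C = z.
Proof. ring. Qed.

(** The horizontal sides nearly cancel by uniform continuity, and the vertical
    ones are short. *)
Lemma thin_rect_int f a b c d : a <= b -> c <= d -> on_rect (ccont f) a b c d ->
  forall e, 0 < e -> exists del, 0 < del /\ forall y1 y2, c <= y1 -> y1 <= y2 -> y2 <= d ->
    y2 - y1 < del -> Cmod (rect_int f a b y1 y2) <= e.
Proof.
  intros H1 H2 F e He.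
  set (e1 := e / (2 * (1 + (b - a)))).
  assert (He1 : 0 < e1) by (apply Rdiv_lt_0_compat; lra).
  destruct (ccont_uniform f a b c d F e1 He1) as [d1 [D1 U1]].
  destruct (ccont_uniform f a b c d F 1 Rlt_0_1) as [d2 [D2 U2]].
  assert (Hbd : exists M, 0 < M /\ forall y, c <= y <= d -> Cmod (f (a, y)) <= M /\ Cmod (f (b, y)) <= M).
  {
    (* climb from the bottom side in steps of d2/2, each changing f by at most 1 *)
    assert (G : forall x, a <= x <= b -> forall n : nat, forall y, c <= y <= d -> y <= c + INR n * (d2 / 2) ->
      Cmod (f (x, y)) <= Cmod (f (x, c)) + INR n).
    { intros x Hx n; induction n; intros y Hy Hn.
      - simpl in *. replace y with c by lra. lra.
      - rewrite S_INR in *. 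
        destruct (Rle_dec y (c + d2 / 2)) as [Hl|Hl].
        + assert (K := U2 x c x y Hx ltac:(lra) Hx Hy). 
          rewrite !Rabs_pos_eq in K by lra. specialize (K ltac:(lra) ltac:(lra)).
          generalize (Cmod_tri (f (x, y)) (f (x, c)) 0). 
          rewrite !Cminus_zero_r.
          generalize (pos_INR n). lra.
        + assert (K := U2 x (y - d2/2) x y Hx ltac:(lra) Hx Hy).
          rewrite !Rabs_pos_eq in K by lra. specialize (K ltac:(lra) ltac:(lra)).
          generalize (Cmod_tri (f (x, y)) (f (x, y - d2/2)) 0). 
          rewrite !Cminus_zero_r.
          generalize (IHn (y - d2/2) ltac:(lra) ltac:(lra)). lra. }
    destruct (INR_unbounded ((d - c) / (d2 / 2))) as [n Hn].
    assert (Hn' : d <= c + INR n * (d2 / 2)).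
    { apply Rlt_div_l in Hn; lra. }
    exists (1 + Cmod (f (a, c)) + Cmod (f (b, c)) + INR n).
    generalize (pos_INR n) (Cmod_ge_0 (f (a, c))) (Cmod_ge_0 (f (b, c))); intros.
    split. lra. intros y Hy.
    generalize (G a ltac:(lra) n y Hy ltac:(lra)) (G b ltac:(lra) n y Hy ltac:(lra)). lra. }
  destruct Hbd as [M [HM B]].
  exists (Rmin d1 (e / (4 * M))). split.
  { apply Rmin_glb_lt; auto. apply Rdiv_lt_0_compat; lra. }
  intros y1 y2 Hy1 Hy Hy2 Hd.
  assert (Hd1 : y2 - y1 < d1) by (eapply Rlt_le_trans; [exact Hd|apply Rmin_l]).
  assert (Hd2 : y2 - y1 < e / (4 * M)) by (eapply Rlt_le_trans; [exact Hd|apply Rmin_r]).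
  unfold rect_int. eapply Rle_trans. apply Cmod_triangle. rewrite Cmod_mult.
  replace (Cmod Ci) with 1. 2: { unfold Ci. rewrite Cmod_ver, Rabs_R1; auto. }
  assert (I1 : Cmod (cint (fun x => f (x, y1) - f (x, y2))%C a b) <= (b - a) * e1).
  { apply cint_bound_const; auto. apply cintable_minus; apply (cintable_hor f); auto; intros; apply F; lra.
    intros x Hx. left. rewrite Cmod_minus_sym. apply U1; try lra.
    rewrite Rabs_pos_eq; lra. rewrite Rabs_pos_eq; lra. }
  assert (I2 : Cmod (cint (fun y => f (b, y) - f (a, y))%C y1 y2) <= (y2 - y1) * (2 * M)).
  { apply cint_bound_const; auto. apply cintable_minus; apply (cintable_ver f); auto; intros; apply F; lra.
    intros x Hx. generalize (Cmod_minus_le (f (b, x)) (f (a, x))) (B x ltac:(lra)). lra. }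
  assert ((y2 - y1) * (2 * M) <= e / 2).
  { apply Rlt_le. apply Rlt_div_r in Hd2; lra. }
  assert ((b - a) * e1 <= e / 2).
  { replace (e / 2) with ((1 + (b - a)) * e1) by (unfold e1; field; lra). nra. }
  lra.
Qed.

(** Differentiability is dropped on the two horizontal sides: cut off thin
    rectangles along them, whose boundary integrals tend to zero. *)
Lemma goursat_open f a b c d : a <= b -> c < d -> on_rect (ccont f) a b c d ->
  (forall x y, a <= x <= b -> c < y < d -> cdiff f (x, y)) -> rect_int f a b c d = 0.
Proof.
  intros H1 H2 F D. apply Cmod_eq_0. apply Rle_antisym; [|apply Cmod_ge_0].
  apply le_epsilon. intros e He. rewrite Rplus_0_l.
  destruct (thin_rect_int f a b c d H1 ltac:(lra) F (e / 2)) as [del [Hdel T]]; [lra|].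
  set (t := Rmin (del / 2) ((d - c) / 3)).
  assert (Ht : 0 < t) by (unfold t; apply Rmin_glb_lt; lra).
  assert (Ht1 : t <= del / 2) by apply Rmin_l. assert (Ht2 : t <= (d - c) / 3) by apply Rmin_r.
  rewrite (rect_int_split_y f a b c (c + t) d); try lra; auto.
  rewrite (rect_int_split_y f a b (c + t) (d - t) d); try lra.
  2: eapply on_rect_sub; eauto; lra.
  rewrite (goursat f a b (c + t) (d - t)); try lra.
  2: intros x y Hx Hy; apply D; lra.
  rewrite Cplus_0_l. eapply Rle_trans. apply Cmod_triangle.
  generalize (T c (c + t) ltac:(lra) ltac:(lra) ltac:(lra) ltac:(lra))
    (T (d - t) d ltac:(lra) ltac:(lra) ltac:(lra) ltac:(lra)). lra.
Qed.

Lemma cdiff_local f g z r : 0 < r -> (forall w, Cmod (w - z) < r -> f w = g w) ->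
  cdiff f z -> cdiff g z.
Proof.
  intros Hr E [phi [P H]].
  assert (Ez : f z = g z).
  { apply E. replace (z - z)%C with (RtoC 0) by ring. rewrite Cmod_0; lra. }
  exists (fun w => if Rlt_dec (Cmod (w - z)) r then phi w else (g w - g z) / (w - z))%C. split.
  - apply ccont_local with phi r; auto. intros w Hw.
    destruct (Rlt_dec _ _); [reflexivity|contradiction].
  - intros w. destruct (Rlt_dec _ _) as [L|L].
    + rewrite <- H, E, Ez; auto.
    + field. intros Z. rewrite Z, Cmod_0 in L. lra.
Qed.

Lemma rect_int_ext f g a b c d : a <= b -> c <= d -> on_boundary (fun z => f z = g z) a b c d ->
  rect_int f a b c d = rect_int g a b c d.
Proof.
  intros H1 H2 [E1 E2]. unfold rect_int. f_equal; [|f_equal]; apply cint_ext; auto; intros x Hx.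
  destruct (E1 x Hx) as [-> ->]; auto. destruct (E2 x Hx) as [-> ->]; auto.
Qed.

Lemma Cneq_dist (z w : C) : z <> w -> (z - w)%C <> 0.
Proof. intros H E. apply H, Ceq_minus, E. Qed.

Lemma ccont_cauchy_kernel (z0 z : C) : z <> z0 -> ccont (fun w => / (w - z0))%C z.
Proof.
  intros H. apply (ccont_comp Cinv (fun w => w - z0)%C).
  apply (ccont_plus (fun w => w) (fun _ => - z0)%C). apply ccont_id. apply ccont_const.
  apply ccont_inv, Cneq_dist, H.
Qed.

Lemma cdiff_cauchy_kernel (z0 z : C) : z <> z0 -> cdiff (fun w => / (w - z0))%C z.
Proof.
  intros H. apply (cdiff_comp Cinv (fun w => w - z0)%C).
  apply (cdiff_minus (fun w => w) (fun _ => z0)). apply cdiff_id. apply cdiff_const.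
  apply cdiff_inv, Cneq_dist, H.
Qed.

Lemma boundary_off a b c d x0 y0 : a < x0 < b -> c < y0 < d ->
  on_boundary (fun z => z <> (x0, y0)) a b c d.
Proof.
  intros Hx Hy; split; intros t Ht; split; intros E; inversion E; lra.
Qed.

(** The slope phi of f at z0 is continuous everywhere and differentiable except at
    z0.  Cutting the rectangle along the horizontal line through z0 puts the bad
    point on a side of both halves, so the integral of phi vanishes by
    goursat_open.  On the boundary phi(w) = (f(w) - f(z0)) / (w - z0). *)
Lemma cauchy_formula f a b c d x0 y0 : a < x0 < b -> c < y0 < d -> on_rect (cdiff f) a b c d ->
  rect_int (fun w => f w * / (w - (x0, y0)))%C a b c d =
  (f (x0, y0) * rect_int (fun w => / (w - (x0, y0))) a b c d)%C.
Proof.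
  intros Hx Hy D. set (z0 := (x0, y0) : C).
  destruct (D x0 y0 ltac:(lra) ltac:(lra)) as [phi [P E]]. fold z0 in P, E.
  assert (Dphi : forall x y, a <= x <= b -> c <= y <= d -> (x, y) <> z0 -> cdiff phi (x, y)).
  { intros x y Hx' Hy' N. assert (N' := Cneq_dist _ _ N).
    apply cdiff_local with (fun w => (f w - f z0) * / (w - z0))%C (Cmod ((x, y) - z0)%C).
    - apply Cmod_gt_0; auto.
    - intros w Hw. rewrite E. field. intros Z.
      assert (w = z0) by (apply Ceq_minus; auto). subst w. rewrite Cmod_minus_sym in Hw. lra.
    - apply (cdiff_mult (fun w => f w - f z0)%C (fun w => / (w - z0))%C).
      apply (cdiff_minus f (fun _ => f z0)). apply D; auto. apply cdiff_const.
      apply cdiff_cauchy_kernel; auto. }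
  assert (Cphi : on_rect (ccont phi) a b c d).
  { intros x y Hx' Hy'. destruct (Ceq_dec (x, y) z0) as [->|N]; auto.
    apply cdiff_ccont, Dphi; auto. }
  assert (Z : rect_int phi a b c d = 0).
  { rewrite (rect_int_split_y phi a b c y0 d); try lra; auto.
    rewrite !goursat_open; try lra. ring.
    - eapply on_rect_sub; eauto; lra.
    - intros x y ? ?. apply Dphi; try lra. intros EE; inversion EE; lra.
    - eapply on_rect_sub; eauto; lra.
    - intros x y ? ?. apply Dphi; try lra. intros EE; inversion EE; lra. }
  assert (Off := boundary_off a b c d x0 y0 Hx Hy). fold z0 in Off.
  assert (Cf : on_boundary (ccont f) a b c d).
  { apply on_rect_boundary; try lra. intros x y ? ?. apply cdiff_ccont, D; auto. }
  assert (CK : on_boundary (ccont (fun w => / (w - z0))%C) a b c d).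
  { eapply on_boundary_map; [|exact Off|exact Off]. intros z Hz _. now apply ccont_cauchy_kernel. }
  rewrite (rect_int_ext phi (fun w => f w * / (w - z0) + (- f z0) * / (w - z0))%C) in Z; try lra.
  2: { eapply on_boundary_map; [|exact Off|exact Off]. intros w Hw _. simpl.
       apply Cneq_dist in Hw.
       replace (phi w) with ((phi w * (w - z0)) * / (w - z0))%C by (field; auto).
       rewrite <- E. ring. }
  rewrite rect_int_plus, rect_int_mult in Z; try lra; auto.
  - apply Ceq_minus. rewrite <- Z. ring.
  - eapply on_boundary_map; [|exact Cf|exact CK]. intros w; apply ccont_mult.
  - eapply on_boundary_map; [|exact CK|exact CK]. intros w Hw _. apply ccont_mult; auto. apply ccont_const.
Qed.

Lemma pcont_ccont g t : pcont g t -> ccont (fun z => g (Re z)) (t, 0).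
Proof.
  intros G e He. destruct (G e He) as [d [Hd K]]. exists d; split; auto.
  intros z Hz. apply K. eapply Rle_lt_trans; [|exact Hz]. apply (re_le_Cmod (z - (t, 0))%C).
Qed.

Lemma pcont_minus g h t : pcont g t -> pcont h t -> pcont (fun s => g s - h s)%C t.
Proof.
  intros G H.
  assert (K : ccont (fun z => g (Re z) - h (Re z))%C (t, 0)).
  { apply ccont_ext with (fun z => g (Re z) + (- RtoC 1) * h (Re z))%C. intros; ring.
    apply ccont_plus. now apply pcont_ccont.
    apply ccont_mult. apply ccont_const. now apply pcont_ccont. }
  exact (ccont_hor _ _ _ K).
Qed.

Lemma pcont_mult g h t : pcont g t -> pcont h t -> pcont (fun s => g s * h s)%C t.
Proof.
  intros G H. exact (ccont_hor _ _ _ (ccont_mult _ _ _ (pcont_ccont g t G) (pcont_ccont h t H))).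
Qed.

Lemma pcont_Re_Im g t : pcont g t ->
  continuous (fun s => Re (g s)) t /\ continuous (fun s => Im (g s)) t.
Proof.
  intros G. split; apply filterlim_locally; intros [e He];
  destruct (G e He) as [d [D K]]; exists (mkposreal d D); intros s Hs;
  (eapply Rle_lt_trans; [|apply (K s Hs)]).
  apply (re_le_Cmod (g s - g t)). apply (Im_le_Cmod (g s - g t)).
Qed.

(** The value is 2 PI i, but only its being nonzero matters: each of the four
    sides contributes a positive imaginary part. *)
Lemma cauchy_kernel_nonzero a b c d x0 y0 : a < x0 < b -> c < y0 < d ->
  rect_int (fun w => / (w - (x0, y0)))%C a b c d <> 0.
Proof.
  intros Hx Hy E. set (K := fun w : C => (/ (w - (x0, y0)))%C) in E.
  assert (Off := boundary_off a b c d x0 y0 Hx Hy).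
  assert (CK : on_boundary (ccont K) a b c d).
  { eapply on_boundary_map; [|exact Off|exact Off]. intros z Hz _. now apply ccont_cauchy_kernel. }
  destruct CK as [C1 C2].
  assert (I1 : cintable (fun x => K (x, c) - K (x, d))%C a b).
  { apply cintable_minus; apply (cintable_hor K); try lra; apply C1. }
  assert (I2 : cintable (fun y => K (b, y) - K (a, y))%C c d).
  { apply cintable_minus; apply (cintable_ver K); try lra; apply C2. }
  apply (f_equal Im) in E. unfold rect_int in E.
  rewrite im_plus, im_mult, (proj2 (cint_Im _ _ _ I1)), (proj2 (cint_Re _ _ _ I2)) in E.
  assert (HK : forall x y, (x, y) <> (x0, y0) -> 0 < (x - x0) ^ 2 + (y - y0) ^ 2 /\
     Re (K (x, y)) = (x - x0) / ((x - x0) ^ 2 + (y - y0) ^ 2) /\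
     Im (K (x, y)) = - (y - y0) / ((x - x0) ^ 2 + (y - y0) ^ 2)).
  { intros x y N. split; [|split; reflexivity].
    assert (N' : x - x0 <> 0 \/ y - y0 <> 0).
    { destruct (Req_dec x x0); [|left; lra]. right; intros ?. apply N. f_equal; lra. }
    generalize (pow2_ge_0 (x - x0)) (pow2_ge_0 (y - y0)). destruct N' as [N'|N'];
    apply pow_nonzero with (n := 2%nat) in N'; lra. }
  assert (P1 : 0 < RInt (fun x => Im (K (x, c) - K (x, d))%C) a b).
  { apply RInt_gt_0; try lra.
    - intros x Hx'. change (0 < Im (K (x, c)) - Im (K (x, d))).
      destruct (HK x c) as (S1 & _ & ->). { intros Z; inversion Z; lra. }
      destruct (HK x d) as (S2 & _ & ->). { intros Z; inversion Z; lra. }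
      assert (0 < - (c - y0) / ((x - x0) ^ 2 + (c - y0) ^ 2)) by (apply Rdiv_lt_0_compat; lra).
      assert (0 < (d - y0) / ((x - x0) ^ 2 + (d - y0) ^ 2)) by (apply Rdiv_lt_0_compat; lra).
      unfold Rdiv in *; lra.
    - intros x Hx'. apply (fun t H => proj2 (pcont_Re_Im (fun x => K (x, c) - K (x, d))%C t H)).
      apply (pcont_minus (fun x => K (x, c)) (fun x => K (x, d)));
      apply (ccont_hor K); apply C1; auto. }
  assert (P2 : 0 < RInt (fun y => Re (K (b, y) - K (a, y))%C) c d).
  { apply RInt_gt_0; try lra.
    - intros y Hy'. change (0 < Re (K (b, y)) - Re (K (a, y))).
      destruct (HK b y) as (S1 & -> & _). { intros Z; inversion Z; lra. }
      destruct (HK a y) as (S2 & -> & _). { intros Z; inversion Z; lra. }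
      assert (0 < (b - x0) / ((b - x0) ^ 2 + (y - y0) ^ 2)) by (apply Rdiv_lt_0_compat; lra).
      assert (0 < - (a - x0) / ((a - x0) ^ 2 + (y - y0) ^ 2)) by (apply Rdiv_lt_0_compat; lra).
      unfold Rdiv in *; lra.
    - intros y Hy'. apply (fun t H => proj1 (pcont_Re_Im (fun y => K (b, y) - K (a, y))%C t H)).
      apply (pcont_minus (fun y => K (b, y)) (fun y => K (a, y)));
      apply (ccont_ver K); apply C2; auto. }
  change (Re Ci) with 0 in E. change (Im Ci) with 1 in E. change (Im 0) with 0 in E. lra.
Qed.

Lemma pow_bounded_le (r M : R) : 0 <= r -> (forall n, r ^ n <= M) -> r <= 1.
Proof.
  intros Hr H. apply Rnot_lt_le. intros H1.
  destruct (Pow_x_infinity r ltac:(rewrite Rabs_pos_eq; lra) (M + 1)) as [N HN].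
  specialize (HN N (le_n _)). rewrite Rabs_pos_eq in HN by (apply pow_le; lra).
  specialize (H N). lra.
Qed.

(** Landau's trick: Cauchy's formula for f^n gives |f(z0)|^n <= K B^n with the
    same K for all n, so the constant disappears as n grows. *)
Lemma maximum_modulus f a b c d x0 y0 B : a < x0 < b -> c < y0 < d -> on_rect (cdiff f) a b c d ->
  0 < B -> on_boundary (fun z => Cmod (f z) <= B) a b c d -> Cmod (f (x0, y0)) <= B.
Proof.
  intros Hx Hy D HB Bd. set (z0 := (x0, y0) : C).
  set (k := rect_int (fun w => / (w - z0))%C a b c d).
  assert (Hk : 0 < Cmod k) by (apply Cmod_gt_0, cauchy_kernel_nonzero; auto).
  set (r := Rmin (Rmin (x0 - a) (b - x0)) (Rmin (y0 - c) (d - y0))).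
  assert (Hr : 0 < r) by (unfold r; repeat apply Rmin_glb_lt; lra).
  assert (Hr' : r <= x0 - a /\ r <= b - x0 /\ r <= y0 - c /\ r <= d - y0).
  { unfold r. generalize (Rmin_l (Rmin (x0 - a) (b - x0)) (Rmin (y0 - c) (d - y0)))
     (Rmin_r (Rmin (x0 - a) (b - x0)) (Rmin (y0 - c) (d - y0)))
     (Rmin_l (x0 - a) (b - x0)) (Rmin_r (x0 - a) (b - x0)) (Rmin_l (y0 - c) (d - y0)) (Rmin_r (y0 - c) (d - y0)). lra. }
  assert (Dist : on_boundary (fun w => r <= Cmod (w - z0)) a b c d).
  { split; intros t Ht; split;
    [eapply Rle_trans; [|apply (Im_le_Cmod)] | eapply Rle_trans; [|apply (Im_le_Cmod)]
    |eapply Rle_trans; [|apply (re_le_Cmod)] | eapply Rle_trans; [|apply (re_le_Cmod)]];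
    simpl; unfold Rabs; destruct (Rcase_abs _); lra. }
  assert (Off := boundary_off a b c d x0 y0 Hx Hy). fold z0 in Off.
  assert (CK : on_boundary (ccont (fun w => / (w - z0))%C) a b c d).
  { eapply on_boundary_map; [|exact Off|exact Off]. intros z Hz _. now apply ccont_cauchy_kernel. }
  assert (Cf : on_boundary (ccont f) a b c d).
  { apply on_rect_boundary; try lra. intros x y ? ?. apply cdiff_ccont, D; auto. }
  assert (Pw : forall n, (Cmod (f z0) / B) ^ n <= 2 * / r * ((b - a) + (d - c)) / Cmod k).
  { intros n.
    assert (E := cauchy_formula (fun w => f w ^ n)%C a b c d x0 y0 Hx Hy
       (fun x y Hx Hy => cdiff_pow f n _ (D x y Hx Hy))).
    fold z0 k in E. apply (f_equal Cmod) in E. rewrite Cmod_mult, Cmod_pow in E.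
    apply Rle_div_r; auto. unfold Rdiv. rewrite Rpow_mult_distr, pow_inv.
    replace (Cmod (f z0) ^ n * / B ^ n * Cmod k) with (Cmod (f z0) ^ n * Cmod k * / B ^ n) by ring.
    rewrite <- E. assert (HBn : 0 < B ^ n) by (apply pow_lt; auto).
    apply (Rmult_le_reg_r (B ^ n)); auto. rewrite Rmult_assoc, Rinv_l, Rmult_1_r by lra.
    eapply Rle_trans. apply rect_int_bound with (M := B ^ n * / r); try lra.
    - eapply on_boundary_map; [|exact Cf|exact CK]. intros w H1 H2.
      apply (ccont_mult (fun w => f w ^ n)%C); auto.
      clear - H1. induction n; simpl. apply ccont_const. apply ccont_mult; auto.
    - eapply on_boundary_map; [|exact Bd|exact Dist]. intros w H1 H2. simpl.
      rewrite Cmod_mult, Cmod_pow, Cmod_inv by (apply Cmod_gt_0; lra).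
      apply Rmult_le_compat.
      + apply pow_le, Cmod_ge_0.
      + left; apply Rinv_0_lt_compat; lra.
      + apply pow_incr. split; auto. apply Cmod_ge_0.
      + apply Rinv_le_contravar; auto.
    - right; ring. }
  apply pow_bounded_le in Pw.
  - apply Rle_div_l in Pw; lra.
  - apply Rdiv_le_0_compat; auto. apply Cmod_ge_0.
Qed.

(** * The complex exponential *)

Lemma cdiff_quadratic f z l K r : 0 < r ->
  (forall w, Cmod (w - z) <= r -> Cmod (f w - f z - l * (w - z)) <= K * Cmod (w - z) ^ 2) ->
  cdiff f z.
Proof.
  intros Hr H. exists (fun w => if Ceq_dec w z then l else (f w - f z) / (w - z))%C. split.
  - intros e He. set (K' := Rmax K 1). assert (HK : 1 <= K') by apply Rmax_r.
    exists (Rmin r (e / K')). split. { apply Rmin_glb_lt; auto. apply Rdiv_lt_0_compat; lra. }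
    intros w Hw. destruct (Ceq_dec z z) as [_|]; [|now contradiction].
    destruct (Ceq_dec w z) as [->|Hwz].
    { replace (l - l)%C with (RtoC 0) by ring. rewrite Cmod_0; lra. }
    assert (N := Cneq_dist _ _ Hwz).
    assert (Hw1 : Cmod (w - z) < r) by (eapply Rlt_le_trans; [exact Hw|apply Rmin_l]).
    assert (Hw2 : Cmod (w - z) < e / K') by (eapply Rlt_le_trans; [exact Hw|apply Rmin_r]).
    replace ((f w - f z) / (w - z) - l)%C with ((f w - f z - l * (w - z)) / (w - z))%C by (field; auto).
    rewrite Cmod_div by auto. apply Cmod_gt_0 in N.
    apply Rlt_div_l; auto. eapply Rle_lt_trans. apply H; lra.
    apply Rlt_div_r in Hw2; [|lra].
    assert (K <= K') by apply Rmax_l. nra.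
  - intros w. destruct (Ceq_dec w z) as [->|Hwz]. ring. field. apply Cneq_dist; auto.
Qed.

Lemma exp_mono x y : x <= y -> exp x <= exp y.
Proof. intros [H|<-]. left; now apply exp_increasing. lra. Qed.

Definition cexp (z : C) : C := (exp (Re z) * cos (Im z), exp (Re z) * sin (Im z)).

Lemma Cmod_cexp z : Cmod (cexp z) = exp (Re z).
Proof.
  transitivity (sqrt (Rsqr (exp (Re z)))).
  2: apply sqrt_Rsqr; left; apply exp_pos.
  unfold Cmod, cexp; simpl.
  f_equal. generalize (sin2_cos2 (Im z)); unfold Rsqr; intros E.
  transitivity (exp (Re z) * exp (Re z) * (sin (Im z) * sin (Im z) + cos (Im z) * cos (Im z))).
  ring. rewrite E; ring.
Qed.

Lemma cexp_plus z w : cexp (z + w) = (cexp z * cexp w)%C.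
Proof.
  unfold cexp. rewrite re_plus, im_plus, exp_plus, cos_plus, sin_plus.
  apply injective_projections; simpl; ring.
Qed.

Lemma abs_sin_le y : Rabs (sin y) <= Rabs y.
Proof.
  assert (P : forall t, 0 <= t -> sin t <= t).
  { intros t [H|<-]. left; now apply sin_lt_x. rewrite sin_0; lra. }
  assert (Q : forall t, 0 <= t -> - t <= sin t).
  { intros t Ht. destruct (Rle_dec t PI) as [L|L].
    generalize (sin_ge_0 t Ht L); lra.
    generalize (SIN_bound t) PI2_1; lra. }
  unfold Rabs at 2. destruct (Rcase_abs y).
  - rewrite <- Rabs_Ropp, <- sin_neg. apply Rabs_le. split; [apply Ropp_le_cancel; generalize (Q (-y)); lra | apply P; lra].
  - apply Rabs_le. split; [apply Q; lra | apply P; lra].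
Qed.

Lemma cos_quadratic y : 0 <= 1 - cos y <= y ^ 2 / 2.
Proof.
  split. generalize (COS_bound y); lra.
  replace y with (2 * (y / 2)) at 1 by field. rewrite cos_2a_sin.
  assert (H := abs_sin_le (y / 2)). apply Rsqr_le_abs_1 in H. unfold Rsqr in H. nra.
Qed.

Lemma sin_cubic y : Rabs (sin y - y) <= Rabs y * (y ^ 2 / 2).
Proof.
  destruct (MVT_gen sin 0 y cos) as [c [Hc E]].
  - intros x _. apply is_derive_Reals, derivable_pt_lim_sin.
  - intros x _. apply continuity_sin.
  - rewrite sin_0, !Rminus_0_r in E. rewrite E.
    replace (cos c * y - y) with (y * - (1 - cos c)) by ring.
    rewrite Rabs_mult, Rabs_Ropp, (Rabs_pos_eq (1 - cos c)) by apply cos_quadratic.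
    apply Rmult_le_compat_l. apply Rabs_pos.
    apply Rle_trans with (1 := proj2 (cos_quadratic c)).
    assert (c ^ 2 <= y ^ 2); [|lra].
    rewrite <- !Rsqr_pow2. apply Rsqr_le_abs_1.
    unfold Rmin, Rmax in Hc. destruct (Rle_dec 0 y);
    unfold Rabs; destruct (Rcase_abs c), (Rcase_abs y); lra.
Qed.

Lemma exp_quadratic x : Rabs x <= / 2 -> 0 <= exp x - 1 - x <= 2 * x ^ 2.
Proof.
  intros H. apply Rabs_le_between in H. split.
  - generalize (exp_ineq1_le x); lra.
  - assert (E := exp_ineq1_le (- x)). rewrite exp_Ropp in E.
    assert (P := exp_pos x).
    assert (exp x * (1 - x) <= 1).
    { apply Rle_trans with (exp x * / exp x). apply Rmult_le_compat_l; lra. right; field; lra. }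
    assert (exp x <= / (1 - x)).
    { apply (Rmult_le_reg_r (1 - x)); [lra|]. rewrite Rinv_l; lra. }
    apply Rle_trans with (/ (1 - x) - 1 - x); [lra|].
    replace (/ (1 - x) - 1 - x) with (x ^ 2 * / (1 - x)) by (field; lra).
    rewrite Rmult_comm. apply Rmult_le_compat_r. apply pow2_ge_0.
    replace 2 with (/ / 2) by field. apply Rinv_le_contravar; lra.
Qed.

(** At 0 the remainder exp(w) - 1 - w is quadratic in w; the functional equation
    transports differentiability to every other point. *)
Lemma cdiff_cexp z : cdiff cexp z.
Proof.
  assert (H0 : cdiff cexp 0).
  { apply cdiff_quadratic with (RtoC 1) 8 (/ 2); [lra|]. intros w Hw.
    replace (w - 0)%C with w in * by ring.
    assert (E0 : cexp 0 = RtoC 1).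
    { unfold cexp; simpl. rewrite exp_0, cos_0, sin_0. apply injective_projections; simpl; ring. }
    rewrite E0, Cmult_1_l.
    assert (Hx := Rle_trans _ _ _ (re_le_Cmod w) Hw).
    assert (Hy := Rle_trans _ _ _ (Im_le_Cmod w) Hw).
    rewrite Cmod2_alt. destruct w as [x y]. unfold Re, Im in *; simpl fst in *; simpl snd in *.
    eapply Rle_trans. apply Cmod_le_abs. unfold cexp, Re, Im; simpl.
    set (X := Rabs x) in *. set (Y := Rabs y) in *.
    assert (EX := exp_quadratic x Hx).
    assert (CY := cos_quadratic y). assert (SY := sin_cubic y). assert (SA := abs_sin_le y).
    fold Y in SY, SA.
    assert (X2 : x ^ 2 = X * X). { unfold X. rewrite <- Rsqr_pow2. apply Rsqr_abs. }
    assert (Y2 : y ^ 2 = Y * Y). { unfold Y. rewrite <- Rsqr_pow2. apply Rsqr_abs. }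
    replace (x * (x * 1) + y * (y * 1)) with (X * X + Y * Y) by (rewrite <- X2, <- Y2; ring).
    rewrite X2, Y2 in *.
    assert (PX : 0 <= X) by apply Rabs_pos. assert (PY : 0 <= Y) by apply Rabs_pos.
    assert (EX3 : Rabs (exp x - 1) <= 2 * X).
    { replace (exp x - 1) with ((exp x - 1 - x) + x) by ring. eapply Rle_trans. apply Rabs_triang.
      fold X. rewrite Rabs_pos_eq by lra. nra. }
    assert (E2 : 0 <= exp x <= 2).
    { split. left; apply exp_pos. generalize (Rle_abs (exp x - 1)). lra. }
    assert (A1 : Rabs (exp x * cos y + -1 + - x) <= 2 * (X * X) + Y * Y).
    { replace (exp x * cos y + -1 + - x) with ((exp x - 1 - x) + - (exp x * (1 - cos y))) by ring.
      eapply Rle_trans. apply Rabs_triang. rewrite Rabs_Ropp, !Rabs_pos_eq by (try apply Rmult_le_pos; lra).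
      assert (exp x * (1 - cos y) <= 2 * (Y * Y / 2)) by (apply Rmult_le_compat; lra). lra. }
    assert (A2 : Rabs (exp x * sin y + - 0 + - y) <= 2 * X * Y + Y * (Y * Y / 2)).
    { replace (exp x * sin y + -0 + - y) with ((exp x - 1) * sin y + (sin y - y)) by ring.
      eapply Rle_trans. apply Rabs_triang. rewrite Rabs_mult.
      apply Rplus_le_compat; auto. apply Rmult_le_compat; auto using Rabs_pos. }
    eapply Rle_trans. apply Rplus_le_compat; [exact A1|exact A2].
    assert (Y * (Y * Y / 2) <= Y * Y) by nra. nra. }
  apply cdiff_ext with (fun w => cexp z * cexp (w - z))%C.
  { intros w. rewrite <- cexp_plus. f_equal. ring. }
  apply (cdiff_mult (fun _ => cexp z)). apply cdiff_const.
  apply (cdiff_comp cexp (fun w => w - z)%C).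
  apply (cdiff_minus (fun w => w) (fun _ => z)). apply cdiff_id. apply cdiff_const.
  replace (z - z)%C with (RtoC 0) by ring. exact H0.
Qed.

(** * Uniqueness in a strip *)

(** With b = PI / (2k), the function exp(A (exp(bz) + exp(-bz))) has modulus one
    on the lines |Im z| = k, since cos(bk) = 0, and modulus at most
    exp(2 A exp(bx)) on |Re z| = x, where f compensates it.  By the maximum
    principle f times this function is bounded by M inside the rectangle, although
    the factor is unbounded there as A grows. *)
Lemma strip_uniqueness f h k M : 0 < k < h -> (forall z, strip h z -> cdiff f z) -> 0 < M ->
  (forall z, strip h z -> Cmod (f z) <= M) ->
  (forall A0 X0, exists A x, A0 <= A /\ X0 < x /\ forall z, strip h z -> Rabs (Re z) = x ->
      Cmod (f z) <= M * exp (- (2 * A * exp (PI / (2 * k) * x)))) ->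
  forall z, strip k z -> f z = 0.
Proof.
  intros [Hk Hkh] D HM HB HA [x0 y0] [Hy1 Hy2]. simpl in Hy1, Hy2.
  set (b := PI / (2 * k)) in *.
  assert (Hb : 0 < b) by (apply Rdiv_lt_0_compat; [apply PI_RGT_0|lra]).
  assert (Hbk : b * k = PI / 2) by (unfold b; field; lra).
  set (z0 := (x0, y0) : C).
  set (g := fun z => (exp (b * Re z) + exp (- (b * Re z))) * cos (b * Im z)).
  assert (Hg0 : 0 < g z0).
  { unfold g. apply Rmult_lt_0_compat. generalize (exp_pos (b * Re z0)) (exp_pos (- (b * Re z0))); lra.
    apply cos_gt_0; unfold z0; simpl; nra. }
  assert (Key : forall A, 0 <= A -> exists A', A <= A' /\ Cmod (f z0) * exp (A' * g z0) <= M).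
  { intros A HA0. destruct (HA A (Rabs x0)) as [A' [x [HA' [Hx K]]]].
    exists A'. split; auto.
    pose (e := fun z : C => (cexp (RtoC b * z) + cexp (- RtoC b * z))%C).
    assert (He : forall z, Re (e z) = g z).
    { intros [u v]. unfold e, g, cexp; simpl. replace (b * u - 0 * v) with (b * u) by ring.
      replace (b * v + 0 * u) with (b * v) by ring.
      replace (- b * u - - 0 * v) with (- (b * u)) by ring.
      replace (- b * v + - 0 * u) with (- (b * v)) by ring. rewrite cos_neg. ring. }
    pose (G := fun z => (f z * cexp (RtoC A' * e z))%C).
    assert (HG : forall z, Cmod (G z) = Cmod (f z) * exp (A' * g z)).
    { intros z. unfold G. rewrite Cmod_mult, Cmod_cexp, re_scal_l, He. auto. }
    unfold z0. rewrite <- HG. assert (Hx0 := Rle_abs x0). assert (Hx0' := Rle_abs (- x0)).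
    rewrite Rabs_Ropp in Hx0'.
    assert (Hor : forall u v, cos (b * v) = 0 -> - h < v < h -> Cmod (G (u, v)) <= M).
    { intros u v Hc Hv. rewrite HG. unfold g; simpl. rewrite Hc, !Rmult_0_r, exp_0, Rmult_1_r.
      apply HB. split; simpl; lra. }
    assert (Ver : forall u v, Rabs u = x -> - k <= v <= k -> Cmod (G (u, v)) <= M).
    { intros u v Hu Hv. rewrite HG.
      assert (E : g (u, v) <= 2 * exp (b * x)).
      { unfold g; simpl. apply Rle_trans with ((exp (b * u) + exp (- (b * u))) * 1).
        - apply Rmult_le_compat_l. generalize (exp_pos (b * u)) (exp_pos (- (b * u))); lra.
          generalize (COS_bound (b * v)); lra.
        - assert (forall s, s <= Rabs u -> exp (b * s) <= exp (b * x)).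
          { intros s Hs. apply exp_mono. rewrite <- Hu. apply Rmult_le_compat_l; lra. }
          generalize (H u (Rle_abs u)). replace (- (b * u)) with (b * - u) by ring.
          assert (Q := H (- u)). rewrite <- Rabs_Ropp in Q. specialize (Q (Rle_abs _)). lra. }
      assert (K' := K (u, v) ltac:(split; simpl; lra) Hu).
      apply Rle_trans with (M * exp (- (2 * A' * exp (b * x))) * exp (A' * (2 * exp (b * x)))).
      - apply Rmult_le_compat; auto. apply Cmod_ge_0. left; apply exp_pos.
        apply exp_mono. apply Rmult_le_compat_l; lra.
      - rewrite Rmult_assoc, <- exp_plus. replace (_ + _) with 0 by ring. rewrite exp_0; lra. }
    apply (maximum_modulus G (- x) x (- k) k); auto; try lra.
    - intros u v Hu Hv. unfold G. apply (cdiff_mult f). apply D. split; simpl; lra.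
      apply (cdiff_comp cexp (fun z => RtoC A' * e z)%C). 2: apply cdiff_cexp.
      apply (cdiff_mult (fun _ => RtoC A')). apply cdiff_const. unfold e.
      apply cdiff_plus; apply (cdiff_comp cexp); try apply cdiff_cexp;
      apply cdiff_mult; try apply cdiff_const; apply cdiff_id.
    - split; intros t Ht; split.
      + apply Hor; [|lra]. replace (b * - k) with (- (PI / 2)) by lra. rewrite cos_neg. apply cos_PI2.
      + apply Hor; [|lra]. rewrite Hbk. apply cos_PI2.
      + apply Ver; auto. rewrite Rabs_Ropp. apply Rabs_pos_eq. generalize (Rabs_pos x0); lra.
      + apply Ver; auto. apply Rabs_pos_eq. generalize (Rabs_pos x0); lra. }
  apply Cmod_eq_0. apply Rle_antisym; [|apply Cmod_ge_0]. apply Rnot_lt_le. intros P.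
  fold z0 in P.
  (* with this A, exp(A g) >= 1 + A g already exceeds M / |f z0| *)
  set (T := M / Cmod (f z0) / g z0).
  assert (HT : 0 <= T). { unfold T. apply Rlt_le. repeat apply Rdiv_lt_0_compat; auto. }
  destruct (Key T HT) as [A' [H1 H2]].
  assert (E := exp_ineq1_le (A' * g z0)).
  assert (T * g z0 <= A' * g z0) by (apply Rmult_le_compat_r; lra).
  assert (T * g z0 = M / Cmod (f z0)) by (unfold T; field; lra).
  assert (Cmod (f z0) * (1 + M / Cmod (f z0)) <= M).
  { eapply Rle_trans; [|exact H2]. apply Rmult_le_compat_l; lra. }
  replace (Cmod (f z0) * (1 + M / Cmod (f z0))) with (Cmod (f z0) + M) in H3 by (field; lra). lra.
Qed.

(** * Weighted norms *)

Lemma RInt_const_R (c a b : R) : RInt (fun _ => c) a b = (b - a) * c.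
Proof. exact (RInt_const (V := R_CompleteNormedModule) a b c). Qed.

Lemma is_RInt_const_R (c a b : R) : is_RInt (fun _ => c) a b ((b - a) * c).
Proof. exact (is_RInt_const (V := R_NormedModule) a b c). Qed.

Lemma wnorm_le w h lam f M :
  (forall z, strip h z -> Cmod (f z) * exp (w (Rabs (lam * Re z))) <= M) ->
  Rbar_le (wnorm w h lam f) (Finite M).
Proof.
  intros H. apply Lub_Rbar_correct. intros r [z [Hz ->]]. apply H; auto.
Qed.

Lemma wnorm_ge w h lam f z : strip h z ->
  Rbar_le (Finite (Cmod (f z) * exp (w (Rabs (lam * Re z))))) (wnorm w h lam f).
Proof.
  intros Hz. apply (proj1 (Lub_Rbar_correct _)). exists z; auto.
Qed.

Lemma wnorm_finite w h lam f : 0 < h ->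
  (Rbar_lt (wnorm w h lam f) p_infty <->
  exists M, 0 < M /\ forall z, strip h z -> Cmod (f z) * exp (w (Rabs (lam * Re z))) <= M).
Proof.
  intros Hh. split.
  - intros H. destruct (wnorm w h lam f) as [M| |] eqn:E.
    + exists (Rmax M 1). split. apply Rlt_le_trans with 1; [lra|apply Rmax_r].
      intros z Hz. assert (K := wnorm_ge w h lam f z Hz). rewrite E in K. simpl in K.
      eapply Rle_trans; [exact K|apply Rmax_l].
    + destruct H.
    + exists 1. split. lra. intros z Hz.
      assert (K := wnorm_ge w h lam f z Hz). rewrite E in K. destruct K.
  - intros [M [_ H]]. apply Rbar_le_lt_trans with (1 := wnorm_le _ _ _ _ _ H). exact I.
Qed.

(** * The integral condition as a growth condition *)

Definition subexponential (w : R -> R) := forall mu, 0 < mu ->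
  exists K, forall t, 0 <= t -> w t <= K * exp (mu * t).

(** A superlevel set of a nondecreasing function is a half-line, so the integrand
    vanishes on one side of a point and is continuous on the other. *)
Lemma level_set_integrable (g phi : R -> R) b c : 0 <= b ->
  (forall s t, 0 <= s -> s <= t -> g s <= g t) -> (forall t, continuous phi t) ->
  ex_RInt (fun t => (if Rle_dec c (g t) then 1 else 0) * phi t) 0 b.
Proof.
  intros Hb Hg Hphi.
  assert (Hs : exists s, 0 <= s <= b /\ (forall t, 0 <= t < s -> g t < c) /\
     (forall t, s < t <= b -> c <= g t)).
  { destruct (completeness (fun t => t = 0 \/ (0 <= t <= b /\ g t < c))) as [s [S1 S2]].
    - exists b. intros t [->|[H _]]; lra.
    - exists 0; auto.
    - exists s. assert (0 <= s) by (apply S1; auto).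
      assert (s <= b) by (apply S2; intros t [->|[? _]]; lra).
      split; [lra|]. split.
      + intros t Ht. apply Rnot_le_lt. intros Hc.
        assert (s <= t); [|lra]. apply S2. intros u [->|[Hu Hgu]]; [lra|].
        apply Rnot_lt_le. intros L. generalize (Hg t u ltac:(lra) ltac:(lra)). lra.
      + intros t Ht. apply Rnot_lt_le. intros L.
        assert (t <= s); [|lra]. apply S1. right; split; auto; lra. }
  destruct Hs as [s [Hs [L U]]].
  apply ex_RInt_Chasles with s.
  - apply ex_RInt_ext with (fun _ => 0).
    + intros t Ht. rewrite Rmin_left, Rmax_right in Ht by lra.
      destruct (Rle_dec c (g t)). generalize (L t ltac:(lra)); lra. symmetry; apply Rmult_0_l.
    + apply ex_RInt_const.
  - apply ex_RInt_ext with phi.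
    + intros t Ht. rewrite Rmin_left, Rmax_right in Ht by lra.
      destruct (Rle_dec c (g t)). symmetry; apply Rmult_1_l. generalize (U t ltac:(lra)); lra.
    + apply (ex_RInt_continuous (V := R_CompleteNormedModule)). auto.
Qed.

(** A staircase function of u: this is e * min(n, floor(u / e)). *)
Fixpoint level_sum (e u : R) (n : nat) : R :=
  match n with
  | O => 0
  | S n => level_sum e u n + e * (if Rle_dec (INR (S n) * e) u then 1 else 0)
  end.

Lemma level_sum_approx e u n : 0 < e -> 0 <= u ->
  (INR n * e <= u -> level_sum e u n = INR n * e) /\
  (u < INR n * e -> u - e < level_sum e u n <= u).
Proof.
  intros He Hu. induction n as [|n [IH1 IH2]].
  - simpl. split; intros; lra.
  - change (level_sum e u (S n)) with
      (level_sum e u n + e * (if Rle_dec (INR (S n) * e) u then 1 else 0)).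
    rewrite S_INR. split; intros H; destruct (Rle_dec _ _) as [L|L]; lra.
Qed.

(** The monotone factor is a uniform limit of finite sums of indicators of its
    superlevel sets. *)
Lemma monotone_integrable (g phi : R -> R) b : 0 <= b -> (forall t, 0 <= t -> 0 <= g t) ->
  (forall s t, 0 <= s -> s <= t -> g s <= g t) -> (forall t, continuous phi t) ->
  (forall t, 0 <= t -> Rabs (phi t) <= 1) ->
  ex_RInt (fun t => g t * phi t) 0 b.
Proof.
  intros Hb Hpos Hg Hphi Hphi1.
  (* uniform convergence is required on the whole line, so the functions are made
     constant outside [0, b] *)
  set (clip := fun t => Rmax 0 (Rmin t b)).
  assert (Hclip : forall t, 0 <= clip t <= b).
  { intros t. unfold clip, Rmax, Rmin. destruct (Rle_dec _ _), (Rle_dec _ _); lra. }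
  assert (Hclip_id : forall t, Rmin 0 b < t < Rmax 0 b -> clip t = t).
  { intros t. rewrite Rmin_left, Rmax_right by lra. intros Ht. unfold clip.
    rewrite Rmin_left, Rmax_right; lra. }
  pose (e := fun n => / INR (S n)).
  assert (He : forall n, 0 < e n). { intros n. apply Rinv_0_lt_compat, lt_0_INR. lia. }
  pose (N := fun n => Z.to_nat (up (g b / e n))).
  assert (HN : forall n u, 0 <= u <= g b -> u < INR (N n) * e n).
  { intros n u Hu. unfold N. assert (Hq : 0 <= g b / e n) by (apply Rdiv_le_0_compat; auto; lra).
    destruct (archimed (g b / e n)) as [A _].
    rewrite INR_IZR_INZ, Z2Nat.id. 
    2: { apply le_IZR. lra. }
    apply Rle_lt_trans with (g b); [lra|]. apply Rlt_div_l in A; auto. apply He. }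
  pose (F := fun n t => level_sum (e n) (g (clip t)) (N n) * phi (clip t)).
  assert (HF : forall n, exists I, is_RInt (F n) 0 b I).
  { intros n.
    apply (ex_RInt_ext (fun t => level_sum (e n) (g t) (N n) * phi t)).
    { intros t Ht. unfold F. rewrite Hclip_id; auto. }
    generalize (N n) as m. induction m.
    - apply ex_RInt_ext with (fun _ => 0). intros; symmetry; apply Rmult_0_l. apply ex_RInt_const.
    - apply ex_RInt_ext with (fun t => level_sum (e n) (g t) m * phi t +
        e n * ((if Rle_dec (INR (S m) * e n) (g t) then 1 else 0) * phi t)).
      + intros t _. change (level_sum (e n) (g t) (S m)) with
          (level_sum (e n) (g t) m + e n * (if Rle_dec (INR (S m) * e n) (g t) then 1 else 0)).
        match goal with |- @eq _ ?x ?y => change (@eq R x y) end. ring.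
      + apply (ex_RInt_plus (V := R_NormedModule)); auto.
        apply (ex_RInt_scal (V := R_NormedModule)). apply level_set_integrable; auto. }
  apply (ex_RInt_ext (fun t => g (clip t) * phi (clip t))).
  { intros t Ht. rewrite Hclip_id; auto. }
  destruct (filterlim_RInt (V := R_CompleteNormedModule) F 0 b eventually _
     (fun t => g (clip t) * phi (clip t)) (fun n => RInt (F n) 0 b)) as [I [_ HI]].
  - intros n. apply (RInt_correct (V := R_CompleteNormedModule)). apply HF.
  - apply filterlim_locally. intros [eps Heps].
    destruct (nfloor_ex (/ eps)) as [n0 Hn0]. { left; apply Rinv_0_lt_compat; auto. }
    exists n0. intros n Hn t. change (Rabs (F n t - g (clip t) * phi (clip t)) < eps).
    unfold F. rewrite <- Rmult_minus_distr_r, Rabs_mult.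
    destruct (level_sum_approx (e n) (g (clip t)) (N n)) as [_ K]; auto.
    { apply Hpos, Hclip. }
    specialize (K (HN n _ ltac:(split; [apply Hpos, Hclip| apply Hg; apply Hclip]))).
    apply Rle_lt_trans with (e n * 1).
    + apply Rmult_le_compat; auto using Rabs_pos. apply Rabs_le; lra. apply Hphi1, Hclip.
    + rewrite Rmult_1_r. unfold e. rewrite <- (Rinv_inv eps).
      apply Rinv_lt_contravar.
      * apply Rmult_lt_0_compat. apply Rinv_0_lt_compat; auto. apply lt_0_INR; lia.
      * apply Rlt_le_trans with (INR n0 + 1); [lra|]. rewrite <- S_INR. apply le_INR. lia.
  - exists I; exact HI.
Qed.

Lemma weight_integrable w mu a b : weight_function w -> 0 < mu -> 0 <= a -> a <= b ->
  ex_RInt (fun t => w t * exp (- (mu * t))) a b.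
Proof.
  intros (W1 & W2 & _) Hmu Ha Hab.
  assert (G : forall c, 0 <= c -> ex_RInt (fun t => w t * exp (- (mu * t))) 0 c).
  { intros c Hc. apply monotone_integrable; auto.
    - intros t. apply (ex_derive_continuous (V := R_NormedModule)). auto_derive. auto.
    - intros t Ht. rewrite Rabs_pos_eq by (left; apply exp_pos).
      rewrite <- exp_0. apply exp_mono. nra. }
  apply (ex_RInt_Chasles_2 (V := R_CompleteNormedModule)) with 0. lra. apply G; lra.
Qed.

(** By monotonicity, the integral over [t, t+1] is at least
    w(t) exp(-mu(t+1)), and it is bounded independently of t. *)
Lemma epsilon0_subexponential w : weight_function w -> epsilon0 w -> subexponential w.
Proof.
  intros Hw HE mu Hmu. assert (W := Hw). destruct W as (W1 & W2 & _).
  destruct (HE mu Hmu) as [l Hl].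
  specialize (Hl (fun y => Rabs (y - l) < 1)).
  destruct Hl as [Q P HQ [X HP] HQP].
  { exists (mkposreal 1 Rlt_0_1). intros y Hy. exact Hy. }
  assert (B : forall b, 0 <= b -> X < b -> RInt (fun t => w t * exp (- (mu * t))) 0 b <= l + 1).
  { intros b Hb HX. destruct (HQP 0 b HQ (HP b HX)) as [I [HI HI']]. simpl in HI.
    rewrite (is_RInt_unique _ _ _ _ HI). apply Rabs_lt_between in HI'. lra. }
  exists ((l + 1) * exp mu). intros t Ht.
  set (b := Rmax X (t + 1) + 1).
  assert (Hb1 : X < b) by (unfold b; generalize (Rmax_l X (t + 1)); lra).
  assert (Hb2 : t + 1 < b) by (unfold b; generalize (Rmax_r X (t + 1)); lra).
  specialize (B b ltac:(lra) Hb1).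
  assert (Ex := fun a b => weight_integrable w mu a b Hw Hmu).
  assert (Pos : forall s, 0 <= s -> 0 <= w s * exp (- (mu * s))).
  { intros s Hs. apply Rmult_le_pos; auto. left; apply exp_pos. }
  assert (C1 := RInt_Chasles (V := R_CompleteNormedModule) _ _ _ _ (Ex 0 t ltac:(lra) ltac:(lra)) (Ex t b ltac:(lra) ltac:(lra))).
  assert (C2 := RInt_Chasles (V := R_CompleteNormedModule) _ _ _ _ (Ex t (t+1) ltac:(lra) ltac:(lra)) (Ex (t+1) b ltac:(lra) ltac:(lra))).
  rewrite <- C1, <- C2 in B. unfold plus in B; simpl in B.
  assert (P1 := RInt_ge_0 _ 0 t Ht (Ex 0 t ltac:(lra) ltac:(lra)) (fun s Hs => Pos s ltac:(lra))).
  assert (P2 := RInt_ge_0 _ (t+1) b ltac:(lra) (Ex (t+1) b ltac:(lra) ltac:(lra)) (fun s Hs => Pos s ltac:(lra))).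
  assert (P3 : w t * exp (- (mu * (t + 1))) <= RInt (fun t => w t * exp (- (mu * t))) t (t+1)).
  { assert (E : RInt (fun _ => w t * exp (- (mu * (t + 1)))) t (t + 1) = w t * exp (- (mu * (t + 1)))).
    { rewrite RInt_const_R. match goal with |- @eq _ ?x ?y => change (@eq R x y) end. ring. }
    rewrite <- E. apply RInt_le; try lra. apply ex_RInt_const. apply Ex; lra.
    intros s Hs. apply Rmult_le_compat; auto. left; apply exp_pos. apply W2; lra.
    apply exp_mono. nra. }
  assert (E : w t = w t * exp (- (mu * (t + 1))) * (exp mu * exp (mu * t))).
  { rewrite <- exp_plus, Rmult_assoc, <- exp_plus. replace (_ + _) with 0 by ring. rewrite exp_0; ring. }
  rewrite E, (Rmult_assoc (l + 1)). apply Rmult_le_compat_r.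
  apply Rmult_le_pos; left; apply exp_pos. lra.
Qed.

Lemma subexponential_epsilon0 w : weight_function w -> subexponential w -> epsilon0 w.
Proof.
  intros Hw HS mu Hmu. assert (W := Hw). destruct W as (W1 & W2 & _).
  destruct (HS (mu / 2)) as [K HK]; [lra|].
  assert (Ex := fun a b => weight_integrable w mu a b Hw Hmu).
  set (f := fun t => w t * exp (- (mu * t))) in *.
  assert (Pos : forall s, 0 <= s -> 0 <= f s).
  { intros s Hs. apply Rmult_le_pos; auto. left; apply exp_pos. }
  assert (K0 : 0 <= K). { generalize (HK 0 (Rle_refl _)) (W1 0 (Rle_refl _)).
    rewrite Rmult_0_r, exp_0. lra. }
  assert (Mono : forall b c, 0 <= b -> b <= c -> RInt f 0 b <= RInt f 0 c).
  { intros b c Hb Hc.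
    assert (C1 := RInt_Chasles (V := R_CompleteNormedModule) f _ _ _ (Ex 0 b ltac:(lra) ltac:(lra)) (Ex b c ltac:(lra) ltac:(lra))).
    assert (P := RInt_ge_0 f b c Hc (Ex b c ltac:(lra) ltac:(lra)) (fun s Hs => Pos s ltac:(lra))).
    rewrite <- C1. unfold plus; simpl. lra. }
  assert (Bd : forall b, 0 <= b -> RInt f 0 b <= 2 * K / mu).
  { intros b Hb.
    assert (J : is_RInt (fun t => K * exp (- (mu / 2 * t))) 0 b
       (minus (- (2 * K / mu) * exp (- (mu / 2 * b))) (- (2 * K / mu) * exp (- (mu / 2 * 0))))).
    { apply (is_RInt_derive (V := R_CompleteNormedModule) (fun t => - (2 * K / mu) * exp (- (mu / 2 * t)))).
      - intros t _. auto_derive; auto. field. lra.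
      - intros t _. apply (ex_derive_continuous (V := R_NormedModule)). auto_derive. auto. }
    apply Rle_trans with (RInt (fun t => K * exp (- (mu / 2 * t))) 0 b).
    - apply RInt_le; auto. apply Ex; lra. eexists; exact J.
      intros t Ht. unfold f.
      replace (exp (- (mu / 2 * t))) with (exp (mu / 2 * t) * exp (- (mu * t)))
        by (rewrite <- exp_plus; f_equal; field).
      rewrite <- Rmult_assoc. apply Rmult_le_compat_r. left; apply exp_pos. apply HK; lra.
    - rewrite (is_RInt_unique _ _ _ _ J). unfold minus, plus, opp; simpl.
      rewrite Rmult_0_r, Ropp_0, exp_0.
      assert (0 <= 2 * K / mu * exp (- (mu / 2 * b))).
      { apply Rmult_le_pos. apply Rdiv_le_0_compat; lra. left; apply exp_pos. } lra. }
  destruct (completeness (fun r => exists b, 0 <= b /\ r = RInt f 0 b)) as [l [L1 L2]].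
  { exists (2 * K / mu). intros r [b [Hb ->]]; auto. }
  { exists (RInt f 0 0), 0; split; auto; lra. }
  exists l. intros P [[e He] HP].
  assert (Hb : exists b, 0 <= b /\ l - e < RInt f 0 b).
  { apply NNPP. intros HN. assert (l <= l - e); [|lra]. apply L2. intros r [b [Hb ->]].
    apply Rnot_lt_le. intros L. apply HN; eauto. }
  destruct Hb as [b [Hb HbL]].
  apply (Filter_prod _ _ _ (fun x => x = 0) (fun c => b < c)).
  - reflexivity.
  - exists b. auto.
  - intros x c -> Hc. exists (RInt f 0 c). split.
    + apply (RInt_correct (V := R_CompleteNormedModule)). apply Ex; lra.
    + apply HP. change (Rabs (RInt f 0 c - l) < e). apply Rabs_lt_between.
      generalize (Mono b c Hb ltac:(lra)) (L1 (RInt f 0 c) ltac:(exists c; split; auto; lra)). lra.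
Qed.

(** For lam = b / mu the substitution t = lam x turns an excess of w(t) over
    K exp(mu t) into an excess of w(lam x) over K exp(b x), with b the exponent
    that strip_uniqueness requires. *)
Lemma A_space_trivial w h f : weight_function w -> A_space w h f -> ~ subexponential w ->
  forall z, strip h z -> f z = 0.
Proof.
  intros (W1 & W2 & _) [An Bd] HN z Hz.
  assert (exists mu, 0 < mu /\ forall K, exists t, 0 <= t /\ K * exp (mu * t) < w t) as [mu [Hmu HK]].
  { apply NNPP. intros H. apply HN. intros mu Hmu. apply NNPP. intros H'. apply H. exists mu.
    split; auto. intros K. apply NNPP. intros H''. apply H'. exists K. intros t Ht.
    apply Rnot_lt_le. intros L. apply H''. eauto. }
  (* two intermediate widths |Im z| < k < k' < h: f is bounded on the open strip of
     width k', hence up to the boundary of the strip of width k *)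
  set (k := (Rabs (Im z) + h) / 2). set (k' := (k + h) / 2).
  assert (Hz' : Rabs (Im z) < h). { destruct Hz. apply Rabs_def1; lra. }
  assert (Hk : Rabs (Im z) < k /\ k < k' /\ k' < h) by (unfold k', k; lra).
  assert (HI := Rabs_pos (Im z)).
  set (b := PI / (2 * k)).
  assert (Hb : 0 < b) by (apply Rdiv_lt_0_compat; [apply PI_RGT_0|lra]).
  assert (Hlam : 0 < b / mu) by (apply Rdiv_lt_0_compat; auto).
  destruct (proj1 (wnorm_finite w k' (b / mu) f ltac:(lra)) (Bd k' (b / mu) ltac:(lra) Hlam)) as [M [HM HB]].
  apply (strip_uniqueness f k' k M); try lra.
  - intros v [Hv1 Hv2]. apply ex_derive_cdiff, An. split; lra.
  - intros v Hv. specialize (HB v Hv).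
    apply Rle_trans with (2 := HB). rewrite <- (Rmult_1_r (Cmod (f v))) at 1.
    apply Rmult_le_compat_l. apply Cmod_ge_0. rewrite <- exp_0. apply exp_mono, W1, Rabs_pos.
  - intros A0 X0.
    set (A := Rmax 1 (Rmax A0 (w (b / mu * Rabs X0)))).
    assert (HA : 1 <= A /\ A0 <= A /\ w (b / mu * Rabs X0) <= A).
    { unfold A. generalize (Rmax_l 1 (Rmax A0 (w (b / mu * Rabs X0)))) (Rmax_r 1 (Rmax A0 (w (b / mu * Rabs X0))))
       (Rmax_l A0 (w (b / mu * Rabs X0))) (Rmax_r A0 (w (b / mu * Rabs X0))). lra. }
    destruct (HK (2 * A)) as [t [Ht Hwt]].
    assert (E1 := exp_ineq1_le (mu * t)). assert (Hmt : 0 <= mu * t) by (apply Rmult_le_pos; lra).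
    exists A, (t / (b / mu)). split; [lra|]. split.
    + apply Rnot_le_lt. intros L. apply Rle_div_l in L; auto.
      assert (w t <= w (b / mu * Rabs X0)).
      { apply W2; auto. rewrite Rmult_comm. eapply Rle_trans; [exact L|].
        apply Rmult_le_compat_r. lra. apply Rle_abs. }
      nra.
    + intros v Hv Hvx. specialize (HB v Hv).
      rewrite Rabs_mult, Hvx, (Rabs_pos_eq (b / mu)) in HB by lra.
      replace (b / mu * (t / (b / mu))) with t in HB by (field; lra).
      fold b. replace (b * (t / (b / mu))) with (mu * t) by (field; lra).
      rewrite exp_Ropp. apply Rle_div_r. apply exp_pos.
      eapply Rle_trans; [|exact HB]. apply Rmult_le_compat_l. apply Cmod_ge_0.
      apply exp_mono. lra.
  - destruct Hk as [Hk _]. apply Rabs_def2 in Hk. split; lra.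
Qed.

(** * Choice of the exponents *)

(** Let rho(t) be the supremum of g(s)/s over s >= t, which tends to 0.  Then
    G(t) = t sqrt(rho(t)) is still o(t), while g(lam t) <= lam t rho(t) <= G(t) as
    soon as lam sqrt(rho(t)) <= 1. *)
Lemma slow_majorant (g : R -> R) : (forall t, 0 <= t -> 0 <= g t) ->
  (forall e, 0 < e -> exists T, forall t, T <= t -> g t <= e * t) ->
  exists G : R -> R, (forall t, 0 < t -> 0 <= G t) /\
    (forall e, 0 < e -> exists T, forall t, T <= t -> G t <= e * t) /\
    forall lam, 1 <= lam -> exists T, forall t, T <= t -> g (lam * t) <= G t.
Proof.
  intros Hpos Hsmall.
  (* truncating at 1 keeps the supremum finite for every t > 0 *)
  set (E := fun t r => exists s, t <= s /\ r = Rmin 1 (g s / s)).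
  set (rho := fun t => real (Lub_Rbar (E t))).
  assert (Hrho : forall t, 0 < t -> is_lub (E t) (rho t)).
  { intros t Ht. assert (L := Lub_Rbar_correct (E t)). unfold rho.
    destruct (Lub_Rbar (E t)) as [l| |].
    - destruct L as [L1 L2]. split. exact L1. intros b Hb. exact (L2 (Finite b) Hb).
    - destruct L as [_ L2]. destruct (L2 (Finite 1)). intros r [s [_ ->]]. apply Rmin_l.
    - destruct L as [L1 _]. destruct (L1 (Rmin 1 (g t / t))). exists t; split; auto; lra. }
  assert (Hrho0 : forall t, 0 < t -> 0 <= rho t).
  { intros t Ht. apply Rle_trans with (Rmin 1 (g t / t)).
    apply Rmin_glb; [lra|]. apply Rdiv_le_0_compat; auto; apply Hpos; lra.
    apply (Hrho t Ht). exists t; split; auto; lra. }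
  assert (Hrhos : forall e, 0 < e -> exists T, 0 < T /\ forall t, T <= t -> rho t <= e).
  { intros e He. destruct (Hsmall e He) as [T HT]. exists (Rmax 1 T). split.
    apply Rlt_le_trans with 1; [lra|apply Rmax_l].
    intros t Ht. assert (H1 := Rmax_l 1 T). assert (H2 := Rmax_r 1 T).
    apply (Hrho t ltac:(lra)). intros r [s [Hs ->]].
    eapply Rle_trans; [apply Rmin_r|]. apply Rle_div_l; [lra|]. apply HT; lra. }
  exists (fun t => t * sqrt (rho t)). split; [|split].
  - intros t Ht. apply Rmult_le_pos; [lra|apply sqrt_pos].
  - intros e He. destruct (Hrhos (e * e)) as [T [HT0 HT]]. nra.
    exists T. intros t Ht. rewrite (Rmult_comm e). apply Rmult_le_compat_l; [lra|].
    rewrite <- (sqrt_square e) by lra. apply sqrt_le_1_alt, HT; auto.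
  - intros lam Hlam. destruct (Hsmall 1 Rlt_0_1) as [T1 HT1].
    destruct (Hrhos (/ (lam * lam))) as [T2 [HT20 HT2]]. { apply Rinv_0_lt_compat; nra. }
    exists (Rmax T1 T2). intros t Ht.
    assert (H1 := Rmax_l T1 T2). assert (H2 := Rmax_r T1 T2).
    assert (Hs : t <= lam * t) by nra.
    assert (A : g (lam * t) <= lam * t * rho t).
    { assert (K : Rmin 1 (g (lam * t) / (lam * t)) <= rho t).
      { apply (Hrho t ltac:(lra)). exists (lam * t); auto. }
      rewrite Rmin_right in K.
      2: { apply Rle_div_l; [lra|]. apply HT1. lra. }
      apply Rle_div_l in K; lra. }
    eapply Rle_trans; [exact A|].
    set (q := sqrt (rho t)).
    assert (Hq : rho t = q * q). { unfold q. rewrite sqrt_sqrt; auto. apply Hrho0; lra. }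
    assert (Hq0 : 0 <= q) by apply sqrt_pos.
    assert (Hlq : lam * q <= 1).
    { rewrite <- (sqrt_square lam) by lra. unfold q. rewrite <- sqrt_mult_alt by nra.
      rewrite <- sqrt_1. apply sqrt_le_1_alt.
      apply Rle_trans with (lam * lam * / (lam * lam)).
      apply Rmult_le_compat_l. nra. apply HT2; lra. right; field; lra. }
    rewrite Hq. replace (lam * t * (q * q)) with (t * q * (lam * q)) by ring.
    rewrite <- (Rmult_1_r (t * q)) at 2. apply Rmult_le_compat_l; auto. apply Rmult_le_pos; lra.
Qed.

Lemma nat_le_eps_pow2 e : 0 < e -> exists N, forall n, (N <= n)%nat -> INR n + 1 <= e * 2 ^ n.
Proof.
  intros He.
  assert (Sq : forall n, INR n * INR n <= 4 * 2 ^ n /\ INR n + 1 <= 2 ^ n).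
  { induction n as [|n [IH1 IH2]]. simpl; lra. rewrite S_INR; simpl pow.
    generalize (pos_INR n). split; nra. }
  destruct (INR_unbounded (8 / e + 1)) as [N HN]. exists N. intros n Hn.
  apply le_INR in Hn. assert (H8 : 0 < 8 / e) by (apply Rdiv_lt_0_compat; lra).
  destruct (Sq n) as [S1 _].
  assert (Hn8 : 8 < e * INR n).
  { apply Rlt_le_trans with (e * (8 / e + 1)). 
    replace (e * (8 / e + 1)) with (8 + e) by (field; lra). lra.
    apply Rmult_le_compat_l; lra. }
  assert (INR n * 8 <= 4 * (e * 2 ^ n)).
  { apply Rle_trans with (INR n * (e * INR n)). apply Rmult_le_compat_l; lra.
    replace (INR n * (e * INR n)) with (e * (INR n * INR n)) by ring.
    apply Rle_trans with (e * (4 * 2 ^ n)); [apply Rmult_le_compat_l; lra|]. lra. }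
  lra.
Qed.

(** Apply slow_majorant to ln(1 + w) and round G(2^n) up; the summand n + 1 makes
    the exponents exceed n, which later gives geometric convergence. *)
Lemma lacunary_exponents w : weight_function w -> subexponential w ->
  exists k : nat -> nat, (forall n, (n < k n)%nat) /\
    (forall e, 0 < e -> exists N, forall n, (N <= n)%nat -> INR (k n) <= e * 2 ^ n) /\
    forall lam, 0 < lam -> exists N, forall n, (N <= n)%nat -> 2 * w (lam * 2 ^ (n + 2)) <= 4 ^ (k n).
Proof.
  intros (W1 & W2 & _) HS.
  destruct (slow_majorant (fun t => ln (1 + w t))) as (G & G0 & Gs & Gm).
  - intros t Ht. rewrite <- ln_1. apply ln_le; [lra|]. generalize (W1 t Ht); lra.
  - intros e He. destruct (HS (e / 2)) as [K HK]; [lra|].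
    set (K' := Rmax K 0). assert (H1 := Rmax_l K 0). assert (H2 := Rmax_r K 0). fold K' in H1, H2.
    exists (Rmax 0 (2 * ln (1 + K') / e)). intros t Ht.
    assert (Ht0 : 0 <= t) by (eapply Rle_trans; [apply Rmax_l|exact Ht]).
    assert (Ht1 : 2 * ln (1 + K') / e <= t) by (eapply Rle_trans; [apply Rmax_r|exact Ht]).
    apply Rle_div_l in Ht1; auto.
    assert (E1 : 1 <= exp (e / 2 * t)). { rewrite <- exp_0. apply exp_mono. nra. }
    apply Rle_trans with (ln ((1 + K') * exp (e / 2 * t))).
    + apply ln_le. generalize (W1 t Ht0); lra.
      generalize (HK t Ht0). assert (K * exp (e / 2 * t) <= K' * exp (e / 2 * t)).
      apply Rmult_le_compat_r; lra. lra.
    + rewrite ln_mult, ln_exp; try lra.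
  - exists (fun n => (n + 1 + Z.to_nat (up (G (2 ^ n)%R)))%nat).
    assert (P2 : forall n, 0 < 2 ^ n) by (intros; apply pow_lt; lra).
    assert (Up : forall n, G (2 ^ n) <= INR (Z.to_nat (up (G (2 ^ n)))) <= G (2 ^ n) + 1).
    { intros n. assert (Hg := G0 _ (P2 n)). destruct (archimed (G (2 ^ n))) as [A B].
      rewrite INR_IZR_INZ, Z2Nat.id. lra. apply le_IZR. lra. }
    split; [intros; lia|]. split.
    + intros e He. destruct (nat_le_eps_pow2 (e / 3)) as [N1 HN1]; [lra|].
      destruct (Gs (e / 3)) as [T HT]; [lra|].
      destruct (Pow_x_infinity 2 ltac:(rewrite Rabs_pos_eq; lra) T) as [N2 HN2].
      exists (N1 + N2)%nat. intros n Hn.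
      rewrite !plus_INR. simpl (INR 1).
      assert (A1 := HN1 n ltac:(lia)). assert (A2 := HN2 n ltac:(lia)).
      rewrite Rabs_pos_eq in A2 by (left; auto). assert (A3 := HT (2 ^ n) ltac:(lra)).
      generalize (Up n) (pos_INR n). lra.
    (* the factor 4 accounts for the exponent n + 2 in place of n *)
    + intros lam Hlam. set (lam' := Rmax 1 (4 * lam)).
      assert (L1 : 1 <= lam') by apply Rmax_l. assert (L2 : 4 * lam <= lam') by apply Rmax_r.
      destruct (Gm lam' L1) as [T HT].
      destruct (Pow_x_infinity 2 ltac:(rewrite Rabs_pos_eq; lra) T) as [N2 HN2].
      exists N2. intros n Hn. assert (A2 := HN2 n Hn).
      rewrite Rabs_pos_eq in A2 by (left; auto). specialize (HT (2 ^ n) ltac:(lra)).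
      set (k := Z.to_nat _). assert (Uk := Up n). fold k in Uk.
      assert (E : forall m, exp (INR m) <= 4 ^ m).
      { intros m. induction m. simpl. rewrite exp_0; lra.
        rewrite S_INR, exp_plus, Rmult_comm. simpl pow.
        apply Rmult_le_compat; auto; try (left; apply exp_pos). generalize exp_le_3; lra. }
      assert (Hw : 0 <= w (lam' * 2 ^ n)). { apply W1. specialize (P2 n). nra. }
      rewrite !pow_add. assert (P1 : 1 <= 4 ^ n) by (apply pow_R1_Rle; lra).
      assert (A : 1 + w (lam' * 2 ^ n) <= 4 ^ k).
      { eapply Rle_trans; [|apply E]. rewrite <- (exp_ln (1 + w (lam' * 2 ^ n))) by lra.
        apply exp_mono. lra. }
      assert (B : w (lam * (2 ^ n * 2 ^ 2)) <= w (lam' * 2 ^ n)).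
      { apply W2. specialize (P2 n). nra. specialize (P2 n). nra. }
      simpl (4 ^ 1). assert (4 ^ k <= 4 ^ n * 4 ^ k) by (rewrite <- (Rmult_1_l (4 ^ k)) at 1; apply Rmult_le_compat_r; lra).
      lra.
Qed.

(** * Series of complex functions *)

Definition Cseries (u : nat -> C) : C := (Series (fun n => Re (u n)), Series (fun n => Im (u n))).

Definition dominated (u : nat -> C) (b : nat -> R) := ex_series b /\ forall n, Cmod (u n) <= b n.

Lemma dominated_Re u b : dominated u b -> ex_series (fun n => Re (u n)).
Proof.
  intros [B H]. apply (ex_series_le (V := R_CompleteNormedModule)) with b; auto.
  intros n. eapply Rle_trans; [apply re_le_Cmod|apply H].
Qed.

Lemma dominated_Im u b : dominated u b -> ex_series (fun n => Im (u n)).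
Proof.
  intros [B H]. apply (ex_series_le (V := R_CompleteNormedModule)) with b; auto.
  intros n. eapply Rle_trans; [apply Im_le_Cmod|apply H].
Qed.

(** Real and imaginary parts are estimated separately, whence the factor 2. *)
Lemma Cseries_bound u b : dominated u b -> Cmod (Cseries u) <= 2 * Series b.
Proof.
  intros H. eapply Rle_trans. apply Cmod_le_abs. unfold Cseries; simpl.
  assert (K : forall p : C -> R, (forall z, Rabs (p z) <= Cmod z) ->
    Rabs (Series (fun n => p (u n))) <= Series b).
  { intros p P. destruct H as [B H].
    assert (S : forall n, 0 <= Rabs (p (u n)) <= b n).
    { intros n; split. apply Rabs_pos. eapply Rle_trans; [apply P|apply H]. }
    eapply Rle_trans. apply Series_Rabs.
    - apply (ex_series_le (V := R_CompleteNormedModule)) with b; auto.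
      intros n. change (Rabs (Rabs (p (u n))) <= b n). rewrite Rabs_Rabsolu. apply S.
    - apply Series_le; auto. }
  generalize (K Re re_le_Cmod) (K Im Im_le_Cmod). lra.
Qed.

Lemma Cseries_minus u v b c : dominated u b -> dominated v c ->
  Cseries (fun n => u n - v n)%C = (Cseries u - Cseries v)%C.
Proof.
  intros U V. unfold Cseries. apply injective_projections; simpl.
  - rewrite <- Series_opp, <- Series_plus; auto. eapply dominated_Re; eauto.
    apply (ex_series_opp (V := R_NormedModule)). eapply dominated_Re; eauto.
  - rewrite <- Series_opp, <- Series_plus; auto. eapply dominated_Im; eauto.
    apply (ex_series_opp (V := R_NormedModule)). eapply dominated_Im; eauto.
Qed.

Lemma Cseries_mult_r u b z : dominated u b ->
  Cseries (fun n => u n * z)%C = (Cseries u * z)%C.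
Proof.
  intros U. assert (UR := dominated_Re _ _ U). assert (UI := dominated_Im _ _ U).
  destruct z as [x y]. unfold Cseries, Cmult; simpl.
  assert (S : forall (a : nat -> R) c, ex_series a -> ex_series (fun n => a n * c)).
  { intros a c H. apply ex_series_scal_r. exact H. }
  apply injective_projections; simpl.
  - rewrite <- !Series_scal_r. rewrite <- Series_minus; auto.
  - rewrite <- !Series_scal_r. rewrite <- Series_plus; auto.
Qed.

Lemma Cseries_incr u b : dominated u b -> Cseries u = (u 0%nat + Cseries (fun n => u (S n)))%C.
Proof.
  intros U. unfold Cseries. apply injective_projections; simpl.
  - rewrite (Series_incr_1 (fun n => Re (u n))); auto. eapply dominated_Re; eauto.
  - rewrite (Series_incr_1 (fun n => Im (u n))); auto. eapply dominated_Im; eauto.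
Qed.

Lemma dominated_incr u b : dominated u b -> dominated (fun n => u (S n)) (fun n => b (S n)).
Proof.
  intros [B H]; split; auto. apply (ex_series_incr_1 (V := R_NormedModule)) in B. exact B.
Qed.

(** Weierstrass' test: finitely many terms are continuous and the tail is small
    uniformly near z. *)
Lemma Cseries_cont (u : nat -> C -> C) (b : nat -> R) z r : 0 < r -> ex_series b ->
  (forall n w, Cmod (w - z) <= r -> Cmod (u n w) <= b n) ->
  (forall n, ccont (u n) z) -> ccont (fun w => Cseries (fun n => u n w)) z.
Proof.
  intros Hr HB HD HC e He.
  assert (Dz : Cmod (z - z) <= r).
  { replace (z - z)%C with (RtoC 0) by ring. rewrite Cmod_0; lra. }
  (* induction on the number N + 1 of terms peeled off before the remaining sum of
     majorants drops below e / 8; e / 2 bounds the contribution of both tails *)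
  assert (Ind : forall N u (b : nat -> R), ex_series b ->
    (forall n w, Cmod (w - z) <= r -> Cmod (u n w) <= b n) -> (forall n, ccont (u n) z) ->
    Series b - sum_n b N < e / 8 ->
    forall e', e / 2 < e' -> exists d, 0 < d /\ forall w, Cmod (w - z) < d -> 
      Cmod (Cseries (fun n => u n w) - Cseries (fun n => u n z)) < e').
  { clear u b HB HD HC. induction N as [|N IH]; intros u b HB HD HC HN e' He'.
    - destruct (HC 0%nat (e' - e / 2) ltac:(lra)) as [d [Hd K]].
      exists (Rmin d r). split. apply Rmin_glb_lt; auto. intros w Hw.
      assert (Hw1 : Cmod (w - z) < d) by (eapply Rlt_le_trans; [exact Hw|apply Rmin_l]).
      assert (Hw2 : Cmod (w - z) <= r) by (left; eapply Rlt_le_trans; [exact Hw|apply Rmin_r]).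
      assert (U : forall v, Cmod (v - z) <= r -> dominated (fun n => u n v) b) by (split; auto).
      rewrite (Cseries_incr _ _ (U w Hw2)), (Cseries_incr _ _ (U z Dz)).
      rewrite sum_O in HN. rewrite (Series_incr_1 b HB) in HN.
      assert (B1 := Cseries_bound _ _ (dominated_incr _ _ (U w Hw2))).
      assert (B2 := Cseries_bound _ _ (dominated_incr _ _ (U z Dz))).
      specialize (K w Hw1). simpl in *.
      replace (u 0%nat w + Cseries (fun n => u (S n) w) - (u 0%nat z + Cseries (fun n => u (S n) z)))%C
        with ((u 0%nat w - u 0%nat z) + (Cseries (fun n => u (S n) w) - Cseries (fun n => u (S n) z)))%C by ring.
      eapply Rle_lt_trans. apply Cmod_triangle.
      generalize (Cmod_minus_le (Cseries (fun n => u (S n) w)) (Cseries (fun n => u (S n) z))). lra.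
    - set (t := (e' - e / 2) / 2).
      destruct (HC 0%nat t ltac:(unfold t; lra)) as [d1 [Hd1 K1]].
      destruct (IH (fun n => u (S n)) (fun n => b (S n))) with (e' := e' - t) as [d2 [Hd2 K2]]; auto.
      { apply (ex_series_incr_1 (V := R_NormedModule)) in HB. exact HB. }
      { rewrite (Series_incr_1 b HB) in HN.
        assert (E : sum_n b (S N) = b 0%nat + sum_n (fun n => b (S n)) N).
        { unfold sum_n. rewrite sum_Sn_m by lia. rewrite <- sum_n_m_S. reflexivity. }
        unfold sum_n in *. rewrite E in HN. simpl in HN. lra. }
      { unfold t; lra. }
      exists (Rmin (Rmin d1 d2) r). split. repeat apply Rmin_glb_lt; auto. intros w Hw.
      assert (M1 := Rmin_l (Rmin d1 d2) r). assert (M2 := Rmin_r (Rmin d1 d2) r).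
      assert (M3 := Rmin_l d1 d2). assert (M4 := Rmin_r d1 d2).
      assert (U : forall v, Cmod (v - z) <= r -> dominated (fun n => u n v) b) by (split; auto).
      rewrite (Cseries_incr _ _ (U w ltac:(lra))), (Cseries_incr _ _ (U z Dz)).
      replace (u 0%nat w + Cseries (fun n => u (S n) w) - (u 0%nat z + Cseries (fun n => u (S n) z)))%C
        with ((u 0%nat w - u 0%nat z) + (Cseries (fun n => u (S n) w) - Cseries (fun n => u (S n) z)))%C by ring.
      eapply Rle_lt_trans. apply Cmod_triangle.
      generalize (K1 w ltac:(lra)) (K2 w ltac:(lra)). lra. }
  assert (L := Series_correct b HB).
  destruct (proj1 (filterlim_locally _ _) L (mkposreal (e / 8) ltac:(lra))) as [N HN].
  specialize (HN N (le_n _)). change (Rabs (sum_n b N - Series b) < e / 8) in HN.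
  apply Rabs_def2 in HN. apply (Ind N u b); auto; lra.
Qed.

(** The divided difference (w^m - z^m) / (w - z), also defined at w = z. *)
Fixpoint pow_slope (z w : C) (m : nat) : C :=
  match m with O => RtoC 0 | S m => (w * pow_slope z w m + z ^ m)%C end.

Lemma pow_slope_eq z w m : (w ^ m - z ^ m = pow_slope z w m * (w - z))%C.
Proof.
  induction m; simpl. ring. 
  replace (w * w ^ m - z * z ^ m)%C with (w * (w ^ m - z ^ m) + z ^ m * (w - z))%C by ring.
  rewrite IHm. ring.
Qed.

Lemma pow_slope_bound z w m r : 1 <= r -> Cmod z <= r -> Cmod w <= r ->
  Cmod (pow_slope z w m) <= (2 * r) ^ m.
Proof.
  intros Hr Hz Hw.
  assert (B : Cmod (pow_slope z w m) <= INR m * r ^ m).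
  { induction m. simpl. rewrite Cmod_0; lra. rewrite S_INR. simpl.
    eapply Rle_trans. apply Cmod_triangle. rewrite Cmod_mult, Cmod_pow.
    assert (H1 : Cmod w * Cmod (pow_slope z w m) <= r * (INR m * r ^ m)).
    { apply Rmult_le_compat; auto; apply Cmod_ge_0. }
    assert (H2 : Cmod z ^ m <= r ^ m). { apply pow_incr; split; auto. apply Cmod_ge_0. }
    assert (H3 : 0 <= r ^ m) by (apply pow_le; lra). nra. }
  eapply Rle_trans; [exact B|]. rewrite Rpow_mult_distr. apply Rmult_le_compat_r.
  apply pow_le; lra.
  clear. induction m. simpl; lra. rewrite S_INR. simpl pow.
  assert (1 <= 2 ^ m) by (apply pow_R1_Rle; lra). lra.
Qed.

Lemma ccont_pow_slope z v m : ccont (fun w => pow_slope z w m) v.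
Proof.
  induction m; simpl. apply ccont_const. apply ccont_plus.
  apply ccont_mult; auto. apply ccont_id. apply ccont_const.
Qed.

(** The slope of the sum is the series of the slopes, and its continuity is
    Weierstrass' test; the factor m gained by differentiating is absorbed by
    enlarging the radius from r to 2r. *)
Lemma cdiff_power_series (c : nat -> R) (m : nat -> nat) :
  (forall n, 0 <= c n) -> (forall r, 0 <= r -> ex_series (fun n => c n * r ^ m n)) ->
  forall z, cdiff (fun z => Cseries (fun n => RtoC (c n) * z ^ m n)%C) z.
Proof.
  intros Hc HS z.
  assert (Dom : forall w, dominated (fun n => RtoC (c n) * w ^ m n)%C (fun n => c n * Cmod w ^ m n)).
  { intros w. split. apply HS, Cmod_ge_0. intros n.
    rewrite Cmod_mult, Cmod_pow, Cmod_R, Rabs_pos_eq; auto; lra. }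
  assert (Slope : forall r w, 1 <= r -> Cmod z <= r -> Cmod w <= r ->
    dominated (fun n => RtoC (c n) * pow_slope z w (m n))%C (fun n => c n * (2 * r) ^ m n)).
  { intros r w Hr Hz Hw. split. apply HS; lra. intros n.
    rewrite Cmod_mult, Cmod_R, Rabs_pos_eq by auto. apply Rmult_le_compat_l; auto.
    apply pow_slope_bound; auto. }
  exists (fun w => Cseries (fun n => RtoC (c n) * pow_slope z w (m n))%C). split.
  - apply Cseries_cont with (fun n => c n * (2 * (Cmod z + 1)) ^ m n) 1.
    + lra.
    + apply HS. generalize (Cmod_ge_0 z); lra.
    + intros n w Hw. apply Slope; generalize (Cmod_ge_0 z); try lra.
      replace w with ((w - z) + z)%C by ring. generalize (Cmod_triangle (w - z) z).
      replace (w - z + z - z)%C with (w - z)%C by ring. intros. lra.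
    + intros n. apply (ccont_mult (fun _ => RtoC (c n))). apply ccont_const. apply ccont_pow_slope.
  - intros w. rewrite <- (Cseries_minus _ _ _ _ (Dom w) (Dom z)).
    set (r := 1 + Cmod z + Cmod w).
    assert (Sl := Slope r w ltac:(unfold r; generalize (Cmod_ge_0 z) (Cmod_ge_0 w); lra)
      ltac:(unfold r; generalize (Cmod_ge_0 z) (Cmod_ge_0 w); lra)
      ltac:(unfold r; generalize (Cmod_ge_0 z) (Cmod_ge_0 w); lra)).
    rewrite <- (Cseries_mult_r _ _ _ Sl). f_equal.
    apply functional_extensionality. intros n.
    rewrite <- Cmult_assoc, <- pow_slope_eq. ring.
Qed.

(** * An entire function of rapid decay *)

Lemma ex_series_eventually_geom (b : nat -> R) N : (forall n, 0 <= b n) ->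
  (forall n, (N <= n)%nat -> b n <= (/ 2) ^ n) -> ex_series b.
Proof.
  intros Hb H. apply (ex_series_incr_n b N).
  apply (ex_series_le (V := R_CompleteNormedModule)) with (fun n => (/ 2) ^ n).
  - intros n. change (Rabs (b (N + n)%nat) <= (/ 2) ^ n). rewrite Rabs_pos_eq by auto.
    eapply Rle_trans. apply H; lia. rewrite pow_add.
    assert ((/ 2) ^ N <= 1).
    { rewrite <- (pow1 N). apply pow_incr; lra. }
    assert (0 <= (/ 2) ^ n) by (apply pow_le; lra).
    rewrite <- (Rmult_1_l ((/ 2) ^ n)) at 2. apply Rmult_le_compat_r; auto.
  - apply ex_series_geom. rewrite Rabs_pos_eq; lra.
Qed.

Lemma Series_zero (a : nat -> R) : (forall n, a n = 0) -> Series a = 0.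
Proof.
  intros H. rewrite (Series_ext a (fun n => 0 * a n)).
  rewrite Series_scal_l; ring. intros n. rewrite H; ring.
Qed.

Lemma Series_nonneg (a : nat -> R) : (forall n, 0 <= a n) -> ex_series a -> 0 <= Series a.
Proof.
  intros Ha Hex. rewrite <- (Series_zero (fun _ => 0)) by auto.
  apply Series_le; auto. split; auto; lra.
Qed.

Lemma Series_ge_term (a : nat -> R) n : (forall m, 0 <= a m) -> ex_series a -> a n <= Series a.
Proof.
  revert a. induction n; intros a Ha Hex; rewrite (Series_incr_1 a Hex);
  assert (Hex' : ex_series (fun m => a (S m))) by (apply (ex_series_incr_1 a); auto).
  - assert (0 <= Series (fun m => a (S m))); [|lra].
    apply Series_nonneg; auto.
  - generalize (IHn (fun m => a (S m)) (fun m => Ha (S m)) Hex') (Ha 0%nat). lra.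
Qed.

Lemma one_plus_pow_close (v : C) m : Cmod ((1 + v) ^ m - 1)%C <= (1 + Cmod v) ^ m - 1.
Proof.
  induction m; simpl.
  - replace (1 - 1)%C with (RtoC 0) by ring. rewrite Cmod_0; lra.
  - replace ((1 + v) * (1 + v) ^ m - 1)%C with ((1 + v) * ((1 + v) ^ m - 1) + v)%C by ring.
    eapply Rle_trans. apply Cmod_triangle. rewrite Cmod_mult.
    assert (H : Cmod (1 + v) <= 1 + Cmod v).
    { eapply Rle_trans. apply Cmod_triangle. rewrite Cmod_1; lra. }
    assert (0 <= Cmod (1 + v)) by apply Cmod_ge_0. assert (0 <= Cmod v) by apply Cmod_ge_0.
    assert (1 <= (1 + Cmod v) ^ m) by (apply pow_R1_Rle; lra).
    assert (Cmod (1 + v) * Cmod ((1 + v) ^ m - 1) <= (1 + Cmod v) * ((1 + Cmod v) ^ m - 1)).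
    { apply Rmult_le_compat; auto. apply Cmod_ge_0. } lra.
Qed.

(** Writing z = x (1 + i y/x), the factor (1 + i y/x)^(2k) differs from 1 by at most
    exp(2k |y/x|) - 1 <= exp(1/4) - 1 < 1/2, and x^(2k) is positive. *)
Lemma Re_even_pow_lower (x y : R) (k : nat) : (0 < k)%nat -> x <> 0 -> 8 * INR k * Rabs y <= Rabs x ->
  / 2 * Rabs x ^ (2 * k) <= Re ((x, y) ^ (2 * k))%C.
Proof.
  intros Hk Hx H.
  set (v := (0, y / x) : C).
  assert (E : ((x, y) : C) = (RtoC x * (1 + v))%C).
  { unfold v. apply injective_projections; simpl; field; auto. }
  assert (Ex : (RtoC x ^ (2 * k))%C = RtoC (Rabs x ^ (2 * k))).
  { rewrite <- RtoC_pow. f_equal. rewrite !pow_mult. f_equal. symmetry; apply pow2_abs. }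
  rewrite E, Cpow_mult_l, Ex, re_scal_l, Rmult_comm.
  apply Rmult_le_compat_l. apply pow_le, Rabs_pos.
  assert (B := one_plus_pow_close v (2 * k)).
  assert (Hv : Cmod v = Rabs y / Rabs x). { unfold v. rewrite Cmod_ver. apply Rabs_div; auto. }
  assert (Hax : 0 < Rabs x) by (apply Rabs_pos_lt; auto).
  assert (Hk' : 0 < INR k) by (apply lt_0_INR; auto).
  assert (Pow : (1 + Cmod v) ^ (2 * k) <= exp (/ 4)).
  { apply Rle_trans with (exp (INR (2 * k) * Cmod v)).
    - generalize (2 * k)%nat. intros m. induction m. simpl. rewrite Rmult_0_l, exp_0; lra.
      rewrite S_INR, Rmult_plus_distr_r, exp_plus, Rmult_1_l, Rmult_comm. simpl. apply Rmult_le_compat; auto.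
      generalize (Cmod_ge_0 v); lra. apply pow_le; generalize (Cmod_ge_0 v); lra.
      apply exp_ineq1_le.
    - apply exp_mono. rewrite mult_INR, Hv. simpl (INR 2).
      replace ((1 + 1) * INR k * (Rabs y / Rabs x)) with ((2 * INR k * Rabs y) / Rabs x) by (field; lra).
      apply Rle_div_l; auto. lra. }
  assert (Q := exp_quadratic (/ 4) ltac:(rewrite Rabs_pos_eq; lra)).
  assert (R1 := re_le_Cmod ((1 + v) ^ (2 * k) - 1)%C).
  change (Re ((1 + v) ^ (2 * k) - 1)%C) with (Re ((1 + v) ^ (2 * k))%C - 1) in R1.
  apply Rabs_le_between in R1. lra.
Qed.

(** Locates the index n whose term controls the weight at r. *)
Lemma dyadic_bracket r N : 2 ^ N <= r -> exists n, (N <= n)%nat /\ 2 ^ n <= r < 2 ^ (n + 1).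
Proof.
  intros H. destruct (Pow_x_infinity 2 ltac:(rewrite Rabs_pos_eq; lra) (r + 1)) as [M HM].
  assert (HM' : r < 2 ^ (N + M)).
  { specialize (HM (N + M)%nat ltac:(lia)). rewrite Rabs_pos_eq in HM by (apply pow_le; lra). lra. }
  clear HM. induction M as [|M IH].
  - rewrite Nat.add_0_r in HM'. lra.
  - destruct (Rlt_dec r (2 ^ (N + M))) as [L|L]; auto.
    exists (N + M)%nat. split. lia. replace (N + M + 1)%nat with (N + S M)%nat by lia. lra.
Qed.

(** The function is exp(-F) with F(z) = sum_n (z / 2^n)^(2 k_n) and k_n from
    lacunary_exponents. *)
Lemma rapidly_decreasing_entire w : weight_function w -> subexponential w ->
  exists (psi : C -> C) (p : R -> R), U_space w psi /\ (forall x : R, psi (RtoC x) = RtoC (p x)) /\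
    forall x, 0 < p x.
Proof.
  intros Hw HS. assert (W := Hw). destruct W as (W1 & W2 & _).
  destruct (lacunary_exponents w Hw HS) as (k & Hk & Hk0 & Hkw).
  assert (P2 : forall n, 0 < 2 ^ n) by (intros; apply pow_lt; lra).
  assert (Hki : forall n, 1 <= INR (k n)).
  { intros n. apply (le_INR 1). specialize (Hk n). lia. }
  set (c := fun n => (/ 2 ^ n) ^ (2 * k n)).
  assert (Hc : forall n, 0 <= c n).
  { intros n. apply pow_le. left. apply Rinv_0_lt_compat; auto. }
  assert (Hcr : forall n r, c n * r ^ (2 * k n) = (r / 2 ^ n) ^ (2 * k n)).
  { intros n r. unfold c, Rdiv. rewrite <- Rpow_mult_distr. f_equal. ring. }
  (* the exponent 2 k_n is at least n *)
  assert (Geo : forall n r, 0 <= r -> r <= 2 ^ n / 2 -> (r / 2 ^ n) ^ (2 * k n) <= (/ 2) ^ n).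
  { intros n r Hr H. assert (Q : 0 <= r / 2 ^ n <= / 2).
    { split. apply Rdiv_le_0_compat; auto. apply Rle_div_l; generalize (P2 n); lra. }
    apply Rle_trans with ((/ 2) ^ (2 * k n)). apply pow_incr; auto.
    replace (2 * k n)%nat with (n + (2 * k n - n))%nat by (specialize (Hk n); lia).
    rewrite pow_add. rewrite <- (Rmult_1_r ((/ 2) ^ n)) at 2.
    apply Rmult_le_compat_l. apply pow_le; lra. rewrite <- (pow1 (2 * k n - n)). apply pow_incr; lra. }
  assert (Hs : forall r, 0 <= r -> ex_series (fun n => c n * r ^ (2 * k n))).
  { intros r Hr.
    destruct (Pow_x_infinity 2 ltac:(rewrite Rabs_pos_eq; lra) (2 * r)) as [N HN].
    apply ex_series_eventually_geom with N.
    - intros n. apply Rmult_le_pos; auto. apply pow_le; auto.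
    - intros n Hn. rewrite Hcr. apply Geo; auto. specialize (HN n Hn).
      rewrite Rabs_pos_eq in HN by (left; auto). lra. }
  set (u := fun z n => (RtoC (c n) * z ^ (2 * k n))%C).
  set (F := fun z => Cseries (u z)).
  assert (DF : forall z, cdiff F z) by (apply (cdiff_power_series c (fun n => 2 * k n)%nat); auto).
  (* for |Re z| >= 8 k_n H the n-th term has positive real part; otherwise
     |z| <= 9 k_n H, so its modulus is at most the n-th term b_n of a convergent
     series that does not depend on z; B is the sum of the b_n *)
  assert (Lower : forall H, 0 < H -> exists B, 0 <= B /\ forall x y, Rabs y <= H ->
    - B <= Re (F (x, y)) /\
    forall n, 8 * INR (k n) * H <= Rabs x -> / 2 * (Rabs x / 2 ^ n) ^ (2 * k n) - B <= Re (F (x, y))).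
  { intros H HH.
    set (b := fun n => (9 * INR (k n) * H / 2 ^ n) ^ (2 * k n)).
    assert (Hb0 : forall n, 0 <= b n).
    { intros n. apply pow_le. apply Rdiv_le_0_compat; auto. generalize (Hki n); nra. }
    assert (Hb : ex_series b).
    { destruct (Hk0 (/ (18 * H))) as [N HN]. { apply Rinv_0_lt_compat; lra. }
      apply ex_series_eventually_geom with N; auto.
      intros n Hn. apply Geo. generalize (Hki n); nra.
      specialize (HN n Hn).
      apply Rle_trans with (9 * (/ (18 * H) * 2 ^ n) * H). 
      apply Rmult_le_compat_r; lra. right. field. lra. }
    exists (Series b). split.
    { apply Series_nonneg; auto. }
    intros x y Hy.
    assert (Large : forall n, 8 * INR (k n) * H <= Rabs x ->
      / 2 * (Rabs x / 2 ^ n) ^ (2 * k n) <= Re (u (x, y) n)).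
    { intros n Hn. unfold u. rewrite re_scal_l, <- Hcr.
      replace (/ 2 * (c n * Rabs x ^ (2 * k n))) with (c n * (/ 2 * Rabs x ^ (2 * k n))) by ring.
      apply Rmult_le_compat_l; auto. apply Re_even_pow_lower.
      - specialize (Hk n). lia.
      - intros ->. rewrite Rabs_R0 in Hn. generalize (Hki n); nra.
      - eapply Rle_trans; [|exact Hn]. apply Rmult_le_compat_l; auto. generalize (Hki n); lra. }
    assert (Ge : forall n, 0 <= Re (u (x, y) n) + b n).
    { intros n. destruct (Rle_dec (8 * INR (k n) * H) (Rabs x)) as [L|L].
      - assert (Q := Large n L).
        assert (0 <= (Rabs x / 2 ^ n) ^ (2 * k n)).
        { apply pow_le, Rdiv_le_0_compat; auto. apply Rabs_pos. }
        specialize (Hb0 n). lra.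
      - assert (Hz : Cmod (x, y) <= 9 * INR (k n) * H).
        { eapply Rle_trans. apply Cmod_le_abs. simpl. generalize (Hki n); nra. }
        assert (Hu : Cmod (u (x, y) n) <= b n).
        { unfold u. rewrite Cmod_mult, Cmod_pow, Cmod_R, Rabs_pos_eq by auto.
          unfold b. rewrite <- Hcr. apply Rmult_le_compat_l; auto.
          apply pow_incr; split; auto. apply Cmod_ge_0. }
        generalize (re_le_Cmod (u (x, y) n)). intros Q.
        assert (Q' := Rle_trans _ _ _ Q Hu). apply Rabs_le_between in Q'. lra. }
    assert (Hre : ex_series (fun n => Re (u (x, y) n))).
    { apply dominated_Re with (fun n => c n * Cmod (x, y) ^ (2 * k n)). split. apply Hs, Cmod_ge_0.
      intros n. unfold u. rewrite Cmod_mult, Cmod_pow, Cmod_R, Rabs_pos_eq by auto. lra. }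
    assert (Hex : ex_series (fun n => Re (u (x, y) n) + b n))
      by (apply (ex_series_plus (V := R_NormedModule)); auto).
    assert (Term : forall n, Re (u (x, y) n) + b n <= Re (F (x, y)) + Series b).
    { intros n. unfold F, Cseries; simpl. rewrite <- Series_plus; auto.
      apply (Series_ge_term (fun n => Re (u (x, y) n) + b n)); auto. }
    split.
    - generalize (Term 0%nat) (Ge 0%nat). lra.
    - intros n Hn. generalize (Term n) (Large n Hn) (Hb0 n). lra. }
  exists (fun z => cexp (- RtoC 1 * F z)), (fun x => exp (- Re (F (RtoC x)))).
  split; [split|split].
  - intros z _. apply ex_derive_cdiff. apply (cdiff_comp cexp (fun z => - RtoC 1 * F z)%C).
    apply (cdiff_mult (fun _ => (- RtoC 1)%C)). apply cdiff_const. auto. apply cdiff_cexp.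
  - intros H lam HH Hlam. apply wnorm_finite; auto.
    destruct (Lower H HH) as (B & HB & HF).
    destruct (Hkw lam Hlam) as [N1 HN1].
    destruct (Hk0 (/ (4 * H))) as [N2 HN2]. { apply Rinv_0_lt_compat; lra. }
    set (N := (N1 + N2)%nat).
    exists (exp (B + w (lam * 2 ^ (N + 1)))). split. apply exp_pos.
    intros [x y] [Hy1 Hy2]. simpl in Hy1, Hy2.
    assert (Hy : Rabs y <= H) by (apply Rabs_le; lra).
    rewrite Cmod_cexp, <- exp_plus. apply exp_mono. simpl Re at 2.
    replace (Re (- RtoC 1 * F (x, y))%C) with (- Re (F (x, y))) by (simpl; ring).
    rewrite Rabs_mult, (Rabs_pos_eq lam) by lra.
    destruct (HF x y Hy) as [F1 F2].
    assert (0 <= w (lam * 2 ^ (N + 1))) by (apply W1, Rmult_le_pos; [lra|left; auto]).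
    destruct (Rlt_dec (Rabs x) (2 ^ (N + 1))) as [L|L].
    + assert (w (lam * Rabs x) <= w (lam * 2 ^ (N + 1))); [|lra].
      apply W2. apply Rmult_le_pos; [lra|apply Rabs_pos]. apply Rmult_le_compat_l; lra.
    (* the term with 2^(n+1) <= |x| < 2^(n+2) has modulus at least 4^(k_n), which is
       at least twice the weight by the choice of k_n *)
    + destruct (dyadic_bracket (Rabs x) (N + 1) ltac:(lra)) as [n1 [Hn1 Hx]].
      destruct n1 as [|n]; [lia|].
      assert (Hx1 : 2 * 2 ^ n <= Rabs x) by apply Hx.
      assert (Hx2 : Rabs x < 2 ^ (n + 2)). { replace (n + 2)%nat with (S n + 1)%nat by lia. apply Hx. }
      assert (K1 := HN1 n ltac:(unfold N in *; lia)). assert (K2 := HN2 n ltac:(unfold N in *; lia)).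
      assert (K3 : 8 * INR (k n) * H <= Rabs x).
      { apply Rle_trans with (8 * (/ (4 * H) * 2 ^ n) * H).
        apply Rmult_le_compat_r; lra. replace (8 * (/ (4 * H) * 2 ^ n) * H) with (2 * 2 ^ n) by (field; lra). lra. }
      specialize (F2 n K3).
      assert (K4 : 4 ^ k n <= (Rabs x / 2 ^ n) ^ (2 * k n)).
      { rewrite pow_mult. apply pow_incr. split; [lra|].
        assert (Q : 2 <= Rabs x / 2 ^ n) by (apply Rle_div_r; generalize (P2 n); lra). simpl. nra. }
      assert (w (lam * Rabs x) <= w (lam * 2 ^ (n + 2))).
      { apply W2. apply Rmult_le_pos; [lra|apply Rabs_pos]. apply Rmult_le_compat_l; lra. }
      lra.
  - intros x. unfold cexp.
    assert (I0 : Im (F (RtoC x)) = 0).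
    { unfold F, Cseries; simpl. apply Series_zero. intros n. change (Im (RtoC (c n) * RtoC x ^ (2 * k n))%C = 0).
      rewrite <- RtoC_pow, <- RtoC_mult. reflexivity. }
    replace (Im (- RtoC 1 * F (RtoC x))%C) with (- Im (F (RtoC x))) by (simpl; ring).
    replace (Re (- RtoC 1 * F (RtoC x))%C) with (- Re (F (RtoC x))) by (simpl; ring).
    rewrite I0, Ropp_0, cos_0, sin_0. apply injective_projections; simpl; ring.
  - intros x. apply exp_pos.
Qed.

(** * Rapid decay on strips *)

Definition rapid (w : R -> R) (h : R) (f : C -> C) := forall lam, 0 < lam ->
  exists M, 0 < M /\ forall z, strip h z -> Cmod (f z) * exp (w (lam * Rabs (Re z))) <= M.

Lemma wnorm_rapid w h f : 0 < h ->
  (forall lam, 0 < lam -> Rbar_lt (wnorm w h lam f) p_infty) <-> rapid w h f.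
Proof.
  intros Hh. split; intros H lam Hl; specialize (H lam Hl).
  - apply wnorm_finite in H; auto. destruct H as [M [HM H]]. exists M; split; auto.
    intros z Hz. specialize (H z Hz). rewrite Rabs_mult, (Rabs_pos_eq lam) in H; lra.
  - apply wnorm_finite; auto. destruct H as [M [HM H]]. exists M; split; auto.
    intros z Hz. specialize (H z Hz). rewrite Rabs_mult, (Rabs_pos_eq lam); lra.
Qed.

Lemma U_space_iff w f : U_space w f <-> (forall z, cdiff f z) /\ forall h, 0 < h -> rapid w h f.
Proof.
  split; intros [H1 H2]; split.
  - intros z. apply ex_derive_cdiff, H1. exact I.
  - intros h Hh. apply wnorm_rapid; auto.
  - intros z _. apply ex_derive_cdiff, H1.
  - intros h lam Hh. apply wnorm_rapid; auto.
Qed.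

Lemma weight_mono w s t : weight_function w -> 0 <= s -> s <= t -> exp (w s) <= exp (w t).
Proof. intros (_ & W & _) H1 H2. apply exp_mono, W; auto. Qed.

Lemma weight_exp_ge1 w t : weight_function w -> 0 <= t -> 1 <= exp (w t).
Proof. intros (W & _ & _) H1. rewrite <- exp_0. apply exp_mono, W; auto. Qed.

(** One of |x - t| and |t| is at least |x| / 2.  This is what makes convolution
    compatible with the weights, at the price of doubling lam. *)
Lemma weight_split w lam x t : weight_function w -> 0 <= lam ->
  exp (w (lam * Rabs x)) <= exp (w (2 * lam * Rabs (x - t))) + exp (w (2 * lam * Rabs t)).
Proof.
  intros W Hl. assert (T := Rabs_triang (x - t) t). replace (x - t + t) with x in T by ring.
  assert (P1 := exp_pos (w (2 * lam * Rabs (x - t)))). assert (P2 := exp_pos (w (2 * lam * Rabs t))).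
  assert (Q1 := Rabs_pos x).
  destruct (Rle_dec (Rabs t) (Rabs (x - t))) as [L|L].
  - assert (exp (w (lam * Rabs x)) <= exp (w (2 * lam * Rabs (x - t)))); [|lra].
    apply weight_mono; auto. apply Rmult_le_pos; auto. nra.
  - assert (exp (w (lam * Rabs x)) <= exp (w (2 * lam * Rabs t))); [|lra].
    apply weight_mono; auto. apply Rmult_le_pos; auto. nra.
Qed.

Lemma weight_log w m : weight_function w -> exists T, 1 <= T /\ forall t, T <= t -> m * ln t <= w t.
Proof.
  intros (_ & _ & W). apply is_lim_spec in W. destruct (W m) as [T HT].
  exists (Rmax 2 (T + 1)). split. apply Rle_trans with 2; [lra|apply Rmax_l].
  intros t Ht. assert (H1 := Rmax_l 2 (T + 1)). assert (H2 := Rmax_r 2 (T + 1)).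
  assert (Hln : 0 < ln t). { rewrite <- ln_1. apply ln_increasing; lra. }
  specialize (HT t ltac:(lra)). apply Rlt_le. apply Rlt_div_r in HT; auto.
Qed.

Lemma weight_infinity w lam B : weight_function w -> 0 < lam ->
  exists X, 0 < X /\ forall x, X <= Rabs x -> B <= w (lam * Rabs x).
Proof.
  intros W Hl. destruct (weight_log w 1 W) as [T [HT H]].
  exists (Rmax T (exp B) / lam). assert (H1 := Rmax_l T (exp B)). assert (H2 := Rmax_r T (exp B)). split.
  apply Rdiv_lt_0_compat; lra. intros x Hx.
  apply Rle_div_l in Hx; auto. rewrite Rmult_comm in Hx.
  eapply Rle_trans; [|apply H; lra]. rewrite Rmult_1_l, <- (ln_exp B). apply ln_le. apply exp_pos. lra.
Qed.

(** Condition delta rewritten: enlarging lam gains a full factor exp(-w(lam x)). *)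
Lemma delta_gap w lam : weight_function w -> delta w -> 0 < lam ->
  exists lam' A, 0 < lam' /\ 0 < A /\ forall x,
    exp (w (lam * Rabs x)) <= A * exp (- w (lam * Rabs x)) * exp (w (lam' * Rabs x)).
Proof.
  intros W (A & H & HA & HH & HD) Hl. exists (H * lam), A. split; [nra|]. split; [lra|].
  intros x. specialize (HD (lam * Rabs x) ltac:(apply Rmult_le_pos; [lra|apply Rabs_pos])).
  rewrite <- Rmult_assoc in HD. rewrite <- (exp_ln A) at 1 by lra.
  rewrite <- !exp_plus. apply exp_mono. lra.
Qed.

(** Boundedness of the weighted modulus for all lam improves to convergence to
    zero, by the gain in delta_gap. *)
Lemma rapid_vanish w k f lam : weight_function w -> delta w -> rapid w k f -> 0 < lam ->
  forall eta, 0 < eta -> exists X, 0 < X /\ forall z, strip k z -> X <= Rabs (Re z) ->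
    Cmod (f z) * exp (w (lam * Rabs (Re z))) <= eta.
Proof.
  intros W D F Hl eta He. destruct (delta_gap w lam W D Hl) as (lam' & A & Hl' & HA & G).
  destruct (F lam' Hl') as [M [HM HF]].
  destruct (weight_infinity w lam (ln (M * A / eta)) W Hl) as [X [HX HB]].
  exists X; split; auto. intros z Hz Hx.
  apply Rle_trans with (Cmod (f z) * (A * exp (- w (lam * Rabs (Re z))) * exp (w (lam' * Rabs (Re z))))).
  { apply Rmult_le_compat_l; auto. apply Cmod_ge_0. }
  specialize (HF z Hz). specialize (HB _ Hx).
  assert (Q : 0 < M * A / eta). { apply Rdiv_lt_0_compat; auto. nra. }
  apply exp_mono in HB. rewrite exp_ln in HB by auto.
  rewrite exp_Ropp. set (E := exp (w (lam * Rabs (Re z)))) in *.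
  assert (HE : 0 < E) by apply exp_pos.
  replace (Cmod (f z) * (A * / E * exp (w (lam' * Rabs (Re z))))) with
    (A / E * (Cmod (f z) * exp (w (lam' * Rabs (Re z))))) by (field; lra).
  apply Rle_trans with (A / E * M).
  apply Rmult_le_compat_l; auto. left; apply Rdiv_lt_0_compat; auto.
  replace (A / E * M) with ((M * A) / E) by (field; lra). apply Rle_div_l; auto.
  apply Rle_div_l in HB; auto. lra.
Qed.

(** * Closure properties of the space of entire functions *)

Lemma U_zero w : U_space w (fun _ => RtoC 0).
Proof.
  apply U_space_iff. split. intros; apply cdiff_const.
  intros h Hh lam Hl. exists 1; split; [lra|]. intros z _. rewrite Cmod_0; lra.
Qed.

Lemma U_plus w f g : U_space w f -> U_space w g -> U_space w (fun z => f z + g z)%C.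
Proof.
  rewrite !U_space_iff. intros [F1 F2] [G1 G2]. split. intros; apply cdiff_plus; auto.
  intros h Hh lam Hl. destruct (F2 h Hh lam Hl) as [M [HM F]]. destruct (G2 h Hh lam Hl) as [N [HN G]].
  exists (M + N). split; [lra|]. intros z Hz. specialize (F z Hz). specialize (G z Hz).
  assert (K := Cmod_triangle (f z) (g z)).
  apply Rmult_le_compat_r with (r := exp (w (lam * Rabs (Re z)))) in K. lra. left; apply exp_pos.
Qed.

Lemma U_scal w c f : U_space w f -> U_space w (fun z => c * f z)%C.
Proof.
  rewrite !U_space_iff. intros [F1 F2]. split.
  intros. apply (cdiff_mult (fun _ => c)); auto. apply cdiff_const.
  intros h Hh lam Hl. destruct (F2 h Hh lam Hl) as [M [HM F]].
  exists (Cmod c * M + 1). split. generalize (Cmod_ge_0 c); nra. intros z Hz. specialize (F z Hz).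
  rewrite Cmod_mult, Rmult_assoc. apply Rmult_le_compat_l with (r := Cmod c) in F. lra. apply Cmod_ge_0.
Qed.

Lemma U_dilate w (n : R) f : 0 < n -> U_space w f -> U_space w (fun z => f (RtoC n * z)%C).
Proof.
  intros Hn. rewrite !U_space_iff. intros [F1 F2]. split.
  intros. apply (cdiff_comp f). apply (cdiff_mult (fun _ => RtoC n)). apply cdiff_const. apply cdiff_id. auto.
  intros h Hh lam Hl.
  destruct (F2 (n * h) ltac:(nra) (lam / n) ltac:(apply Rdiv_lt_0_compat; auto)) as [M [HM F]].
  exists M; split; auto. intros z [Hz1 Hz2].
  specialize (F (RtoC n * z)%C). rewrite re_scal_l in F.
  rewrite Rabs_mult, (Rabs_pos_eq n) in F by lra.
  replace (lam / n * (n * Rabs (Re z))) with (lam * Rabs (Re z)) in F by (field; lra).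
  apply F. unfold strip. rewrite im_scal_l. split; nra.
Qed.

Lemma U_translate w (t : R) f : weight_function w -> U_space w f -> U_space w (fun z => f (z - RtoC t)%C).
Proof.
  intros W. rewrite !U_space_iff. intros [F1 F2]. split.
  intros. apply (cdiff_comp f). apply (cdiff_minus (fun z => z)). apply cdiff_id. apply cdiff_const. auto.
  intros h Hh lam Hl. destruct (F2 h Hh (2 * lam) ltac:(lra)) as [M [HM F]].
  exists (M + M * exp (w (2 * lam * Rabs t))). split. { generalize (exp_pos (w (2 * lam * Rabs t))); nra. }
  intros z [Hz1 Hz2].
  assert (Im (z - RtoC t)%C = Im z) by (change (Im z + - 0 = Im z); ring).
  assert (E : Re (z - RtoC t)%C = Re z - t) by reflexivity.
  specialize (F (z - RtoC t)%C ltac:(split; lra)). rewrite E in F.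
  assert (S := weight_split w lam (Re z) t W ltac:(lra)).
  assert (G := weight_exp_ge1 w (2 * lam * Rabs (Re z - t)) W ltac:(apply Rmult_le_pos; [lra|apply Rabs_pos])).
  assert (N := Cmod_ge_0 (f (z - RtoC t)%C)).
  apply Rmult_le_compat_l with (r := Cmod (f (z - RtoC t)%C)) in S; auto.
  eapply Rle_trans; [exact S|]. rewrite Rmult_plus_distr_l. apply Rplus_le_compat; auto.
  apply Rmult_le_compat_r. left; apply exp_pos. nra.
Qed.

Fixpoint csum (u : nat -> C) (n : nat) : C :=
  match n with O => RtoC 0 | S n => (csum u n + u n)%C end.

Lemma U_csum w (u : nat -> C -> C) n : (forall j, U_space w (u j)) ->
  U_space w (fun z => csum (fun j => u j z) n).
Proof.
  intros H. induction n; simpl. apply U_zero. apply U_plus; auto.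
Qed.

(** * Approximate identities *)

Lemma RInt_dilate (p : R -> R) n a b : (forall s, continuous p s) -> 
  RInt (fun s => n * p (n * s)) a b = RInt p (n * a) (n * b).
Proof.
  intros Hp.
  assert (E := RInt_comp_lin (V := R_CompleteNormedModule) p n 0 a b).
  rewrite !Rplus_0_r in E. rewrite <- E.
  - apply (RInt_ext (V := R_CompleteNormedModule)). intros s _. rewrite Rplus_0_r. reflexivity.
  - apply (ex_RInt_continuous (V := R_CompleteNormedModule)). auto.
Qed.

Lemma continuous_ex_RInt (p : R -> R) a b : (forall s, continuous p s) -> ex_RInt p a b.
Proof. intros H. apply (ex_RInt_continuous (V := R_CompleteNormedModule)). auto. Qed.

Lemma RInt_mono_interval (p : R -> R) a b c d : (forall s, continuous p s) -> (forall s, 0 <= p s) ->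
  a <= b -> b <= c -> c <= d -> RInt p b c <= RInt p a d.
Proof.
  intros Hc Hp H1 H2 H3.
  assert (Ex := fun a b => continuous_ex_RInt p a b Hc).
  assert (E1 := RInt_Chasles (V := R_CompleteNormedModule) p a b d (Ex _ _) (Ex _ _)).
  assert (E2 := RInt_Chasles (V := R_CompleteNormedModule) p b c d (Ex _ _) (Ex _ _)).
  rewrite <- E1, <- E2. unfold plus; simpl.
  generalize (RInt_ge_0 p a b H1 (Ex _ _) (fun s _ => Hp s)) (RInt_ge_0 p c d H3 (Ex _ _) (fun s _ => Hp s)). lra.
Qed.

Lemma inv_one_plus_sqr_RInt c a b : is_RInt (fun t => c / (1 + (t * t))) a b (c * (atan b - atan a)).
Proof.
  replace (c * (atan b - atan a)) with (minus (c * atan b) (c * atan a)) by (unfold minus, plus, opp; simpl; ring).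
  assert (P : forall t, 0 < 1 + t * t) by (intros; nra).
  apply (is_RInt_derive (V := R_CompleteNormedModule) (fun t => c * atan t)).
  - intros t _. auto_derive; auto. field. specialize (P t); lra.
  - intros t _. apply (ex_derive_continuous (V := R_NormedModule)). auto_derive. specialize (P t); lra.
Qed.

Lemma atan_diff a b : a <= b -> 0 <= atan b - atan a <= 4.
Proof.
  intros H. split.
  - destruct H as [H|<-]; [|lra]. generalize (atan_increasing a b H). lra.
  - generalize (atan_bound a) (atan_bound b) PI_4. lra.
Qed.

(** Besides the usual requirements on an approximate identity, the tail is small
    after multiplication by the weight and integrable, so that convolution can be
    estimated in the weighted norms. *)
Definition mollifier (w : R -> R) lam rho eta (kappa : C -> C) (p : R -> R) :=
  U_space w kappa /\ (forall s : R, kappa (RtoC s) = RtoC (p s)) /\ (forall s, 0 <= p s) /\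
  (forall s, continuous p s) /\ (forall a b, a <= b -> RInt p a b <= 1) /\
  (forall a b, a <= - rho -> rho <= b -> 1 - eta <= RInt p a b) /\
  (forall s, rho <= Rabs s -> p s * exp (w (lam * Rabs s)) <= eta / (1 + s * s)).

Lemma real_trace_continuous kappa (p : R -> R) : (forall z, ccont kappa z) ->
  (forall s : R, kappa (RtoC s) = RtoC (p s)) -> forall s, continuous p s.
Proof.
  intros K E s. destruct (pcont_Re_Im (fun s => kappa (s, 0)) s (ccont_hor _ _ _ (K (s, 0)))) as [H _].
  apply (continuous_ext _ p) in H; auto. intros t. change (t, 0) with (RtoC t). rewrite E. reflexivity.
Qed.

(** For large arguments w(t) >= 4 ln t because w grows faster than the logarithm. *)
Lemma inverse_weight_bound w lam : weight_function w -> 0 < lam -> exists K, 0 < K /\ forall u,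
  exp (- w (lam * Rabs u)) <= K / ((1 + u * u) * (1 + u * u)).
Proof.
  intros W Hl. destruct (weight_log w 4 W) as [T [HT HW]].
  set (X := T / lam + 1).
  assert (HX : 1 < X). { unfold X. assert (0 < T / lam) by (apply Rdiv_lt_0_compat; lra). lra. }
  set (l4 := lam * lam * (lam * lam)). assert (Hl4 : 0 < l4) by (unfold l4; repeat apply Rmult_lt_0_compat; auto).
  exists (4 / l4 + (1 + X * X) * (1 + X * X)).
  assert (P4 : 0 < 4 / l4) by (apply Rdiv_lt_0_compat; lra).
  split. nra. intros u. assert (Pu : 0 < (1 + u * u) * (1 + u * u)) by nra.
  apply Rle_div_r; auto.
  assert (Hu2 : u * u = Rabs u * Rabs u) by (rewrite <- Rabs_mult, Rabs_pos_eq; nra).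
  rewrite Hu2 in *. set (v := Rabs u) in *. assert (Hv : 0 <= v) by apply Rabs_pos.
  destruct (Rle_dec X v) as [L|L].
  - assert (HTv : T <= lam * v).
    { apply Rle_trans with (lam * X). unfold X. replace (lam * (T / lam + 1)) with (T + lam) by (field; lra). lra.
      apply Rmult_le_compat_l; lra. }
    specialize (HW _ HTv).
    assert (E : exp (- w (lam * v)) <= / (l4 * (v * v * (v * v)))).
    { rewrite exp_Ropp. apply Rinv_le_contravar. apply Rmult_lt_0_compat; auto. assert (0 < v * v) by nra. nra.
      replace (l4 * (v * v * (v * v))) with ((lam * v) ^ 4) by (unfold l4; ring).
      rewrite <- (exp_ln ((lam * v) ^ 4)) by (apply pow_lt; nra). apply exp_mono.
      rewrite ln_pow by nra. simpl INR. replace (1 + 1 + 1 + 1) with 4 by ring. exact HW. }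
    assert (V1 : 1 <= v * v) by nra.
    assert ((1 + v * v) * (1 + v * v) <= 4 * (v * v * (v * v))) by nra.
    apply Rle_trans with (/ (l4 * (v * v * (v * v))) * (4 * (v * v * (v * v)))).
    + apply Rmult_le_compat; auto. left; apply exp_pos. lra.
    + apply Rle_trans with (4 / l4). right. field. split; nra. nra.
  - assert (E : exp (- w (lam * v)) <= 1).
    { rewrite exp_Ropp, <- Rinv_1. apply Rinv_le_contravar; [lra|]. apply weight_exp_ge1; auto. nra. }
    assert (V : v * v <= X * X) by nra.
    apply Rle_trans with (1 * ((1 + v * v) * (1 + v * v))). apply Rmult_le_compat_r; lra.
    assert ((1 + v * v) * (1 + v * v) <= (1 + X * X) * (1 + X * X)) by (apply Rmult_le_compat; nra). lra.
Qed.

(** Dilations (n / J) psi(n z) of the function of rapidly_decreasing_entire, where J is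
    its total mass on the real line.  For |s| >= rho the decay
    p(u) exp(w(lam u)) <= K / (1 + u^2)^2 leaves a factor 1/n after dilation. *)
Lemma mollifier_exists w lam rho eta : weight_function w -> delta w -> subexponential w ->
  0 < lam -> 0 < rho -> 0 < eta -> exists kappa p, mollifier w lam rho eta kappa p.
Proof.
  intros W D HS Hl Hr He.
  destruct (rapidly_decreasing_entire w W HS) as (psi & p & U & E & Pp).
  assert (U' := U). apply U_space_iff in U'. destruct U' as [Ud Ur].
  assert (Cp : forall s, continuous p s).
  { apply (real_trace_continuous psi); auto. intros; apply cdiff_ccont; auto. }
  assert (Hex := fun a b => continuous_ex_RInt p a b Cp).
  assert (Dec : exists K, 0 < K /\ forall u, p u * exp (w (lam * Rabs u)) <= K / ((1 + u * u) * (1 + u * u))).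
  { destruct (delta_gap w lam W D Hl) as (lam' & A & Hl' & HA & G).
    destruct (Ur 1 Rlt_0_1 lam' Hl') as [M [HM HB]].
    destruct (inverse_weight_bound w lam W Hl) as (K & HK & B).
    exists (A * M * K). split. repeat apply Rmult_lt_0_compat; auto. intros u.
    specialize (HB (RtoC u) ltac:(split; simpl; lra)). rewrite E, Cmod_R, Rabs_pos_eq in HB by (left; auto).
    simpl Re in HB.
    apply Rle_trans with (p u * (A * exp (- w (lam * Rabs u)) * exp (w (lam' * Rabs u)))).
    apply Rmult_le_compat_l; auto. left; auto.
    replace (p u * (A * exp (- w (lam * Rabs u)) * exp (w (lam' * Rabs u)))) with
      (A * (p u * exp (w (lam' * Rabs u))) * exp (- w (lam * Rabs u))) by ring.
    unfold Rdiv. rewrite Rmult_assoc. unfold Rdiv in B. rewrite (Rmult_assoc (A * M)).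
    rewrite <- (Rmult_assoc A). apply Rmult_le_compat; auto.
    - apply Rmult_le_pos; [lra|]. apply Rmult_le_pos; left; auto. apply exp_pos.
    - left; apply exp_pos.
    - apply Rmult_le_compat_l; lra. }
  destruct Dec as (K & HK & Dec).
  assert (Dec2 : forall u, p u <= K / (1 + u * u)).
  { intros u. apply Rle_trans with (p u * exp (w (lam * Rabs u))).
    - rewrite <- (Rmult_1_r (p u)) at 1. apply Rmult_le_compat_l. left; auto.
      apply weight_exp_ge1; auto. apply Rmult_le_pos; [lra|apply Rabs_pos].
    - eapply Rle_trans; [apply Dec|]. apply Rmult_le_compat_l. lra.
      apply Rinv_le_contravar; nra. }
  destruct (completeness (fun r => exists a b, a <= b /\ r = RInt p a b)) as [J [J1 J2]].
  { exists (K * 4). intros r (a & b & Hab & ->).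
    apply Rle_trans with (K * (atan b - atan a)).
    - rewrite <- (is_RInt_unique _ _ _ _ (inv_one_plus_sqr_RInt K a b)).
      apply RInt_le; auto. eexists; apply inv_one_plus_sqr_RInt.
    - apply Rmult_le_compat_l; [lra|]. apply atan_diff; auto. }
  { exists (RInt p 0 0), 0, 0. split; auto; lra. }
  assert (HJ : 0 < J).
  { apply Rlt_le_trans with (RInt p 0 1).
    apply RInt_gt_0; auto; lra. apply J1. exists 0, 1. split; auto; lra. }
  assert (Hab : exists a b, a <= b /\ (1 - eta) * J < RInt p a b).
  { apply NNPP. intros N. assert (J <= (1 - eta) * J); [|nra].
    apply J2. intros r (a & b & Hab & ->). apply Rnot_lt_le. intros L. apply N. eauto. }
  destruct Hab as (a0 & b0 & Hab0 & HabJ).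
  (* the second summand makes [-n rho, n rho] contain an interval [a0, b0] carrying
     the fraction 1 - eta of the mass, the third makes the tail small *)
  set (n := 1 + (Rabs a0 + Rabs b0) / rho + K / (J * rho * rho * eta)).
  assert (Hden : 0 < J * rho * rho * eta) by (repeat apply Rmult_lt_0_compat; auto).
  assert (N1 : 0 <= (Rabs a0 + Rabs b0) / rho).
  { apply Rdiv_le_0_compat; auto. generalize (Rabs_pos a0) (Rabs_pos b0); lra. }
  assert (N2 : 0 < K / (J * rho * rho * eta)) by (apply Rdiv_lt_0_compat; auto).
  assert (Hn : 1 <= n) by (unfold n; lra).
  assert (Hn1 : Rabs a0 + Rabs b0 <= n * rho).
  { apply Rle_div_l; auto. unfold n; lra. }
  assert (Hn2 : K <= n * (J * rho * rho * eta)).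
  { apply Rle_div_l; auto. unfold n; lra. }
  pose (q := fun s => n / J * p (n * s)).
  assert (Hq : forall s, 0 <= q s).
  { intros s. apply Rmult_le_pos; [|left; auto]. apply Rdiv_le_0_compat; lra. }
  assert (Eq : forall s : R, (RtoC (n / J) * psi (RtoC n * RtoC s))%C = RtoC (q s)).
  { intros s. unfold q. rewrite <- RtoC_mult, E, <- RtoC_mult. reflexivity. }
  assert (Uk : U_space w (fun z => RtoC (n / J) * psi (RtoC n * z))%C).
  { apply U_scal. apply (U_dilate w n psi); auto. lra. }
  assert (Iq : forall a b, RInt q a b = RInt p (n * a) (n * b) / J).
  { intros a b. unfold Rdiv. rewrite Rmult_comm, <- RInt_dilate by auto.
    assert (Ec : ex_RInt (fun s => n * p (n * s)) a b).
    { apply continuous_ex_RInt. intros s. apply (continuous_scal_r (V := R_NormedModule) n (fun s => p (n * s))).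
      apply (continuous_comp (fun s => n * s) p); auto.
      apply (continuous_scal_r (V := R_NormedModule) n (fun s => s)). apply continuous_id. }
    transitivity (RInt (fun s => scal (/ J) (n * p (n * s))) a b).
    - apply (RInt_ext (V := R_CompleteNormedModule)). intros s _. unfold q, scal; simpl; unfold mult; simpl.
      match goal with |- @eq _ ?x ?y => change (@eq R x y) end. field. lra.
    - exact (RInt_scal (V := R_CompleteNormedModule) _ a b (/ J) Ec). }
  exists (fun z => RtoC (n / J) * psi (RtoC n * z))%C, q.
  split; [exact Uk|]. split; [exact Eq|]. split; [exact Hq|]. split; [|split; [|split]].
  - apply (real_trace_continuous (fun z => RtoC (n / J) * psi (RtoC n * z))%C); auto.
    apply U_space_iff in Uk. intros z. apply cdiff_ccont, Uk.
  - intros a b Hab. rewrite Iq. apply Rle_div_l; auto. rewrite Rmult_1_l. apply J1.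
    exists (n * a), (n * b). split; auto. apply Rmult_le_compat_l; lra.
  - intros a b Ha Hb. rewrite Iq. apply Rle_div_r; auto.
    apply Rle_trans with (RInt p a0 b0); [lra|].
    generalize (Rle_abs a0) (Rle_abs (- a0)) (Rle_abs b0) (Rabs_pos b0) (Rabs_pos a0). rewrite Rabs_Ropp. intros.
    apply RInt_mono_interval; auto; try nra. left; auto.
  - intros s Hs. unfold q.
    assert (G : exp (w (lam * Rabs s)) <= exp (w (lam * Rabs (n * s)))).
    { apply weight_mono; auto. apply Rmult_le_pos; [lra|apply Rabs_pos].
      rewrite Rabs_mult, (Rabs_pos_eq n) by lra. apply Rmult_le_compat_l; [lra|].
      generalize (Rabs_pos s). nra. }
    assert (Hs2 : rho * rho <= s * s).
    { replace (s * s) with (Rabs s * Rabs s). nra. rewrite <- Rabs_mult, Rabs_pos_eq; nra. }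
    assert (Hns : n * s * (n * s) = n * n * (s * s)) by ring.
    assert (Dn := Dec (n * s)). rewrite Hns in Dn.
    apply Rle_trans with (n / J * (K / ((1 + n * n * (s * s)) * (1 + n * n * (s * s))))).
    + rewrite Rmult_assoc. apply Rmult_le_compat_l. apply Rdiv_le_0_compat; lra.
      eapply Rle_trans; [|exact Dn]. apply Rmult_le_compat_l; auto. left; auto.
    + assert (Zn : 1 <= n * n) by nra. assert (Zs : 0 <= s * s) by nra.
      assert (Z1 : n * n * (rho * rho) <= n * n * (s * s)) by (apply Rmult_le_compat_l; lra).
      assert (Z2 : 1 * (s * s) <= n * n * (s * s)) by (apply Rmult_le_compat_r; lra).
      assert (Z0 : 0 < n * n * (rho * rho)) by (repeat apply Rmult_lt_0_compat; lra).
      apply Rle_trans with (n / J * (K / (n * n * (rho * rho) * (1 + s * s)))).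
      * apply Rmult_le_compat_l. apply Rdiv_le_0_compat; lra. apply Rmult_le_compat_l; [lra|].
        apply Rinv_le_contravar. apply Rmult_lt_0_compat; lra. apply Rmult_le_compat; lra.
      * apply (Rmult_le_reg_r (1 + s * s)); [lra|].
        replace (eta / (1 + s * s) * (1 + s * s)) with eta by (field; lra).
        replace (n / J * (K / (n * n * (rho * rho) * (1 + s * s))) * (1 + s * s)) with
          (K / (n * (J * rho * rho))) by (field; repeat split; lra).
        apply Rle_div_l. repeat apply Rmult_lt_0_compat; lra. nra.
Qed.

(** * Mollification *)

Lemma riemann_sum_error (F : R -> C) a del n eta : 0 <= del ->
  (forall t, a <= t <= a + INR n * del -> pcont F t) ->
  (forall s t, a <= s <= a + INR n * del -> a <= t <= a + INR n * del -> Rabs (t - s) <= del ->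
     Cmod (F t - F s) <= eta) ->
  Cmod (cint F a (a + INR n * del) - csum (fun j => RtoC del * F (a + INR j * del)%R) n)%C <= INR n * del * eta.
Proof.
  intros Hd. induction n as [|n IH]; intros HC HF.
  - simpl. rewrite Rmult_0_l, Rplus_0_r. assert (P : cint F a a = 0) by exact (RInt_point (V := C_R_CompleteNormedModule) a F).
    rewrite P. replace (0 - 0)%C with (RtoC 0) by ring. rewrite Cmod_0; lra.
  - rewrite S_INR in *. set (b := a + INR n * del) in *.
    assert (Eb : a + (INR n + 1) * del = b + del) by (unfold b; ring). rewrite Eb in *.
    assert (Hn : 0 <= INR n * del) by (apply Rmult_le_pos; auto; apply pos_INR).
    assert (Hb : a <= b) by (unfold b; lra).
    rewrite (cint_Chasles F a b); try (apply pcont_cintable; try lra; intros; apply HC; lra).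
    simpl csum. fold b.
    specialize (IH ltac:(intros; apply HC; lra) ltac:(intros; apply HF; lra)).
    assert (L : Cmod (cint F b (b + del) - RtoC del * F b)%C <= del * eta).
    { replace (RtoC del * F b)%C with (cint (fun _ => F b) b (b + del)).
      2: { rewrite cint_const. f_equal. f_equal. ring. }
      assert (I1 : cintable F b (b + del)) by (apply pcont_cintable; try lra; intros; apply HC; lra).
      assert (I2 : cintable (fun _ => F b) b (b + del)).
      { apply pcont_cintable; try lra. intros t _ e He. exists 1; split; [lra|]. intros.
        replace (F b - F b)%C with (RtoC 0) by ring. rewrite Cmod_0; lra. }
      rewrite <- (cint_minus F (fun _ => F b)) by auto.
      replace (del * eta) with ((b + del - b) * eta) by ring.
      apply cint_bound_const; try lra. apply cintable_minus; auto.
      intros x Hx. apply HF; try lra. rewrite Rabs_pos_eq; lra. }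
    replace (cint F a b + cint F b (b + del) - (csum (fun j => RtoC del * F (a + INR j * del)%R) n + RtoC del * F b))%C
      with ((cint F a b - csum (fun j => RtoC del * F (a + INR j * del)%R) n) + (cint F b (b + del) - RtoC del * F b))%C by ring.
    eapply Rle_trans. apply Cmod_triangle. lra.
Qed.

(** By Goursat the two horizontal integrals differ by the integrals over the
    vertical sides. *)
Lemma contour_shift (F : C -> C) R0 y B : 0 <= R0 ->
  (forall t s, - R0 <= t <= R0 -> Rabs s <= Rabs y -> cdiff F (t, s)) ->
  (forall s, Rabs s <= Rabs y -> Cmod (F (R0, s)) <= B /\ Cmod (F ((- R0)%R, s)) <= B) ->
  Cmod (cint (fun t => F (t, 0)) (- R0) R0 - cint (fun t => F (t, y)) (- R0) R0)%C <= 2 * Rabs y * B.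
Proof.
  intros HR D HB.
  assert (Main : forall c d, c <= d -> (forall s, c <= s <= d -> Rabs s <= Rabs y) -> d - c = Rabs y ->
    Cmod (cint (fun t => F (t, c)) (- R0) R0 - cint (fun t => F (t, d)) (- R0) R0)%C <= 2 * Rabs y * B).
  { intros c d Hcd Hs Hl.
    assert (HD : on_rect (cdiff F) (- R0) R0 c d) by (intros u v Hu Hv; apply D; auto).
    assert (G := goursat F (- R0) R0 c d ltac:(lra) Hcd HD).
    assert (HCr : on_rect (ccont F) (- R0) R0 c d) by (intros u v Hu Hv; apply cdiff_ccont, HD; auto).
    rewrite rect_int_sides in G; auto; try lra. 2: apply on_rect_boundary; auto; lra.
    assert (I : forall x, x = R0 \/ x = - R0 -> Cmod (cint (fun s => F (x, s)) c d) <= (d - c) * B).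
    { intros x Hx. apply cint_bound_const; auto. apply (cintable_ver F); auto.
      intros s Hs'. apply HCr; auto. destruct Hx; subst; lra.
      intros s Hs'. specialize (HB s (Hs s Hs')). destruct Hx; subst; apply HB. }
    replace (cint (fun t => F (t, c)) (- R0) R0 - cint (fun t => F (t, d)) (- R0) R0)%C with
      (- (Ci * (cint (fun s => F (R0, s)) c d - cint (fun s => F ((- R0)%R, s)) c d)))%C.
    2: { apply Ceq_minus. rewrite <- Copp_0, <- G. ring. }
    rewrite Cmod_opp, Cmod_mult. replace (Cmod Ci) with 1.
    2: { unfold Ci. rewrite Cmod_ver, Rabs_R1; auto. }
    generalize (Cmod_minus_le (cint (fun s => F (R0, s)) c d) (cint (fun s => F ((- R0)%R, s)) c d))
      (I R0 ltac:(auto)) (I (- R0) ltac:(auto)). rewrite Hl. lra. }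
  destruct (Rle_dec 0 y) as [L|L].
  - apply Main; auto; rewrite (Rabs_pos_eq y) by auto; [|lra]. intros s Hs. rewrite Rabs_pos_eq; lra.
  - rewrite Cmod_minus_sym. assert (Ey : Rabs y = - y) by (apply Rabs_left; lra).
    apply Main; try lra. intros s Hs. rewrite Ey. apply Rabs_le; lra.
Qed.

(** For large |x| both values are small in the weighted sense by rapid_vanish; the
    remaining x range over a compact rectangle. *)
Lemma weighted_uniform_continuity w h k f lam eta : weight_function w -> delta w -> 0 < k < h ->
  (forall z, strip h z -> cdiff f z) -> rapid w k f -> 0 < lam -> 0 < eta ->
  exists rho, 0 < rho /\ forall x y s, - k < y < k -> Rabs s <= rho ->
    Cmod (f (x - s, y)%R - f (x, y))%C * exp (w (lam * Rabs x)) <= eta.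
Proof.
  intros W D Hk HD HR Hl He.
  destruct (rapid_vanish w k f (2 * lam) W D HR ltac:(lra) (eta / 2) ltac:(lra)) as [X [HX V]].
  set (X1 := X + 2).
  set (E := exp (w (lam * X1))). assert (HE : 0 < E) by apply exp_pos.
  assert (HC : on_rect (ccont f) (- X1 - 1) (X1 + 1) (- k) k).
  { intros u v Hu Hv. apply cdiff_ccont, HD. split; simpl; lra. }
  destruct (ccont_uniform f _ _ _ _ HC (eta / E) ltac:(apply Rdiv_lt_0_compat; auto)) as [del [Hdel U]].
  assert (M1 := Rmin_l 1 (del / 2)). assert (M2 := Rmin_r 1 (del / 2)).
  exists (Rmin 1 (del / 2)). split. apply Rmin_glb_lt; lra.
  intros x y s Hy Hs.
  assert (Hs' := Hs). apply Rabs_le_between in Hs'.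
  destruct (Rle_dec (Rabs x) X1) as [L|L].
  - apply Rabs_le_between in L as L'.
    assert (K := U x y (x - s) y ltac:(lra) ltac:(lra) ltac:(lra) ltac:(lra)).
    replace (x - s - x) with (- s) in K by ring. rewrite Rabs_Ropp in K.
    specialize (K ltac:(lra) ltac:(rewrite Rminus_diag, Rabs_R0; lra)).
    apply Rle_trans with (eta / E * E).
    + apply Rmult_le_compat. apply Cmod_ge_0. left; apply exp_pos. lra.
      apply weight_mono; auto. apply Rmult_le_pos; [lra|apply Rabs_pos]. apply Rmult_le_compat_l; lra.
    + right; field; lra.
  - assert (T : Rabs x <= Rabs (x - s) + Rabs s).
    { replace x with ((x - s) + s) at 1 by ring. apply Rabs_triang. }
    unfold X1 in L.
    assert (V1 := V (x, y) ltac:(split; simpl; lra) ltac:(simpl; lra)).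
    assert (V2 := V (x - s, y) ltac:(split; simpl; lra) ltac:(simpl; lra)). simpl in V1, V2.
    assert (W1 : exp (w (lam * Rabs x)) <= exp (w (2 * lam * Rabs x))).
    { apply weight_mono; auto. apply Rmult_le_pos; [lra|apply Rabs_pos].
      apply Rmult_le_compat_r. apply Rabs_pos. lra. }
    assert (W2 : exp (w (lam * Rabs x)) <= exp (w (2 * lam * Rabs (x - s)))).
    { apply weight_mono; auto. apply Rmult_le_pos; [lra|apply Rabs_pos].
      replace (2 * lam * Rabs (x - s)) with (lam * (2 * Rabs (x - s))) by ring.
      apply Rmult_le_compat_l; lra. }
    assert (P := exp_pos (w (lam * Rabs x))).
    apply Rle_trans with ((Cmod (f (x - s, y)%R) + Cmod (f (x, y))) * exp (w (lam * Rabs x))).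
    { apply Rmult_le_compat_r; [lra|]. apply Cmod_minus_le. }
    apply Rmult_le_compat_l with (r := Cmod (f (x, y))) in W1; [|apply Cmod_ge_0].
    apply Rmult_le_compat_l with (r := Cmod (f (x - s, y)%R)) in W2; [|apply Cmod_ge_0]. lra.
Qed.

(** With c the mass of p(x - t) over [-R0, R0], split
    integral - f(z) = integral of (f(t + iy) - f(z)) p(x - t) - (1 - c) f(z).
    In the second term either |x| <= R0 - rho and 1 - c <= eta, or f(z) itself is
    small.  In the first one the values |x - t| <= rho are controlled by uniform
    continuity and the others by the weighted tail of p. *)
Lemma mollification_error w k f kappa p lam M eta rho R0 : weight_function w -> 0 < lam ->
  0 < M -> 0 < eta <= 1 -> 0 < rho -> rho <= R0 ->
  (forall x y, - k < y < k -> ccont f (x, y)) ->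
  (forall x y, - k < y < k -> Cmod (f (x, y)) * exp (w (2 * lam * Rabs x)) <= M) ->
  (forall x y, - k < y < k -> R0 - rho <= Rabs x -> Cmod (f (x, y)) * exp (w (2 * lam * Rabs x)) <= eta) ->
  (forall x y s, - k < y < k -> Rabs s <= rho ->
    Cmod (f (x - s, y)%R - f (x, y))%C * exp (w (lam * Rabs x)) <= eta) ->
  mollifier w (2 * lam) rho eta kappa p ->
  forall x y, - k < y < k ->
  Cmod (cint (fun t => f (t, y) * RtoC (p (x - t)%R)) (- R0) R0 - f (x, y))%C * exp (w (lam * Rabs x))
    <= (2 + 13 * M) * eta.
Proof.
  intros W Hl HM He Hrho HR Cf BM BE BU (_ & _ & P0 & Pc & P1 & P2 & P3) x y Hy.
  set (E := exp (w (lam * Rabs x))). assert (HE : 0 < E) by apply exp_pos.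
  assert (H3 : 0 <= 3 * M * eta) by (repeat apply Rmult_le_pos; lra).
  assert (W2 : E <= exp (w (2 * lam * Rabs x))).
  { apply weight_mono; auto. apply Rmult_le_pos; [lra|apply Rabs_pos].
    apply Rmult_le_compat_r. apply Rabs_pos. lra. }
  assert (Ixy : forall B, Cmod (f (x, y)) * exp (w (2 * lam * Rabs x)) <= B -> Cmod (f (x, y)) * E <= B).
  { intros B HB. eapply Rle_trans; [|exact HB]. apply Rmult_le_compat_l; auto. apply Cmod_ge_0. }
  set (q := fun t => p (x - t)%R).
  assert (Qc : forall t, continuous q t).
  { intros t. apply (continuous_comp (fun t => x - t) p); auto.
    apply (continuous_minus (V := R_NormedModule) (fun _ => x) (fun t => t)). apply continuous_const. apply continuous_id. }
  assert (Qi : RInt q (- R0) R0 = RInt p (x - R0) (x + R0)).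
  { assert (S := RInt_comp_lin (V := R_CompleteNormedModule) p (-1) x (- R0) R0 (continuous_ex_RInt _ _ _ Pc)).
    replace (-1 * - R0 + x) with (x + R0) in S by ring. replace (-1 * R0 + x) with (x - R0) in S by ring.
    rewrite <- (opp_RInt_swap (V := R_CompleteNormedModule) p) by (apply continuous_ex_RInt; auto).
    rewrite <- S. rewrite <- (RInt_opp (V := R_CompleteNormedModule)).
    - apply (RInt_ext (V := R_CompleteNormedModule)). intros t _. unfold q, opp, scal; simpl; unfold mult; simpl.
      match goal with |- @eq _ ?x ?y => change (@eq R x y) end.
      replace (-1 * t + x) with (x - t) by ring. ring.
    - apply continuous_ex_RInt. intros t.
      apply (continuous_scal_r (V := R_NormedModule) (-1) (fun t => p (-1 * t + x))).
      apply (continuous_comp (fun t => -1 * t + x) p); auto.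
      apply (continuous_plus (V := R_NormedModule) (fun t => -1 * t) (fun _ => x)); [|apply continuous_const].
      apply (continuous_scal_r (V := R_NormedModule) (-1) (fun t => t)). apply continuous_id. }
  set (c := RInt q (- R0) R0) in *.
  assert (Hc1 : c <= 1) by (rewrite Qi; apply P1; lra).
  assert (Hc0 : 0 <= c).
  { apply RInt_ge_0; try lra. apply continuous_ex_RInt; auto. intros; apply P0. }
  assert (Qp : forall t, pcont (fun t => RtoC (q t)) t).
  { intros t e Het. destruct (proj1 (filterlim_locally _ _) (Qc t) (mkposreal e Het)) as [d Hd].
    exists d. split. apply cond_pos. intros s Hs. rewrite <- RtoC_minus, Cmod_R. apply Hd. exact Hs. }
  assert (Iq : cintable (fun t => RtoC (q t)) (- R0) R0 /\ cint (fun t => RtoC (q t)) (- R0) R0 = RtoC c).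
  { apply is_cint_pair.
    - apply (RInt_correct (V := R_CompleteNormedModule)). apply continuous_ex_RInt. auto.
    - apply (is_RInt_ext (V := R_NormedModule) (fun _ => 0)). reflexivity.
      assert (Z := is_RInt_const_R 0 (- R0) R0). rewrite Rmult_0_r in Z. exact Z. }
  destruct Iq as [Iq Eq].
  assert (Pf : forall t, pcont (fun t => f (t, y) * RtoC (q t))%C t).
  { intros t. apply (pcont_mult (fun t => f (t, y)) (fun t => RtoC (q t))); auto. apply (ccont_hor f); auto. }
  assert (If : cintable (fun t => f (t, y) * RtoC (q t))%C (- R0) R0) by (apply pcont_cintable; auto; lra).
  destruct (cint_mult (f (x, y)) _ _ _ Iq) as [Ifq Efq]. rewrite Eq in Efq.
  assert (Split : (cint (fun t => f (t, y) * RtoC (p (x - t)%R)) (- R0) R0 - f (x, y))%C =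
    (cint (fun t => f (t, y) * RtoC (q t) - f (x, y) * RtoC (q t)) (- R0) R0 - f (x, y) * (1 - RtoC c))%C).
  { rewrite (cint_minus (fun t => f (t, y) * RtoC (q t))%C (fun t => f (x, y) * RtoC (q t))%C), Efq; auto.
    unfold q. ring. }
  rewrite Split.
  assert (Tail : Cmod (f (x, y) * (1 - RtoC c)) * E <= (1 + M) * eta).
  { rewrite <- RtoC_minus, Cmod_mult, Cmod_R, Rabs_pos_eq by lra.
    replace (Cmod (f (x, y)) * (1 - c) * E) with (Cmod (f (x, y)) * E * (1 - c)) by ring.
    assert (F0 : 0 <= Cmod (f (x, y)) * E) by (apply Rmult_le_pos; [apply Cmod_ge_0|lra]).
    destruct (Rle_dec (R0 - rho) (Rabs x)) as [L|L].
    - assert (F1 := Ixy _ (BE x y Hy L)). nra.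
    - assert (F1 := Ixy _ (BM x y Hy)).
      assert (c >= 1 - eta). { rewrite Qi. apply Rle_ge, P2; generalize (Rle_abs x) (Rle_abs (- x)); rewrite Rabs_Ropp; lra. }
      apply Rle_trans with (M * eta); [|lra]. apply Rmult_le_compat; lra. }
  assert (Main : Cmod (cint (fun t => f (t, y) * RtoC (q t) - f (x, y) * RtoC (q t))%C (- R0) R0) <=
    (eta * c + 3 * M * eta * (atan (x + R0) - atan (x - R0))) / E).
  { apply cint_bound with (fun t => (eta * q t + 3 * M * eta / (1 + (x - t) * (x - t))) / E); try lra.
    - apply cintable_minus; auto.
    - intros t Ht. apply Rle_div_r; auto.
      replace (f (t, y) * RtoC (q t) - f (x, y) * RtoC (q t))%C with ((f (t, y) - f (x, y)) * RtoC (q t))%C by ring.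
      rewrite Cmod_mult, Cmod_R, Rabs_pos_eq by (apply P0).
      assert (Q0 : 0 <= q t) by apply P0.
      assert (D1 : 0 < 1 + (x - t) * (x - t)) by (generalize (Rle_0_sqr (x - t)); unfold Rsqr; lra).
      assert (D0 : 0 <= 3 * M * eta / (1 + (x - t) * (x - t))) by (apply Rdiv_le_0_compat; [exact H3|exact D1]).
      destruct (Rle_dec (Rabs (x - t)) rho) as [L|L].
      + assert (B := BU x y (x - t) Hy L). replace (x - (x - t)) with t in B by ring. fold E in B.
        apply Rmult_le_compat_r with (r := q t) in B; auto. lra.
      + assert (Q3 := P3 (x - t) ltac:(lra)). fold (q t) in Q3.
        set (G := exp (w (2 * lam * Rabs (x - t)))) in *.
        assert (HG : 1 <= G). { apply weight_exp_ge1; auto. apply Rmult_le_pos; [lra|apply Rabs_pos]. }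
        assert (S := weight_split w lam x t W ltac:(lra)). fold E G in S.
        set (T := exp (w (2 * lam * Rabs t))) in *.
        assert (HT : 1 <= T). { apply weight_exp_ge1; auto. apply Rmult_le_pos; [lra|apply Rabs_pos]. }
        assert (B1 := BM t y Hy). fold T in B1.
        assert (B2 := Ixy _ (BM x y Hy)).
        assert (N1 := Cmod_ge_0 (f (t, y))). assert (N2 := Cmod_ge_0 (f (x, y))).
        assert (B3 : Cmod (f (t, y)) * E <= 2 * M * G).
        { apply Rle_trans with (Cmod (f (t, y)) * (G + T)). apply Rmult_le_compat_l; auto.
          assert (Cmod (f (t, y)) <= M) by nra. nra. }
        assert (B4 : Cmod (f (t, y) - f (x, y)) * E <= 3 * M * G).
        { assert (Tr := Cmod_minus_le (f (t, y)) (f (x, y))).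
          apply Rmult_le_compat_r with (r := E) in Tr; [|lra]. nra. }
        apply Rmult_le_compat_r with (r := q t) in B4; auto.
        apply Rmult_le_compat_l with (r := 3 * M) in Q3; [|lra].
        replace (3 * M * (eta / (1 + (x - t) * (x - t)))) with (3 * M * eta / (1 + (x - t) * (x - t))) in Q3 by (unfold Rdiv; ring).
        assert (0 <= eta * q t) by (apply Rmult_le_pos; lra). lra.
    - replace ((eta * c + 3 * M * eta * (atan (x + R0) - atan (x - R0))) / E) with
        (scal (/ E) (plus (scal eta c) (scal (-1) (3 * M * eta * (atan (x - R0) - atan (x - - R0))))))
        by (unfold scal, plus; simpl; unfold mult; simpl; replace (x - - R0) with (x + R0) by ring; field; lra).
      apply (is_RInt_ext (V := R_NormedModule) (fun t => scal (/ E) (plus (scal eta (q t))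
         (scal (-1) (scal (-1) (3 * M * eta / (1 + (-1 * t + x) * (-1 * t + x)))))))).
      { intros t _. unfold scal, plus; simpl; unfold mult; simpl.
        match goal with |- @eq _ ?x ?y => change (@eq R x y) end.
        replace (-1 * t + x) with (x - t) by ring. unfold Rdiv; ring. }
      apply (is_RInt_scal (V := R_NormedModule)). apply (is_RInt_plus (V := R_NormedModule)).
      + apply (is_RInt_scal (V := R_NormedModule)). apply (RInt_correct (V := R_CompleteNormedModule)).
        apply continuous_ex_RInt; auto.
      + apply (is_RInt_scal (V := R_NormedModule)).
        apply (is_RInt_comp_lin (V := R_NormedModule) (fun s => 3 * M * eta / (1 + s * s)) (-1) x (- R0) R0).
        replace (-1 * - R0 + x) with (x - - R0) by ring. replace (-1 * R0 + x) with (x - R0) by ring.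
        apply inv_one_plus_sqr_RInt. }
  assert (At := atan_diff (x - R0) (x + R0) ltac:(lra)).
  apply Rle_div_r in Main; auto.
  eapply Rle_trans. apply Rmult_le_compat_r. lra. apply Cmod_minus_le.
  rewrite Rmult_plus_distr_r.
  assert (eta * c <= eta) by nra.
  assert (3 * M * eta * (atan (x + R0) - atan (x - R0)) <= 3 * M * eta * 4) by (apply Rmult_le_compat_l; lra).
  lra.
Qed.

(** The oscillation of t |-> f(t) kappa(z - t) must be small in the weighted sense
    uniformly in z: for |Re z| > X1 both values are small, as kappa is evaluated
    far out; for |Re z| <= X1 uniform continuity of f and kappa on compact
    sets applies. *)
Lemma riemann_approximation w k f kappa lam R0 eta : weight_function w -> delta w -> 0 < k ->
  (forall t, ccont f (t, 0)) -> (exists M, forall t, Cmod (f (t, 0)) <= M) -> U_space w kappa ->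
  0 < lam -> 0 < R0 -> 0 < eta ->
  exists g, U_space w g /\ forall x y, - k < y < k ->
    Cmod (g (x, y) - cint (fun t => f (t, 0) * kappa ((x, y) - (t, 0))) (- R0) R0)%C * exp (w (lam * Rabs x)) <= eta.
Proof.
  intros W D Hk Cf [M HM] U Hl HR He. assert (U' := U). apply U_space_iff in U'. destruct U' as [Ud Ur].
  assert (M0 : 0 <= M). { eapply Rle_trans; [apply Cmod_ge_0|apply (HM 0)]. }
  set (e1 := eta / (2 * R0)). assert (He1 : 0 < e1) by (apply Rdiv_lt_0_compat; lra).
  destruct (Ur k Hk (2 * lam) ltac:(lra)) as [N [HN BN]].
  destruct (rapid_vanish w k kappa (2 * lam) W D (Ur k Hk) ltac:(lra) (e1 / (2 * (M + 1)))) as [X [HX V]].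
  { apply Rdiv_lt_0_compat; lra. }
  set (X1 := 2 * R0 + X). set (E := exp (w (lam * X1))). assert (HE : 0 < E) by apply exp_pos.
  set (e2 := e1 / (E * (M + N + 1))). assert (He2 : 0 < e2).
  { apply Rdiv_lt_0_compat; auto. apply Rmult_lt_0_compat; lra. }
  destruct (ccont_uniform f (- R0) R0 0 0 ltac:(intros u v Hu Hv; replace v with 0 by lra; auto) e2 He2) as [d1 [Hd1 U1]].
  destruct (ccont_uniform kappa (- X1 - R0) (X1 + R0) (- k) k ltac:(intros u v _ _; apply cdiff_ccont, Ud) e2 He2) as [d2 [Hd2 U2]].
  set (d := Rmin d1 d2). assert (Hd : 0 < d) by (apply Rmin_glb_lt; auto).
  assert (Dl := Rmin_l d1 d2). assert (Dr := Rmin_r d1 d2). fold d in Dl, Dr.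
  destruct (INR_unbounded (2 * R0 / d)) as [n Hn].
  assert (Hnd : 2 * R0 < INR n * d) by (apply Rlt_div_l in Hn; lra).
  assert (Hn0 : 0 < INR n).
  { apply Rle_lt_trans with (2 * R0 / d); auto. apply Rdiv_le_0_compat; lra. }
  set (del := 2 * R0 / INR n). assert (Hdel : 0 < del) by (apply Rdiv_lt_0_compat; lra).
  assert (Hdel2 : del < d) by (apply Rlt_div_l; lra).
  assert (Hdel3 : INR n * del = 2 * R0) by (unfold del; field; lra).
  exists (fun z => csum (fun j => RtoC del * (f (- R0 + INR j * del, 0)%R * kappa (z - RtoC (- R0 + INR j * del)%R)))%C n). split.
  { apply (U_csum w (fun j z => RtoC del * (f (- R0 + INR j * del, 0)%R * kappa (z - RtoC (- R0 + INR j * del)%R)))%C).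
    intros j. apply U_scal. apply (U_scal w (f (- R0 + INR j * del, 0)%R)). apply (U_translate w); auto. }
  intros x y Hy. set (Ex := exp (w (lam * Rabs x))). assert (HEx : 0 < Ex) by apply exp_pos.
  pose (F := fun t => (f (t, 0) * kappa ((x, y) - (t, 0)))%C).
  assert (Ez : forall t : R, ((x, y) - (t, 0))%C = (x - t, y)).
  { intros t. apply injective_projections; simpl; ring. }
  assert (Osc : forall s t, - R0 <= s <= R0 -> - R0 <= t <= R0 -> Rabs (t - s) <= del -> Cmod (F t - F s) <= e1 / Ex).
  { intros s t Hs Ht Hst. apply Rle_div_r; auto. unfold F. rewrite !Ez.
    destruct (Rle_dec (Rabs x) X1) as [L|L].
    - assert (L' := L). apply Rabs_le_between in L'.
      assert (A1 := U1 s 0 t 0 Hs ltac:(lra) Ht ltac:(lra) ltac:(lra) ltac:(rewrite Rminus_diag, Rabs_R0; lra)).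
      assert (A2 := U2 (x - s) y (x - t) y ltac:(lra) ltac:(lra) ltac:(lra) ltac:(lra)).
      replace (x - t - (x - s)) with (- (t - s)) in A2 by ring. rewrite Rabs_Ropp in A2.
      specialize (A2 ltac:(lra) ltac:(rewrite Rminus_diag, Rabs_R0; lra)).
      assert (BN' : Cmod (kappa (x - s, y)%R) <= N).
      { eapply Rle_trans; [|apply (BN (x - s, y)); split; simpl; lra].
        rewrite <- (Rmult_1_r (Cmod (kappa (x - s, y)%R))) at 1. apply Rmult_le_compat_l. apply Cmod_ge_0.
        apply weight_exp_ge1; auto. apply Rmult_le_pos; [lra|apply Rabs_pos]. }
      replace (f (t, 0%R) * kappa (x - t, y)%R - f (s, 0%R) * kappa (x - s, y)%R)%C with
        (f (t, 0%R) * (kappa (x - t, y)%R - kappa (x - s, y)%R) + (f (t, 0%R) - f (s, 0%R)) * kappa (x - s, y)%R)%C by ring.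
      assert (C1 : Cmod (f (t, 0) * (kappa (x - t, y)%R - kappa (x - s, y)%R) + (f (t, 0) - f (s, 0)) * kappa (x - s, y)%R)%C
         <= (M + N + 1) * e2).
      { eapply Rle_trans. apply Cmod_triangle. rewrite !Cmod_mult.
        assert (Cmod (f (t, 0)) * Cmod (kappa (x - t, y)%R - kappa (x - s, y)%R) <= M * e2).
        { apply Rmult_le_compat; try apply Cmod_ge_0; auto. lra. }
        assert (Cmod (f (t, 0) - f (s, 0)) * Cmod (kappa (x - s, y)%R) <= e2 * N).
        { apply Rmult_le_compat; try apply Cmod_ge_0; auto. lra. } lra. }
      apply Rle_trans with ((M + N + 1) * e2 * E).
      + apply Rmult_le_compat; auto. apply Cmod_ge_0. lra. apply weight_mono; auto.
        apply Rmult_le_pos; [lra|apply Rabs_pos]. apply Rmult_le_compat_l; lra.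
      + right. unfold e2. field. split; lra.
    - assert (Far : forall r, - R0 <= r <= R0 -> Cmod (f (r, 0) * kappa (x - r, y)%R)%C * Ex <= e1 / 2).
      { intros r Hr. assert (Hr' : Rabs r <= R0) by (apply Rabs_le; lra).
        assert (T : Rabs x <= Rabs (x - r) + Rabs r).
        { replace x with ((x - r) + r) at 1 by ring. apply Rabs_triang. }
        unfold X1 in L.
        assert (V1 := V (x - r, y) ltac:(split; simpl; lra) ltac:(simpl; lra)). simpl in V1.
        assert (Wx : Ex <= exp (w (2 * lam * Rabs (x - r)))).
        { apply weight_mono; auto. apply Rmult_le_pos; [lra|apply Rabs_pos].
          replace (2 * lam * Rabs (x - r)) with (lam * (2 * Rabs (x - r))) by ring.
          apply Rmult_le_compat_l; lra. }
        rewrite Cmod_mult, Rmult_assoc.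
        apply Rle_trans with (M * (e1 / (2 * (M + 1)))).
        - apply Rmult_le_compat; try apply Cmod_ge_0; auto.
          apply Rmult_le_pos; [apply Cmod_ge_0|lra].
          eapply Rle_trans; [|exact V1]. apply Rmult_le_compat_l; auto. apply Cmod_ge_0.
        - apply Rle_trans with ((M + 1) * (e1 / (2 * (M + 1)))).
          apply Rmult_le_compat_r; [|lra]. apply Rlt_le, Rdiv_lt_0_compat; lra.
          right. field. lra. }
      eapply Rle_trans. apply Rmult_le_compat_r; [lra|]. apply Cmod_minus_le.
      rewrite Rmult_plus_distr_r. generalize (Far t Ht) (Far s Hs). lra. }
  assert (PF : forall t, pcont F t).
  { intros t. apply (pcont_mult (fun t => f (t, 0)) (fun t => kappa ((x, y) - (t, 0))%C)).
    apply (ccont_hor f); auto.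
    assert (Ck : ccont (fun z => kappa ((x, y) - z)%C) (t, 0)).
    { apply (ccont_comp kappa (fun z => (x, y) - z)%C).
      apply cdiff_ccont. apply (cdiff_minus (fun _ => (x, y))). apply cdiff_const. apply cdiff_id.
      apply cdiff_ccont, Ud. }
    apply (ccont_hor _ _ _ Ck). }
  assert (Rs := riemann_sum_error F (- R0) del n (e1 / Ex) ltac:(lra)).
  rewrite Hdel3 in Rs. replace (- R0 + 2 * R0) with R0 in Rs by ring.
  specialize (Rs ltac:(auto) Osc). unfold F in Rs at 1 2.
  rewrite Cmod_minus_sym.
  apply Rle_trans with (2 * R0 * (e1 / Ex) * Ex).
  - apply Rmult_le_compat_r; [lra|]. exact Rs.
  - right. unfold e1. field. lra.
Qed.

(** Adds up three errors: Riemann sum against integral over the real segment,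
    real segment against the segment at height Im z, and mollification.  Their
    total is at most (4 + 13 M) eta, which explains the choice of eta. *)
Lemma U_dense_in_strip w h k f lam eps : weight_function w -> delta w -> subexponential w ->
  0 < k < h -> (forall z, strip h z -> cdiff f z) -> rapid w k f -> 0 < lam -> 0 < eps ->
  exists g, U_space w g /\ forall z, strip k z ->
    Cmod (g z - f z) * exp (w (lam * Rabs (Re z))) <= eps.
Proof.
  intros W D HS Hk HD HR Hl Heps.
  destruct (HR (2 * lam) ltac:(lra)) as [M [HM BM]].
  set (eta := Rmin 1 (eps / (4 + 13 * M))).
  assert (Heta : 0 < eta <= 1).
  { unfold eta. split. apply Rmin_glb_lt; [lra|]. apply Rdiv_lt_0_compat; lra. apply Rmin_l. }
  assert (Heta2 : (4 + 13 * M) * eta <= eps).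
  { apply Rle_trans with ((4 + 13 * M) * (eps / (4 + 13 * M))). apply Rmult_le_compat_l; [lra|apply Rmin_r].
    right; field; lra. }
  destruct (weighted_uniform_continuity w h k f lam eta W D Hk HD HR Hl ltac:(lra)) as [rho [Hrho UC]].
  destruct (mollifier_exists w (2 * lam) rho eta W D HS ltac:(lra) Hrho ltac:(lra)) as (kappa & p & Mol).
  assert (Mol' := Mol). destruct Mol' as (Uk & Ek & _).
  assert (Uk' := Uk). apply U_space_iff in Uk'. destruct Uk' as [Ud Ur].
  destruct (Ur (2 * k) ltac:(lra) (2 * lam) ltac:(lra)) as [N [HN BN]].
  (* each vertical side has length at most k and integrand at most 2 e2 N / E, so
     together they contribute at most 4 k N e2 / E *)
  set (e2 := Rmin eta (eta / (4 * k * N))).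
  assert (HkN : 0 < 4 * k * N) by (repeat apply Rmult_lt_0_compat; lra).
  assert (He2 : 0 < e2). { apply Rmin_glb_lt; [lra|]. apply Rdiv_lt_0_compat; lra. }
  assert (He2a : e2 <= eta) by apply Rmin_l.
  assert (He2b : 4 * k * N * e2 <= eta).
  { apply Rle_trans with (4 * k * N * (eta / (4 * k * N))). apply Rmult_le_compat_l; [lra|apply Rmin_r].
    right; field; lra. }
  destruct (rapid_vanish w k f (2 * lam) W D HR ltac:(lra) e2 He2) as [X [HX V]].
  set (R0 := X + rho).
  assert (Cf : forall x y, - k < y < k -> ccont f (x, y)).
  { intros x y Hy. apply cdiff_ccont, HD. split; simpl; lra. }
  assert (Bf : forall x y, - k < y < k -> Cmod (f (x, y)) <= M).
  { intros x y Hy. eapply Rle_trans; [|apply (BM (x, y)); split; simpl; lra].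
    rewrite <- (Rmult_1_r (Cmod (f (x, y)))) at 1. apply Rmult_le_compat_l. apply Cmod_ge_0.
    apply weight_exp_ge1; auto. apply Rmult_le_pos; [lra|apply Rabs_pos]. }
  destruct (riemann_approximation w k f kappa lam R0 eta W D ltac:(lra)
     ltac:(intros; apply Cf; lra) ltac:(exists M; intros; apply Bf; lra) Uk Hl ltac:(unfold R0; lra) ltac:(lra))
     as [g [Ug Rg]].
  exists g; split; auto. intros [x y] [Hy1 Hy2]. simpl in Hy1, Hy2. simpl Re.
  assert (Hy : - k < y < k) by lra.
  assert (E1 := Rg x y Hy).
  assert (E3 := mollification_error w k f kappa p lam M eta rho R0 W Hl HM Heta Hrho ltac:(unfold R0; lra) Cf
    ltac:(intros u v Hv; apply (BM (u, v)); split; simpl; lra)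
    ltac:(intros u v Hv Hu; eapply Rle_trans; [apply (V (u, v)); [split; simpl; lra| simpl; unfold R0 in Hu; lra]|lra])
    UC Mol x y Hy).
  set (E := exp (w (lam * Rabs x))) in *. assert (HE : 0 < E) by apply exp_pos.
  pose (F := fun z => (f z * kappa ((x, y) - z))%C).
  assert (E2 : Cmod (cint (fun t => F (t, 0)) (- R0) R0 - cint (fun t => F (t, y)) (- R0) R0)%C <=
    2 * Rabs y * (2 * e2 * N / E)).
  { assert (Hay : Rabs y < k) by (apply Rabs_def1; lra).
    apply contour_shift.
    - unfold R0; lra.
    - intros t s _ Hs. apply Rabs_le_between in Hs. unfold F. apply (cdiff_mult f).
      apply HD; split; simpl; lra.
      apply (cdiff_comp kappa (fun z => (x, y) - z)%C); auto.
      apply (cdiff_minus (fun _ => (x, y))). apply cdiff_const. apply cdiff_id.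
    - assert (Side : forall u s, Rabs u = R0 -> Rabs s <= Rabs y -> Cmod (F (u, s)) <= 2 * e2 * N / E).
      { intros u s Hu Hs. apply Rle_div_r; auto.
        assert (Hs' : Rabs s < k) by lra. apply Rabs_def2 in Hs'.
        assert (V1 := V (u, s) ltac:(split; simpl; lra) ltac:(simpl; rewrite Hu; unfold R0; lra)). simpl in V1.
        unfold F. replace ((x, y) - (u, s))%C with ((x - u, y - s)%R : C)
          by (apply injective_projections; simpl; ring).
        assert (B1 := BN (x - u, y - s) ltac:(split; simpl; lra)). simpl in B1.
        assert (S := weight_split w lam x u W ltac:(lra)). fold E in S.
        assert (G1 : 1 <= exp (w (2 * lam * Rabs (x - u)))).
        { apply weight_exp_ge1; auto. apply Rmult_le_pos; [lra|apply Rabs_pos]. }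
        assert (T1 : 1 <= exp (w (2 * lam * Rabs u))).
        { apply weight_exp_ge1; auto. apply Rmult_le_pos; [lra|apply Rabs_pos]. }
        set (G := exp (w (2 * lam * Rabs (x - u)))) in *. set (T := exp (w (2 * lam * Rabs u))) in *.
        rewrite Cmod_mult. set (a := Cmod (f (u, s))) in *. set (b := Cmod (kappa (x - u, y - s)%R)) in *.
        assert (Ha : 0 <= a) by apply Cmod_ge_0. assert (Hb : 0 <= b) by apply Cmod_ge_0.
        apply Rle_trans with (a * b * (G + T)). { apply Rmult_le_compat_l; auto. apply Rmult_le_pos; auto. }
        assert (a * (b * G) <= e2 * N) by (apply Rmult_le_compat; nra).
        assert (a * T * b <= e2 * N) by (apply Rmult_le_compat; nra). nra. }
      intros s Hs. split; apply Side; auto. apply Rabs_pos_eq. unfold R0; lra.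
      rewrite Rabs_Ropp. apply Rabs_pos_eq. unfold R0; lra. }
  assert (Iy : cint (fun t => F (t, y)) (- R0) R0 = cint (fun t => f (t, y) * RtoC (p (x - t)%R))%C (- R0) R0).
  { apply cint_ext. unfold R0; lra. intros t _. unfold F. f_equal. rewrite <- Ek. f_equal.
    apply injective_projections; simpl; ring. }
  rewrite Iy in E2.
  set (I0 := cint (fun t => F (t, 0)) (- R0) R0) in *.
  change (cint (fun t => f (t, 0) * kappa ((x, y) - (t, 0)))%C (- R0) R0) with I0 in E1.
  set (I1 := cint (fun t => f (t, y) * RtoC (p (x - t)%R))%C (- R0) R0) in *.
  assert (Hay : Rabs y <= k) by (apply Rabs_le; lra).
  assert (E2' : Cmod (I0 - I1) * E <= eta).
  { apply Rmult_le_compat_r with (r := E) in E2; [|lra].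
    replace (2 * Rabs y * (2 * e2 * N / E) * E) with (4 * Rabs y * N * e2) in E2 by (field; lra).
    eapply Rle_trans; [exact E2|]. eapply Rle_trans; [|exact He2b].
    apply Rmult_le_compat_r; [lra|]. apply Rmult_le_compat_r; lra. }
  replace (g (x, y) - f (x, y))%C with ((g (x, y) - I0) + ((I0 - I1) + (I1 - f (x, y))))%C by ring.
  apply Rle_trans with ((Cmod (g (x, y) - I0) + (Cmod (I0 - I1) + Cmod (I1 - f (x, y)))) * E).
  - apply Rmult_le_compat_r; [lra|]. eapply Rle_trans; [apply Cmod_triangle|].
    apply Rplus_le_compat_l. apply Cmod_triangle.
  - lra.
Qed.

(** * The main theorem *)

Lemma U_space_A_space w h f : U_space w f -> A_space w h f.
Proof.
  intros [HE HN]. split.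
  - intros z _. apply HE. exact I.
  - intros k lam Hk Hl. apply HN; lra.
Qed.

(** Neighbourhoods only involve finitely many norms, and the norms increase with k
    and lam, so a single norm controls a neighbourhood. *)
Lemma dominating_norm h (l : list (R * R)) : 0 < h ->
  (forall k lam, In (k, lam) l -> 0 < k < h /\ 0 < lam) ->
  exists k0 lam0, 0 < k0 < h /\ 0 < lam0 /\
    forall k lam, In (k, lam) l -> k <= k0 /\ lam <= lam0.
Proof.
  intros Hh. induction l as [|[k lam] l IH]; intros H.
  - exists (h / 2), 1. split; [lra|]. split; [lra|]. intros k lam [].
  - destruct IH as (k0 & lam0 & Hk0 & Hl0 & B); [intros; apply H; now right|].
    destruct (H k lam (or_introl eq_refl)) as [Hk Hl].
    exists (Rmax k0 k), (Rmax lam0 lam).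
    generalize (Rmax_l k0 k) (Rmax_r k0 k) (Rmax_l lam0 lam) (Rmax_r lam0 lam). intros.
    split; [split; [lra | apply Rmax_lub_lt; lra]|]. split; [lra|].
    intros k' lam' [E|E]; [inversion E; subst; lra|]. destruct (B _ _ E). lra.
Qed.

Lemma wnorm_lt_from_larger w k0 lam0 k lam f eps : weight_function w -> k <= k0 -> 0 < lam -> lam <= lam0 -> 0 < eps ->
  (forall z, strip k0 z -> Cmod (f z) * exp (w (lam0 * Rabs (Re z))) <= eps / 2) ->
  Rbar_lt (wnorm w k lam f) (Finite eps).
Proof.
  intros W Hk Hl Hl0 He H. apply Rbar_le_lt_trans with (Finite (eps / 2)); [|simpl; lra].
  apply wnorm_le. intros z [Hz1 Hz2].
  eapply Rle_trans; [|apply (H z); split; lra].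
  apply Rmult_le_compat_l. apply Cmod_ge_0. rewrite Rabs_mult, (Rabs_pos_eq lam) by lra.
  apply weight_mono; auto. apply Rmult_le_pos; [lra|apply Rabs_pos].
  apply Rmult_le_compat_r; auto. apply Rabs_pos.
Qed.

Theorem theorem5p9 :
  forall w : R -> R, weight_function w ->
    (nontrivial (U_space w) <-> epsilon0 w) /\
    (delta w -> forall h : R, 0 < h -> dense_in_A w h (U_space w)).
Proof.
  intros w W. split; [split|].
  - intros (f & Uf & z & Hz). apply subexponential_epsilon0; auto.
    apply NNPP. intros N. apply Hz.
    apply (A_space_trivial w (Rabs (Im z) + 1) f); auto. now apply U_space_A_space.
    generalize (Rle_abs (Im z)) (Rle_abs (- Im z)). rewrite Rabs_Ropp. split; lra.
  - intros HE. destruct (rapidly_decreasing_entire w W (epsilon0_subexponential w W HE)) as (psi & p & U & E & P).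
    exists psi. split; auto. exists (RtoC 0). rewrite E. intros Z. apply RtoC_inj in Z.
    specialize (P 0). lra.
  - intros D h Hh. split; [intros g; apply U_space_A_space|].
    intros f Af P (l & eps & Heps & Hl & HP).
    destruct (dominating_norm h l Hh Hl) as (k0 & lam0 & Hk0 & Hl0 & B).
    assert (Approx : exists g, U_space w g /\ forall z, strip k0 z ->
      Cmod (g z - f z) * exp (w (lam0 * Rabs (Re z))) <= eps / 2).
    { destruct (classic (subexponential w)) as [S|S].
      - destruct Af as [Ad An].
        apply (U_dense_in_strip w h); auto; [|apply wnorm_rapid; try lra; auto|lra].
        intros z Hz. now apply ex_derive_cdiff, Ad.
      - exists (fun _ => RtoC 0). split; [apply U_zero|]. intros z [Hz1 Hz2].
        rewrite (A_space_trivial w h f W Af S z ltac:(split; lra)).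
        replace (0 - 0)%C with (RtoC 0) by ring. rewrite Cmod_0. lra. }
    destruct Approx as (g & Ug & Hg). exists g.
    assert (Ag : A_space w h g) by now apply U_space_A_space.
    split; auto. split; auto. apply HP; auto. intros k lam Hin.
    destruct (B k lam Hin). apply (wnorm_lt_from_larger w k0 lam0); auto. apply (Hl k lam Hin).
Qed.
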